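(* For each $C>1$ there is a constant $a>0$, depending only on $C$ (and the fixed parameter $p$), such that for each $n\in\mathbb N$ with $n\ge C^2$ and each $(h,c)\in[C^{-1}n^{1/2},Cn^{1/2}]_{\mathbb Z}^2$, $$\mathbb P\left(\mathcal E_n^{h,c}\,|\,I>n\right)\ge a\,n^{-1}.$$ In particular, for such $n,h,c$, $\mathbb P(\mathcal E_n^{h,c})\ge a'\,\psi_0(n)\,n^{-1-\mu}$ with $a'>0$ a constant depending only on $C$ (and $p$).
   Context: $\mathbb N=\{1,2,\dots\}$ and $[a,b]_{\mathbb Z}=[a,b]\cap\mathbb Z$. Fix $p\in(0,1/2)$. Let $\Theta=\{\mathsf B_H,\mathsf B_C,\mathsf O_H,\mathsf O_C,\mathsf O_F\}$ (hamburger, cheeseburger, hamburger order, cheeseburger order, flexible order). Finite words in $\Theta$ are considered modulo the relations $\mathsf B_C\mathsf O_C=\mathsf B_H\mathsf O_H=\mathsf B_C\mathsf O_F=\mathsf B_H\mathsf O_F=\emptyset$, $\mathsf B_C\mathsf O_H=\mathsf O_H\mathsf B_C$, $\mathsf B_H\mathsf O_C=\mathsf O_C\mathsf B_H$. $\mathcal R(x)$ is the word $x$ reduced modulo these relations, with all burgers to the right of all orders. Let $X=(X_i)_{i\in\mathbb Z}$ be i.i.d. with $\mathbb P(\mathsf B_H)=\mathbb P(\mathsf B_C)=\frac14$, $\mathbb P(\mathsf O_H)=\mathbb P(\mathsf O_C)=\frac{1-p}4$, $\mathbb P(\mathsf O_F)=\frac p2$. For integers $a\le b$, $X(a,b)=\mathcal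 R(X_a\dots X_b)$. $\mathcal E_n^{h,c}$ is the event that $X(1,n)$ contains no orders, exactly $h$ hamburgers and exactly $c$ cheeseburgers. $I=\inf\{i\in\mathbb N: X(1,i)\text{ contains an order}\}$, so $\{I>n\}$ is the event that $X(1,n)$ contains no orders. $\mu=\frac{\pi}{2(\pi-\arctan(\sqrt{1-2p}/p))}\in(1/2,1)$. A function $\psi$ is slowly varying if $\psi(\lambda t)/\psi(t)\to1$ as $t\to\infty$ for each $\lambda>0$. It is known that there is a slowly varying function $\psi_0:[0,\infty)\to(0,\infty)$ with $\mathbb P(I>n)=\psi_0(n)n^{-\mu}$ for all $n\in\mathbb N$; $\psi_0$ is fixed.
   Formalization: The bounds are proved only for (h,c) with h+c ≤ n and h+c of the same parity as n; for all other (h,c) the event E_n^{h,c} is empty, so the claim as written fails (e.g. C=2, n=4, (h,c)=(1,2)). *)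

(* Defs.v *)
From HB Require Import structures.
From mathcomp Require Import all_boot all_order all_algebra finmap.
From mathcomp Require Import all_classical all_reals all_analysis.

Set Implicit Arguments.
Unset Strict Implicit.
Unset Printing Implicit Defensive.

Import Order.TTheory GRing.Theory Num.Theory numFieldNormedType.Exports.

Local Open Scope classical_set_scope.
Local Open Scope ring_scope.

(* hamburger, cheeseburger, hamburger order, cheeseburger order,
   flexible order *)
Inductive theta : predArgType := BH | BC | OH | OC | OF.

Definition theta_ord (x : theta) : 'I_5 :=
  match x with
  | BH => @Ordinal 5 0 isT
  | BC => @Ordinal 5 1 isT
  | OH => @Ordinal 5 2 isT
  | OC => @Ordinal 5 3 isT
  | OF => @Ordinal 5 4 isT
  end.

Definition ord_theta (i : 'I_5) : theta := nth BH [:: BH; BC; OH; OC; OF] i.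

Lemma theta_ordK : cancel theta_ord ord_theta.
Proof. by case. Qed.

HB.instance Definition _ := Finite.copy theta (can_type theta_ordK).
HB.instance Definition _ := isPointed.Build theta BH.
HB.instance Definition _ := @isMeasurable.Build default_measure_display
  theta discrete_measurable discrete_measurable0
  discrete_measurableC discrete_measurableU.

Definition is_burger (x : theta) : bool :=
  match x with BH | BC => true | _ => false end.

Definition is_order (x : theta) : bool := ~~ is_burger x.

Definition word := seq theta.

Inductive basic_rel : word -> word -> Prop :=
| rel_COC : basic_rel [:: BC; OC] [::]
| rel_HOH : basic_rel [:: BH; OH] [::]
| rel_COF : basic_rel [:: BC; OF] [::]
| rel_HOF : basic_rel [:: BH; OF] [::]
| rel_COH : basic_rel [:: BC; OH] [:: OH; BC]
| rel_HOC : basic_rel [:: BH; OC] [:: OC; BH].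

Inductive word_eq : word -> word -> Prop :=
| word_eq_refl x : word_eq x x
| word_eq_sym x y : word_eq x y -> word_eq y x
| word_eq_trans x y z : word_eq x y -> word_eq y z -> word_eq x z
| word_eq_rel u v x y : basic_rel x y -> word_eq (u ++ x ++ v) (u ++ y ++ v).

Definition orders_first (x : word) : bool :=
  pairwise (fun a b => is_burger a ==> is_burger b) x.

(* [reduce] reads a word from left to right and maintains the pair
   (unfulfilled orders, unconsumed burgers): an order consumes the rightmost
   suitable burger if there is one.  [reduceP] below characterizes it as the
   normal form of a word modulo [word_eq]. *)

Definition suitable (o b : theta) : bool :=
  match o, b with
  | OH, BH | OC, BC | OF, BH | OF, BC => true
  | _, _ => false
  end.

(* the stack of burgers is listed from right to left *)
Fixpoint serve (o : theta) (s : word) : option word :=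
  if s is b :: s' then
    if suitable o b then Some s' else omap (cons b) (serve o s')
  else None.

Definition reduce_step (st : word * word) (x : theta) : word * word :=
  if is_burger x then (st.1, x :: st.2)
  else if serve x st.2 is Some s then (st.1, s) else (rcons st.1 x, st.2).

Definition reduce_state (x : word) : word * word :=
  foldl reduce_step ([::], [::]) x.

Definition state_word (st : word * word) : word := st.1 ++ rev st.2.

Definition reduce (x : word) : word := state_word (reduce_state x).

Definition wf_state (st : word * word) : bool :=
  all is_order st.1 && all is_burger st.2.

Lemma serve_all o s s' : serve o s = Some s' -> all is_burger s ->
  all is_burger s'.
Proof.
elim: s s' => //= b s IHs s'; case: ifP => _.
  by case=> <- /andP[].
case: (serve o s) IHs => //= t IHt [<-] /andP[bb /(IHt _ erefl)] /= ->.
by rewrite bb.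
Qed.

Lemma wf_reduce_step st x : wf_state st -> wf_state (reduce_step st x).
Proof.
case: st => os s /andP[/= hos hs]; rewrite /reduce_step /=.
case: ifPn => [bx|ox]; first by rewrite /wf_state /= hos bx hs.
case E: (serve x s) => [s'|]; rewrite /wf_state /=.
  by rewrite hos (serve_all E hs).
by rewrite all_rcons hos hs andbT andbT.
Qed.

Lemma wf_reduce_foldl st x : wf_state st -> wf_state (foldl reduce_step st x).
Proof. by elim: x st => //= a x IHx st /(wf_reduce_step a)/IHx. Qed.

Lemma wf_reduce_state x : wf_state (reduce_state x).
Proof. exact: wf_reduce_foldl. Qed.

Lemma word_eq_cat2 u v x y : word_eq x y -> word_eq (u ++ x ++ v) (u ++ y ++ v).
Proof.
elim=> {x y} [x|x y _|x y z _ h1 _ h2|u' v' x y r].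
- exact: word_eq_refl.
- exact: word_eq_sym.
- exact: word_eq_trans h1 h2.
- have := word_eq_rel (u ++ u') (v' ++ v) r.
  by rewrite !catA.
Qed.

Lemma serve_word_eq o s : is_order o -> all is_burger s ->
  word_eq (rev s ++ [:: o])
    (if serve o s is Some s' then rev s' else o :: rev s).
Proof.
move=> oo; elim: s => [_|b s IHs] /=; first exact: word_eq_refl.
move=> /andP[bb /IHs{}IHs]; rewrite rev_cons cat_rcons.
case: ifPn => [sob|nsob].
  have r : basic_rel [:: b; o] [::] by case: o b sob {oo IHs bb} => -[] // _;
    constructor.
  by have := word_eq_rel (rev s) [::] r; rewrite !cats0.
have r : basic_rel [:: b; o] [:: o; b].
  by case: o b nsob oo bb {IHs} => -[] // _ _ _; constructor.
apply: word_eq_trans (_ : word_eq (rev s ++ [:: o; b]) _).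
  by have := word_eq_rel (rev s) [::] r; rewrite !cats0.
have := word_eq_cat2 [::] [:: b] IHs; rewrite /= -catA /=.
by case: (serve o s) => [s'|] /=; rewrite ?rev_cons -!cats1.
Qed.

Lemma reduce_step_word_eq st x : wf_state st ->
  word_eq (state_word st ++ [:: x]) (state_word (reduce_step st x)).
Proof.
case: st => os s /andP[/= hos hs]; rewrite /reduce_step /state_word /=.
case: ifPn => [bx|ox] /=.
  rewrite rev_cons -cats1 catA; exact: word_eq_refl.
have := word_eq_cat2 os [::] (serve_word_eq ox hs).
rewrite !cats0 catA.
by case: (serve x s) => [s'|] //=; rewrite cat_rcons.
Qed.

Lemma reduce_word_eq x : word_eq x (reduce x).
Proof.
suff H st : wf_state st ->
    word_eq (state_word st ++ x) (state_word (foldl reduce_step st x)).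
  exact: (H ([::], [::])).
elim: x st => [|a x IHx] st wst /=; first by rewrite cats0; exact: word_eq_refl.
apply: word_eq_trans (IHx _ (wf_reduce_step a wst)).
have := word_eq_cat2 [::] x (reduce_step_word_eq a wst).
by rewrite /= -catA.
Qed.

Lemma orders_first_reduce x : orders_first (reduce x).
Proof.
have := wf_reduce_state x; rewrite /reduce.
case: (reduce_state x) => os s /andP[/= hos]; rewrite -all_rev => hs.
rewrite /orders_first /state_word /=; elim: os hos => [_|o os IHos] /=.
  elim: (rev s) hs => //= b s' IHs /andP[_ hs]; rewrite IHs// andbT.
  by apply/allP => c /(allP hs) ->; exact: implybT.
move=> /andP[/negbTE oo /IHos ->]; rewrite andbT.
by apply/allP => c _; rewrite oo.
Qed.

Lemma foldl_burgers os s x : all is_burger x ->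
  foldl reduce_step (os, s) x = (os, rev x ++ s).
Proof.
elim: x s => //= a x IHx s /andP[ba bx].
have -> : reduce_step (os, s) a = (os, a :: s) by rewrite /reduce_step ba.
by rewrite IHx// rev_cons cat_rcons.
Qed.

Lemma reduce_id x : orders_first x -> reduce x = x.
Proof.
rewrite /reduce /reduce_state => xo.
suff H os : state_word (foldl reduce_step (os, [::]) x) = os ++ x by exact: H.
elim: x os xo => [|a x IHx] os /=; first by rewrite /state_word.
rewrite /orders_first /= => /andP[ax xo].
case: (boolP (is_burger a)) => [ba|oa].
  have -> : reduce_step (os, [::]) a = (os, [:: a]) by rewrite /reduce_step ba.
  have bx : all is_burger x.
    by apply/allP => c cx; have := allP ax c cx; rewrite /= ba.
  rewrite foldl_burgers//.
  by rewrite /state_word /= rev_cat revK.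
have -> : reduce_step (os, [::]) a = (rcons os a, [::]).
  by rewrite /reduce_step (negbTE oa).
by rewrite IHx// cat_rcons.
Qed.

Lemma word_eq_reduce x y : word_eq x y -> reduce x = reduce y.
Proof.
rewrite /reduce /reduce_state.
elim=> {x y} [x|x y _ ->|x y z _ -> _ ->|u v x y r] //.
rewrite !foldl_cat; move: (foldl _ _ u) => [os s].
suff -> : foldl reduce_step (os, s) x = foldl reduce_step (os, s) y by [].
case: r => //=; rewrite /reduce_step /=.
  by case: (serve OH s).
by case: (serve OC s).
Qed.

Lemma reduceP x y : word_eq x y /\ orders_first y <-> y = reduce x.
Proof.
split=> [[/word_eq_reduce -> /reduce_id ->] //|->].
by split; [exact: reduce_word_eq|exact: orders_first_reduce].
Qed.

Lemma has_order_reduce_cat x y :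
  has is_order (reduce x) -> has is_order (reduce (x ++ y)).
Proof.
have E z : has is_order (reduce z) = ((reduce_state z).1 != [::]).
  have := wf_reduce_state z; rewrite /reduce /state_word.
  case: (reduce_state z) => os s /andP[/= hos hs].
  rewrite has_cat has_rev; have -> : has is_order s = false.
    by apply/negbTE; rewrite -all_predC; apply: sub_all hs => c; rewrite /= negbK.
  by case: os hos => //= o os /andP[->].
rewrite !E /reduce_state foldl_cat; elim: y (foldl _ _ x) => //= a y IHy st h.
apply: IHy; rewrite /reduce_step; case: ifP => // _.
by case: (serve a st.2) => //=; case: (st.1).
Qed.

Lemma size_serve o s s' : serve o s = Some s' -> size s = (size s').+1.
Proof.
elim: s s' => //= b s IHs s'; case: ifP => _; first by case=> <-.
by case: (serve o s) IHs => //= t IHt [<-]; rewrite (IHt _ erefl).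
Qed.

Lemma size_reduce x :
  (size (reduce x) <= size x)%N /\ odd (size (reduce x)) = odd (size x).
Proof.
elim/last_ind: x => [//|x a]; rewrite /reduce /reduce_state -cats1 foldl_cat /=.
case: (foldl _ _ x) => os s; rewrite /reduce_step /state_word /=.
rewrite !size_cat !size_rev addn1 => -[le_x odd_x].
case: ifP => _ /=; last case E: (serve a s) => [s'|] /=.
- by rewrite addnS ltnS le_x /= odd_x.
- move: le_x odd_x; rewrite (size_serve E) addnS => le_x <-.
  by split; [exact/ltnW/ltnW|rewrite /= negbK].
- by rewrite size_rcons addSn ltnS le_x /= odd_x.
Qed.

Section independence.
Context {d d'} {T : measurableType d} {T' : measurableType d'} {R : realType}
  (P : probability T R) {I : choiceType}.

Definition mutually_independent (X : I -> {RV P >-> T'}) : Prop :=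
  forall (J : {fset I}) (A : I -> set T'), (forall i, measurable (A i)) ->
    (P (\bigcap_(i in [set` J]) (X i @^-1` A i)) =
     \prod_(i <- J) P (X i @^-1` A i))%E.

End independence.

Definition theta_law {R : realType} (p : R) (x : theta) : R :=
  match x with
  | BH | BC => 1 / 4
  | OH | OC => (1 - p) / 4
  | OF => p / 2
  end.

Section burger_sequence.
Context {d} {T : measurableType d} {R : realType} {P : probability T R}.
Implicit Types (X : int -> {RV P >-> theta}) (w : T).

Definition iid_theta (p : R) X : Prop :=
  mutually_independent X /\
  forall i x, distribution P (X i) [set x] = (theta_law p x)%:E.

(* X_a ... X_b, empty when b < a *)
Definition letters X (a b : int) w : word :=
  if a <= b then [seq X (a + k%:Z) w | k <- iota 0 `|b - a|.+1] else [::].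

Definition Xred X (a b : int) w : word := reduce (letters X a b w).

Definition event_E X (n h c : nat) : set T :=
  [set w | [/\ ~~ has is_order (Xred X 1 n%:Z w),
               count_mem BH (Xred X 1 n%:Z w) = h &
               count_mem BC (Xred X 1 n%:Z w) = c]].

(* ereal-valued: the infimum is +oo if no order ever appears *)
Definition first_order_time X w : \bar R :=
  ereal_inf [set (i%:R)%:E | i in
    [set i : nat | (0 < i)%N /\ has is_order (Xred X 1 i%:Z w)]].

Definition event_I_gt X (n : nat) : set T :=
  [set w | ((n%:R)%:E < first_order_time X w)%E].

Lemma letters1 X (n : nat) w :
  letters X 1 n%:Z w = [seq X (1 + k%:Z) w | k <- iota 0 n].
Proof.
rewrite /letters; case: n => [|n] //.
by rewrite lez_nat /= subn1.
Qed.

Lemma event_I_gtE X (n : nat) :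
  event_I_gt X n = [set w | ~~ has is_order (Xred X 1 n%:Z w)].
Proof.
apply/seteqP; split => w /=.
  rewrite /event_I_gt /= ltNge; apply: contra => hn; apply: ereal_inf_lbound.
  by exists n => //; split=> //; case: n hn => //; rewrite /Xred letters1.
move=> hn; rewrite /event_I_gt /=.
apply: (@lt_le_trans _ _ (n.+1%:R)%:E); first by rewrite lte_fin ltr_nat.
apply: le_ereal_inf_tmp => _ [i [_ hi] <-].
rewrite lee_fin ler_nat ltnNge; apply: contra hn => lein.
move: hi; rewrite /Xred !letters1 -(subnKC lein) iotaD map_cat.
exact: has_order_reduce_cat.
Qed.

(* Every letter changes (number of burgers) - (number of orders) by one, so
   [event_E] is empty unless h + c is at most n and has the parity of n. *)
Lemma event_E_admissible X (n h c : nat) w :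
  event_E X n h c w -> (h + c <= n)%N /\ odd (h + c) = odd n.
Proof.
rewrite /event_E /= /Xred !letters1 => -[noo <- <-].
have := size_reduce [seq X (1 + k%:Z) w | k <- iota 0 n].
rewrite size_map size_iota; set y := reduce _ in noo *.
suff -> : size y = (count_mem BH y + count_mem BC y)%N by [].
elim: y noo => //= b y IHy; rewrite negb_or negbK => /andP[bb /IHy ->].
by case: b bb => //= _; rewrite ?add0n ?add1n ?addnS.
Qed.

End burger_sequence.

Definition cond_prob {d} {T : measurableType d} {R : realType}
    (P : probability T R) (A B : set T) : R :=
  fine (P (A `&` B)) / fine (P B).

Definition mu {R : realType} (p : R) : R :=
  pi / (2 * (pi - atan (Num.sqrt (1 - 2 * p) / p))).

Definition slowly_varying {R : realType} (psi : R -> R) : Prop :=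
  forall lambda : R, 0 < lambda ->
    psi (lambda * t) / psi t @[t --> +oo] --> (1 : R).

(* Main.v *)
(* Let S be the number of burgers minus the number of orders of a reduced word,
   a simple random walk in the length of the word, and let M be the discrepancy
   between its hamburgers and cheeseburgers, orders being counted negatively. M
   is additive up to the number of flexible orders.  Decomposing a word at its
   shortest suffix containing a burger gives E[M^2] >= (1 - 2p) k and a matching
   bound for the fourth moment; comparing M^2 and S^2 at the last time without
   burgers shows that the expected number of flexible orders of X(1,k) is
   o(sqrt k).  Hence at scale sqrt k the pair (S, M) enters each open quadrant
   with probability bounded below.

   Local estimate: from a stack whose two counts are of order sqrt t, any target
   of the same size and parity is reached alive in t steps with probability of
   order 1/t.  Blocks of letters steer the stack close to the target.  Then the
   kinds of the letters (burger, order, flexible order) are frozen: they pin the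
   number of burgers at the price of a factor 1/sqrt t, and the remaining
   randomness is one fair coin per letter.  Changing one coin changes the
   discrepancy D of the stack by at most 2, so {D = d} contains, up to events of
   low stacks, the boundary of {D >= d} in the discrete cube; an isoperimetric
   inequality gives this boundary a probability of order 1/sqrt t.  Averaging
   over the level below which a stack counts as low makes the correction small.

   Finally P(I > n) is regularly varying of index -mu > -1, so given I > m the
   expectation of S^2 is O(m).  A block of length comparable to m that starts
   with few burgers of one type leaves an order unfulfilled with probability
   bounded below; as P(I > 2m) is comparable to P(I > m), given I > m with m
   close to n/4 the stack has, at some time before 2m and with probability
   bounded below, both counts of order sqrt m, and the local estimate applies. *)

Require Import Defs.
From HB Require Import structures.
From mathcomp Require Import all_boot all_order all_algebra finmap.
From mathcomp Require Import all_classical all_reals all_analysis.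
From mathcomp Require Import ring lra zify.

Import Order.TTheory GRing.Theory Num.Theory numFieldNormedType.Exports.

Set Implicit Arguments.
Unset Strict Implicit.
Unset Printing Implicit Defensive.

Local Open Scope classical_set_scope.
Local Open Scope ring_scope.

(** * Acting on a stack of burgers *)

(** The obstacle is that the discrepancy is not a random walk: a flexible order acts on the top
    burger, whose kind depends on the whole past. Nothing explicit is known about its law, so only
    moments, the exchange symmetry of the two kinds and one-letter Lipschitz bounds are available.
    The bound on flexible orders rests on a contradiction. Times without burgers are renewal times,
    and the maximum of -S is a sum of contributions of the renewal blocks. If their means stayed
    bounded while the expected number of such times diverges, single blocks would be negligible at
    scale sqrt k. The maximum of -S, whose second moment is k - O(sqrt k), would then be carried by
    the last time without burgers. There the discrepancy is a sum of sign-symmetric small blocks, of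
    variance o(k), and comparing M^2 with S^2 bounds the second moment of S at that time by 2pk plus
    a small multiple of k. This is impossible since 2p < 1. The order 1/t of the local estimate
    needs two factors 1/sqrt t at once; coins that stay fair once the kinds are frozen provide the
    second one without any joint local limit theorem. *)

Definition act (s x : word) : word * word := foldl reduce_step ([::], s) x.
Definition orders (x : word) : word := (reduce_state x).1.
Definition stack (x : word) : word := (reduce_state x).2.

Lemma reduce_stateE x : reduce_state x = (orders x, stack x).
Proof. by rewrite /orders /stack; case: (reduce_state x). Qed.

Lemma orders_all x : all is_order (orders x).
Proof. by have /andP[] := wf_reduce_state x. Qed.

Lemma stack_all x : all is_burger (stack x).
Proof. by have /andP[] := wf_reduce_state x. Qed.

Lemma act_stack_all s x : all is_burger s -> all is_burger (act s x).2.
Proof.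
move=> hs; have := @wf_reduce_foldl ([::], s) x.
by rewrite /wf_state /= hs => /(_ isT)/andP[].
Qed.

Lemma serve_cat o s1 s2 : serve o (s1 ++ s2) =
  if serve o s1 is Some s then Some (s ++ s2) else omap (cat s1) (serve o s2).
Proof.
elim: s1 => [|b s1 IH] /=; first by case: (serve o s2).
case: ifP => // _; rewrite IH.
by case: (serve o s1) => //; case: (serve o s2).
Qed.

Lemma reduce_step_ord o os s : is_order o -> reduce_step (os, s) o =
  if serve o s is Some s' then (os, s') else (rcons os o, s).
Proof. by rewrite /reduce_step /is_order => /negbTE ->. Qed.

Lemma act_rcons s w x :
  act s (rcons w x) = reduce_step ((act s w).1, (act s w).2) x.
Proof. by rewrite /act -cats1 foldl_cat /=; case: (foldl _ _ w). Qed.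

(* Reading [v] above the stack [s], the orders that are unfulfilled within [v]
   are passed on to [s]; the burgers of [v] stay on top. *)
Lemma foldl_reduce_step os s v :
  foldl reduce_step (os, s) v =
  (os ++ (act s (orders v)).1, stack v ++ (act s (orders v)).2).
Proof.
elim/last_ind: v => [|v x IH]; first by rewrite /act /= cats0.
rewrite -cats1 foldl_cat IH; cbn [foldl].
have E : reduce_state (v ++ [:: x]) = reduce_step (orders v, stack v) x.
  by rewrite /reduce_state foldl_cat -/(reduce_state v) reduce_stateE.
rewrite [orders (v ++ _)]/orders [stack (v ++ _)]/stack E.
case: (boolP (is_burger x)) => bx.
  by rewrite /reduce_step bx.
rewrite !reduce_step_ord// serve_cat.
case: (serve x (stack v)) => [s'|] //=.
rewrite !act_rcons.
case: (act s (orders v)) => o1 s1 /=.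
rewrite reduce_step_ord//; case: (serve x s1) => [s2|] //=.
by rewrite rcons_cat.
Qed.

Lemma actE s v : act s v =
  ((act s (orders v)).1, stack v ++ (act s (orders v)).2).
Proof. exact: foldl_reduce_step. Qed.

Lemma reduce_state_cat u v : reduce_state (u ++ v) =
  (orders u ++ (act (stack u) (orders v)).1,
   stack v ++ (act (stack u) (orders v)).2).
Proof.
by rewrite /reduce_state foldl_cat -/(reduce_state u) reduce_stateE
  foldl_reduce_step.
Qed.

Lemma orders_cat u v :
  orders (u ++ v) = orders u ++ (act (stack u) (orders v)).1.
Proof. by rewrite {1}/orders reduce_state_cat. Qed.

Lemma stack_cat u v :
  stack (u ++ v) = stack v ++ (act (stack u) (orders v)).2.
Proof. by rewrite {1}/stack reduce_state_cat. Qed.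

Lemma act_cat s u v : act s (u ++ v) =
  ((act s u).1 ++ (act (act s u).2 v).1, (act (act s u).2 v).2).
Proof.
rewrite {1}/act foldl_cat -/(act s u); case: (act s u) => o1 s1 /=.
by rewrite foldl_reduce_step (actE s1 v).
Qed.

Definition alive (s x : word) : bool := (act s x).1 == [::].

Lemma alive_cat s u v : alive s (u ++ v) = alive s u && alive (act s u).2 v.
Proof. by rewrite /alive act_cat /=; case: (act s u).1. Qed.

Lemma alive_nil s : alive s [::].
Proof. by []. Qed.

Definition cH (s : word) : nat := count_mem BH s.
Definition cC (s : word) : nat := count_mem BC s.
Definition kH (w : word) : nat := count_mem OH w.
Definition kC (w : word) : nat := count_mem OC w.
Definition kF (w : word) : nat := count_mem OF w.

Arguments cH : simpl never.
Arguments cC : simpl never.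
Arguments kH : simpl never.
Arguments kC : simpl never.
Arguments kF : simpl never.

Lemma cH_cat s1 s2 : cH (s1 ++ s2) = (cH s1 + cH s2)%N.
Proof. exact: count_cat. Qed.

Lemma cC_cat s1 s2 : cC (s1 ++ s2) = (cC s1 + cC s2)%N.
Proof. exact: count_cat. Qed.

Lemma c_cons b s : (cH (b :: s) = (if b is BH then 1 else 0) + cH s)%N /\
  (cC (b :: s) = (if b is BC then 1 else 0) + cC s)%N.
Proof. by case: b. Qed.

Lemma k_nil : [/\ kH [::] = 0%N, kC [::] = 0%N & kF [::] = 0%N].
Proof. by []. Qed.

Lemma k_cat w1 w2 : [/\ (kH (w1 ++ w2) = kH w1 + kH w2)%N,
  (kC (w1 ++ w2) = kC w1 + kC w2)%N & (kF (w1 ++ w2) = kF w1 + kF w2)%N].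
Proof. by split; exact: count_cat. Qed.

Lemma k_rcons w x :
  [/\ (kH (rcons w x) = kH w + if x is OH then 1 else 0)%N,
      (kC (rcons w x) = kC w + if x is OC then 1 else 0)%N &
      (kF (rcons w x) = kF w + if x is OF then 1 else 0)%N].
Proof. by rewrite -cats1; have [-> -> ->] := k_cat w [:: x]; case: x. Qed.

Definition oH (x : word) : nat := kH (orders x).
Definition oC (x : word) : nat := kC (orders x).
Definition oF (x : word) : nat := kF (orders x).
Definition no (x : word) : nat := size (orders x).
Definition nH (x : word) : nat := cH (stack x).
Definition nC (x : word) : nat := cC (stack x).

Lemma size_burgers s : all is_burger s -> size s = (cH s + cC s)%N.
Proof.
elim: s => //= b s IH /andP[bb /IH ->].
have [-> ->] := c_cons b s.
by case: b bb => // _; lia.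
Qed.

Lemma size_orders_count w : all is_order w ->
  size w = (kH w + kC w + kF w)%N.
Proof.
elim/last_ind: w => // w x IH; rewrite all_rcons size_rcons => /andP[ox /IH ->].
have [-> -> ->] := k_rcons w x.
by case: x ox => // _; lia.
Qed.

Lemma noE x : no x = (oH x + oC x + oF x)%N.
Proof. exact: size_orders_count (orders_all x). Qed.

Lemma serveH s : all is_burger s ->
  if serve OH s is Some s' then cH s = (cH s').+1 /\ cC s = cC s'
  else cH s = 0%N.
Proof.
elim: s => //= b s IH /andP[bb /IH {IH}].
have [-> ->] := c_cons b s.
case: b bb => //= _; case: (serve OH s) => [s'|] //= [-> ->].
by have [-> ->] := c_cons BC s'; lia.
Qed.

Lemma serveC s : all is_burger s ->
  if serve OC s is Some s' then cC s = (cC s').+1 /\ cH s = cH s'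
  else cC s = 0%N.
Proof.
elim: s => //= b s IH /andP[bb /IH {IH}].
have [-> ->] := c_cons b s.
case: b bb => //= _; case: (serve OC s) => [s'|] //= [-> ->].
by have [-> ->] := c_cons BH s'; lia.
Qed.

Lemma serveF s : all is_burger s ->
  serve OF s = if s is _ :: s' then Some s' else None.
Proof. by case: s => // b s /= /andP[]; case: b. Qed.

Lemma serve_count o s : is_order o -> all is_burger s ->
  if serve o s is Some s' then exists eH eC : nat,
    [/\ (cH s = cH s' + (if o is OH then 1 else 0) + eH)%N,
        (cC s = cC s' + (if o is OC then 1 else 0) + eC)%N &
        (eH + eC = if o is OF then 1 else 0)%N]
  else match o with
       | OH => cH s = 0%N
       | OC => cC s = 0%N
       | _ => s = [::]
       end.
Proof.
move=> oo hs; case: o oo => // _.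
- have := serveH hs; case: (serve OH s) => // s' [-> ->].
  by exists 0%N, 0%N; split; lia.
- have := serveC hs; case: (serve OC s) => // s' [-> ->].
  by exists 0%N, 0%N; split; lia.
- rewrite serveF//; case: s hs => // b s /andP[bb _].
  have [-> ->] := c_cons b s; case: b bb => // _.
    by exists 1%N, 0%N; split; lia.
  by exists 0%N, 1%N; split; lia.
Qed.

(* [eH] and [eC] count the hamburgers and cheeseburgers of [s] consumed by the
   flexible orders of [w]. *)
Lemma act_count s w : all is_burger s -> all is_order w ->
  exists eH eC : nat,
  [/\ (cH (act s w).2 + kH w + eH = cH s + kH (act s w).1)%N,
      (cC (act s w).2 + kC w + eC = cC s + kC (act s w).1)%N &
      (kF w = kF (act s w).1 + eH + eC)%N].
Proof.
move=> hs; elim/last_ind: w => [_|w x IH].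
  by exists 0%N, 0%N; split; rewrite //= addn0.
rewrite all_rcons => /andP[ox /IH [eH [eC [E1 E2 E3]]]].
rewrite act_rcons reduce_step_ord//.
have [-> -> ->] := k_rcons w x.
have := serve_count ox (act_stack_all w hs).
case: (serve x (act s w).2) => [s'|] => [[fH [fC [F1 F2 F3]]]|F].
  by exists (eH + fH)%N, (eC + fC)%N; cbn [fst snd]; split; lia.
exists eH, eC; cbn [fst snd].
have [-> -> ->] := k_rcons (act s w).1 x; split; lia.
Qed.

(** A flexible order may take a burger of either kind, so it is charged to both; with this reserve
    the identities of [act_count] leave no room for a first unfulfilled order. *)
Lemma act_served s w : all is_burger s -> all is_order w ->
  (kH w + kF w <= cH s)%N -> (kC w + kF w <= cC s)%N -> (act s w).1 = [::].
Proof.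
move=> hs; elim/last_ind: w => [//|w x IH].
rewrite all_rcons act_rcons => /andP[ox ow].
have [-> -> ->] := k_rcons w x => lH lC.
have {IH}E : (act s w).1 = [::] by apply: IH => //; lia.
have [eH [eC []]] := act_count hs ow.
have -> : kH (act s w).1 = 0%N by rewrite E.
have -> : kC (act s w).1 = 0%N by rewrite E.
have -> : kF (act s w).1 = 0%N by rewrite E.
rewrite reduce_step_ord// => E1 E2 E3.
have := serve_count ox (act_stack_all w hs).
case: (serve x (act s w).2) => [//|F]; exfalso.
case: x ox F lH lC => // _ F lH lC; try lia.
have : cH (act s w).2 = 0%N by rewrite F.
have : cC (act s w).2 = 0%N by rewrite F.
by lia.
Qed.

Lemma alive_suff s x : all is_burger s ->
  (oH x + oF x <= cH s)%N -> (oC x + oF x <= cC s)%N -> alive s x.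
Proof.
move=> hs lH lC; rewrite /alive actE /=; apply/eqP.
by apply: act_served => //; exact: orders_all.
Qed.

Lemma alive_act s x : all is_burger s -> alive s x ->
  exists eH eC : nat,
  [/\ (cH (act s x).2 + oH x + eH = cH s + nH x)%N,
      (cC (act s x).2 + oC x + eC = cC s + nC x)%N &
      (oF x = eH + eC)%N].
Proof.
move=> hs; rewrite /alive actE /= => /eqP E.
have [eH [eC []]] := act_count hs (orders_all x).
rewrite E; have [-> -> ->] := k_nil => E1 E2 E3; exists eH, eC.
rewrite /oH /oC /oF /nH /nC cH_cat cC_cat.
by move: E1 E2 E3; split; lia.
Qed.

Lemma aliveW s x : all is_burger s -> alive s x ->
  (oH x <= cH s)%N /\ (oC x <= cC s)%N.
Proof.
move=> hs; rewrite /alive actE /= => /eqP E.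
have [eH [eC []]] := act_count hs (orders_all x).
by rewrite E /oH /oC; have [-> -> ->] := k_nil => E1 E2 E3; split; lia.
Qed.

Lemma act_sub s w : [/\ (kH (act s w).1 <= kH w)%N,
  (kC (act s w).1 <= kC w)%N & (kF (act s w).1 <= kF w)%N].
Proof.
elim/last_ind: w => [|w x [IH1 IH2 IH3]]; first by split.
rewrite act_rcons /reduce_step; have [-> -> ->] := k_rcons w x.
case: ifP => _; first by split; apply: leq_trans (leq_addr _ _).
case: (serve x _) => [s'|]; first by split; apply: leq_trans (leq_addr _ _).
by cbn [fst]; have [-> -> ->] := k_rcons (act s w).1 x; split; rewrite leq_add2r.
Qed.

(** [eH] and [eC] count the flexible orders of [v] fulfilled by the stack of [u]. They are the only
    defect of additivity; they cancel in [netS] but not in [discM]. *)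
Lemma cat_count u v : exists eH eC : nat,
  [/\ (nH (u ++ v) + oH v + oH u + eH = nH u + nH v + oH (u ++ v))%N,
      (nC (u ++ v) + oC v + oC u + eC = nC u + nC v + oC (u ++ v))%N,
      (oF u + oF v = oF (u ++ v) + eH + eC)%N,
      (oH u <= oH (u ++ v) <= oH u + oH v)%N &
      (oC u <= oC (u ++ v) <= oC u + oC v)%N] /\
      ((oF u <= oF (u ++ v))%N /\ (eH + eC <= oF v)%N).
Proof.
have [eH [eC [E1 E2 E3]]] := act_count (stack_all u) (orders_all v).
exists eH, eC; rewrite /nH /nC /oH /oC /oF orders_cat stack_cat.
rewrite cH_cat cC_cat; have [-> -> ->] := k_cat (orders u) (act (stack u) (orders v)).1.
have [] := act_sub (stack u) (orders v).
by split; [split|split]; lia.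
Qed.

Lemma no_cat u v : (no (u ++ v) <= no u + no v)%N.
Proof. by have [eH [eC [[]]]] := cat_count u v; rewrite !noE; lia. Qed.

Lemma no_catl u v : (no u <= no (u ++ v))%N.
Proof. by have [eH [eC [[]]]] := cat_count u v; rewrite !noE; lia. Qed.

Lemma oF_cat u v : (oF (u ++ v) <= oF u + oF v)%N.
Proof. by have [eH [eC [[]]]] := cat_count u v; lia. Qed.

(** * Exchange symmetry of the two kinds of burgers *)

Definition flip (x : theta) : theta :=
  match x with BH => BC | BC => BH | OH => OC | OC => OH | OF => OF end.

Lemma flipK : involutive flip. Proof. by case. Qed.

Lemma is_burger_flip x : is_burger (flip x) = is_burger x.
Proof. by case: x. Qed.

Lemma serve_flip o s :
  serve (flip o) (map flip s) = omap (map flip) (serve o s).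
Proof.
elim: s => //= b s ->; have -> : suitable (flip o) (flip b) = suitable o b.
  by case: o; case: b.
by case: ifP => // _; case: (serve o s).
Qed.

Lemma foldl_flip os s x :
  foldl reduce_step (map flip os, map flip s) (map flip x) =
  (map flip (foldl reduce_step (os, s) x).1,
   map flip (foldl reduce_step (os, s) x).2).
Proof.
elim: x os s => //= a x IH os s.
rewrite {2}/reduce_step {3}/reduce_step {4}/reduce_step /= is_burger_flip.
case: ifP => _; first by rewrite -IH.
rewrite serve_flip; case: (serve a s) => [s'|] /=; rewrite -IH //.
by rewrite map_rcons.
Qed.

Lemma orders_flip x : orders (map flip x) = map flip (orders x).
Proof. by rewrite /orders /reduce_state (foldl_flip [::] [::]). Qed.

Lemma stack_flip x : stack (map flip x) = map flip (stack x).
Proof. by rewrite /stack /reduce_state (foldl_flip [::] [::]). Qed.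

Lemma count_flip t s : count_mem t (map flip s) = count_mem (flip t) s.
Proof.
rewrite count_map; apply: eq_count => x /=.
by rewrite -(inj_eq (can_inj flipK)) flipK.
Qed.

Lemma stats_flip x :
  [/\ nH (map flip x) = nC x, nC (map flip x) = nH x,
      oH (map flip x) = oC x, oC (map flip x) = oH x &
      oF (map flip x) = oF x].
Proof.
by rewrite /nH /nC /oH /oC /oF /cH /cC /kH /kC /kF orders_flip stack_flip !count_flip.
Qed.

Lemma no_flip x : no (map flip x) = no x.
Proof. by rewrite /no orders_flip size_map. Qed.

Lemma has_order_reduceE x : has is_order (reduce x) = (orders x != [::]).
Proof.
rewrite /reduce /state_word reduce_stateE /= has_cat has_rev.
have -> : has is_order (stack x) = false.
  by apply/negbTE; rewrite -all_predC; apply: sub_all (stack_all x) => c; rewrite /= negbK.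
rewrite orbF; have := orders_all x.
by case: (orders x) => //= a s /andP[->].
Qed.

Lemma count_reduce (a : pred theta) x :
  count a (reduce x) = (count a (orders x) + count a (stack x))%N.
Proof. by rewrite /reduce /state_word reduce_stateE count_cat count_rev. Qed.

(** * Expectations over words, discrepancy and moments *)

Section word_expectation.
Context {R : realType} (p : R).

Definition letter_ex (F : theta -> R) : R :=
  1 / 4 * F BH + 1 / 4 * F BC + (1 - p) / 4 * F OH + (1 - p) / 4 * F OC +
  p / 2 * F OF.

(** The recursion on the first letter turns all estimates into finite computations; [sample_prob]
    links them to the sequence [X]. *)
Fixpoint word_ex (k : nat) (F : word -> R) : R :=
  if k is k'.+1 then letter_ex (fun t => word_ex k' (fun x => F (t :: x)))
  else F [::].

Local Notation Lx := letter_ex.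
Local Notation Ex := word_ex.

Lemma Ex_ext k F G : (forall x, size x = k -> F x = G x) -> Ex k F = Ex k G.
Proof.
elim: k F G => [|k IH] F G FG /=; first exact: FG.
have E t : Ex k (fun x => F (t :: x)) = Ex k (fun x => G (t :: x)).
  by apply: IH => x xk; apply: FG; rewrite /= xk.
by rewrite /letter_ex !E.
Qed.

Lemma ExD k F G : Ex k (fun x => F x + G x) = Ex k F + Ex k G.
Proof. by elim: k F G => //= k IH F G; rewrite /letter_ex !IH; ring. Qed.

Lemma ExZ k c F : Ex k (fun x => c * F x) = c * Ex k F.
Proof. by elim: k F => //= k IH F; rewrite /letter_ex !IH; ring. Qed.

Lemma ExZr k c F : Ex k (fun x => F x * c) = Ex k F * c.
Proof. by elim: k F => //= k IH F; rewrite /letter_ex !IH; ring. Qed.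

Lemma Ex_cst k c : Ex k (fun=> c) = c.
Proof. by elim: k => //= k IH; rewrite /letter_ex !IH; field. Qed.

Lemma ExN k F : Ex k (fun x => - F x) = - Ex k F.
Proof. by elim: k F => //= k IH F; rewrite /letter_ex !IH; ring. Qed.

Lemma ExB k F G : Ex k (fun x => F x - G x) = Ex k F - Ex k G.
Proof. by rewrite ExD ExN. Qed.

Lemma Ex_sum k n (F : nat -> word -> R) :
  Ex k (fun x => \sum_(i < n) F i x) = \sum_(i < n) Ex k (F i).
Proof.
elim: n => [|n IH].
  by rewrite big_ord0 -[RHS](Ex_cst k 0); apply: Ex_ext => x _; rewrite big_ord0.
rewrite big_ord_recr /= -IH -ExD; apply: Ex_ext => x _.
by rewrite big_ord_recr.
Qed.

Lemma Ex_cat j k F : Ex (j + k) F = Ex j (fun u => Ex k (fun v => F (u ++ v))).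
Proof.
elim: j F => //= j IH F.
by rewrite /letter_ex !IH.
Qed.

Lemma Ex_Lx k (G : word -> theta -> R) :
  Ex k (fun x => Lx (G x)) = Lx (fun t => Ex k (G^~ t)).
Proof. by rewrite /letter_ex !ExD !ExZ. Qed.

Lemma Ex_rcons k F : Ex k.+1 F = Ex k (fun x => Lx (fun t => F (rcons x t))).
Proof.
rewrite -addn1 Ex_cat; apply: Ex_ext => x _ /=.
by rewrite /letter_ex !cats1.
Qed.

Lemma Ex_flip k F : Ex k (fun x => F (map flip x)) = Ex k F.
Proof.
elim: k F => //= k IH F.
rewrite /letter_ex (IH (fun x => F (BH :: x))) (IH (fun x => F (BC :: x))).
rewrite (IH (fun x => F (OH :: x))) (IH (fun x => F (OC :: x))).
by rewrite (IH (fun x => F (OF :: x))); ring.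
Qed.

Lemma Ex_odd k F : (forall x, size x = k -> F (map flip x) = - F x) ->
  Ex k F = 0.
Proof.
move=> Fodd; have : Ex k F = - Ex k F.
  by rewrite -{1}Ex_flip -ExN; apply: Ex_ext => x /Fodd.
by move=> ?; lra.
Qed.

Lemma Ex_swap j k (G : word -> word -> R) :
  Ex j (fun u => Ex k (G u)) = Ex k (fun v => Ex j (G^~ v)).
Proof.
elim: j G => //= j IH G.
by rewrite Ex_Lx /letter_ex !IH.
Qed.

Definition netS (x : word) : R :=
  (nH x)%:R + (nC x)%:R - (oH x)%:R - (oC x)%:R - (oF x)%:R.
Definition discM (x : word) : R :=
  (nH x)%:R - (nC x)%:R - (oH x)%:R + (oC x)%:R.
Definition nb (x : word) : bool := stack x == [::].
(** Minus the jump of [discM] when a flexible order is appended; it is 0 without burgers, where that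
    order stays unfulfilled. *)
Definition topsg (x : word) : R :=
  match stack x with BH :: _ => 1 | BC :: _ => - 1 | _ => 0 end.

Local Notation S := netS.
Local Notation M := discM.
Local Notation sg := topsg.

Lemma natR_eq (m n : nat) : m = n -> m%:R = n%:R :> R.
Proof. by move=> ->. Qed.

Lemma S_cat u v : S (u ++ v) = S u + S v.
Proof.
have [eH [eC [[/natR_eq E1 /natR_eq E2 /natR_eq E3 _ _] _]]] := cat_count u v.
by move: E1 E2 E3; rewrite !natrD /netS => E1 E2 E3; lra.
Qed.

Lemma M_cat u v : `|M (u ++ v) - M u - M v| <= (oF v)%:R.
Proof.
have [eH [eC [[/natR_eq E1 /natR_eq E2 _ _ _] [_ E3]]]] := cat_count u v.
move: E1 E2 E3; rewrite -(ler_nat R) !natrD /discM => E1 E2 E3.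
have := (ler0n R eH, ler0n R eC) => -[? ?].
by rewrite ler_norml; apply/andP; split; lra.
Qed.

Lemma M_flip x : M (map flip x) = - M x.
Proof. by rewrite /discM; have [-> -> -> -> _] := stats_flip x; ring. Qed.

Lemma S_flip x : S (map flip x) = S x.
Proof. by rewrite /netS; have [-> -> -> -> ->] := stats_flip x; ring. Qed.

Lemma nb_flip x : nb (map flip x) = nb x.
Proof. by rewrite /nb stack_flip; case: (stack x). Qed.

Lemma S_no x : S x = (nH x)%:R + (nC x)%:R - (no x)%:R.
Proof. by rewrite /netS noE !natrD; ring. Qed.

Lemma nb_nil x : nb x -> [/\ nH x = 0%N, nC x = 0%N & S x = - (no x)%:R].
Proof.
rewrite S_no /nH /nC => /eqP ->; split => //.
by rewrite /cH /cC /=; ring.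
Qed.

Lemma reduce_state_rcons x t :
  reduce_state (rcons x t) = reduce_step (orders x, stack x) t.
Proof. by rewrite /reduce_state -cats1 foldl_cat -/(reduce_state x) reduce_stateE. Qed.

Lemma stats_rconsB x :
  [/\ nH (rcons x BH) = (nH x).+1, nC (rcons x BH) = nC x,
      oH (rcons x BH) = oH x, oC (rcons x BH) = oC x &
      oF (rcons x BH) = oF x] /\
  [/\ nH (rcons x BC) = nH x, nC (rcons x BC) = (nC x).+1,
      oH (rcons x BC) = oH x, oC (rcons x BC) = oC x &
      oF (rcons x BC) = oF x].
Proof.
by rewrite /nH /nC /oH /oC /oF /stack /orders !reduce_state_rcons.
Qed.

Lemma stats_rcons_ord x t : is_order t ->
  [/\ oF (rcons x t) = (oF x + (nb x && (t == OF)))%N,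
      (nH (rcons x t) <= nH x)%N, (nC (rcons x t) <= nC x)%N &
      match t with
      | OH => [/\ M (rcons x t) = M x - 1, nC (rcons x t) = nC x &
               nH (rcons x t) = (nH x).-1]
      | OC => [/\ M (rcons x t) = M x + 1, nH (rcons x t) = nH x &
               nC (rcons x t) = (nC x).-1]
      | _ => [/\ M (rcons x t) = M x - sg x,
                 (nH (rcons x t))%:R = (nH x)%:R - (sg x == 1)%:R :> R &
                 (nC (rcons x t))%:R = (nC x)%:R - (sg x == -1)%:R :> R]
      end].
Proof.
move=> ot; rewrite /discM /nH /nC /oH /oC /oF /nb /topsg.
rewrite ![orders (rcons x t)]/orders ![stack (rcons x t)]/stack.
rewrite reduce_state_rcons reduce_step_ord//.
have := serve_count ot (stack_all x); have hs := stack_all x.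
case: t ot => // _.
- case: (serve OH _) => [s'|]; cbn [fst snd].
    move=> [eH [eC [-> -> E]]]; rewrite andbF addn0; split => //; try lia.
    split; try lia.
    have [-> ->] : eH = 0%N /\ eC = 0%N by lia.
    by rewrite !natrD; ring.
  move=> E; have [-> -> ->] := k_rcons (orders x) OH; rewrite E andbF !addn0.
  by split => //; split => //; rewrite !natrD; ring.
- case: (serve OC _) => [s'|]; cbn [fst snd].
    move=> [eH [eC [-> -> E]]]; rewrite andbF addn0; split => //; try lia.
    split; try lia.
    have [-> ->] : eH = 0%N /\ eC = 0%N by lia.
    by rewrite !natrD; ring.
  move=> E; have [-> -> ->] := k_rcons (orders x) OC; rewrite E andbF !addn0.
  by split => //; split => //; rewrite !natrD; ring.
- rewrite serveF//; case: (stack x) hs => [|b s] hs.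
    cbn [fst snd] => _; have [-> -> ->] := k_rcons (orders x) OF.
    split => //; split; first by rewrite !addn0; ring.
      by rewrite eq_sym oner_eq0 subr0.
    by rewrite eq_sym oppr_eq0 oner_eq0 subr0.
  move=> _; cbn [fst snd]; have [-> ->] := c_cons b s.
  have n11 : (1 == -1 :> R) = false by apply/negbTE/eqP => ?; lra.
  case: b hs => // _; rewrite !natrD ?eqxx ?n11 1?[-1 == 1]eq_sym ?n11.
    by split; rewrite ?leq_addl ?addn0 //; split => //; rewrite /=; ring.
  by split; rewrite ?leq_addl ?addn0 //; split => //; rewrite /=; ring.
Qed.

Lemma sg_sqr x : sg x ^+ 2 = 1 - (nb x)%:R.
Proof.
rewrite /topsg /nb; have := stack_all x.
by case: (stack x) => [|[] s] //= _; ring.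
Qed.

Lemma sg_nb x : nb x -> sg x = 0.
Proof. by rewrite /topsg /nb => /eqP ->. Qed.

Lemma sg_cat z y : ~~ nb y -> sg (z ++ y) = sg y.
Proof. by rewrite /topsg /nb stack_cat; case: (stack y). Qed.

Lemma nb_cat z y : nb (z ++ y) -> nb y.
Proof. by rewrite /nb stack_cat; case: (stack y). Qed.

(* Shortest suffix containing a burger. *)
Definition chunk (y : word) : bool := ~~ nb y && nb (behead y).

Lemma chunkE y : chunk y -> exists2 t, t \in [:: BH; BC] &
  [/\ stack y = [:: t], oF y = 0%N, sg y = (if t is BH then 1 else -1) &
      if t is BH then oH y = 0%N else oC y = 0%N].
Proof.
rewrite /chunk; case: y => [|t y0] //= /andP[ny /eqP y0b].
have tb : is_burger t.
  apply: contraR ny => ob; rewrite /nb -cat1s stack_cat y0b.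
  have -> : stack [:: t] = [::] by rewrite /stack /reduce_state /= reduce_step_ord.
  suff -> : (act [::] (orders y0)).2 = [::] by [].
  elim/last_ind: (orders y0) (orders_all y0) => // w x IH.
  rewrite all_rcons => /andP[ox /IH E].
  by rewrite act_rcons E reduce_step_ord.
have [st ot] : stack [:: t] = [:: t] /\ orders [:: t] = [::].
  by rewrite /stack /orders /reduce_state /= /reduce_step tb.
have E w : all is_order w -> (act [:: t] w).2 != [::] ->
    [/\ act [:: t] w = (w, [:: t]), kF w = 0%N &
        if t is BH then kH w = 0%N else kC w = 0%N].
  elim/last_ind: w => [|w x IH]; first by case: (t).
  rewrite all_rcons act_rcons => /andP[ox ow].
  rewrite reduce_step_ord// => ne.
  have /(IH ow)[E1 E2 E3] : (act [:: t] w).2 != [::].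
    by apply: contra ne => /eqP ->.
  rewrite E1 in ne *; cbn [fst snd] in *.
  have [-> -> ->] := k_rcons w x; rewrite E2.
  move: ne tb E3; rewrite /=; case: (t); case: x ox => //= _ _ _ ->.
    by [].
  by [].
have {E}[E1 E2 E3] : [/\ act [:: t] (orders y0) = (orders y0, [:: t]),
    kF (orders y0) = 0%N &
    if t is BH then kH (orders y0) = 0%N else kC (orders y0) = 0%N].
  apply: E; first exact: orders_all.
  apply: contra ny => /eqP ne; by rewrite /nb -cat1s stack_cat y0b st ne.
exists t; first by case: (t) tb.
have Es : stack (t :: y0) = [:: t].
  by rewrite -cat1s stack_cat y0b st E1.
have Eo : orders (t :: y0) = orders y0.
  by rewrite -cat1s orders_cat st ot E1.
rewrite /topsg Es /oF /oH /oC Eo; split => //.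
by case: (t) tb E3.
Qed.

(** All orders of a chunk have the kind opposite to its burger, so they move [discM] in the same
    direction as that burger. *)
Lemma chunk_stats y : chunk y ->
  [/\ M y = sg y * (1 + (no y)%:R), S y = 1 - (no y)%:R, oF y = 0%N &
      sg y = 1 \/ sg y = -1].
Proof.
move=> /chunkE[t tb [Es EF Esg EO]]; rewrite S_no /discM noE /nH /nC Es EF Esg.
case: t tb EO {Es Esg} => // _ ->; rewrite /cH /cC /= !addn0 ?add0n.
  by split => //; [ring|ring|left].
by split => //; [ring|ring|right].
Qed.

Lemma M_cat0 z y : oF y = 0%N -> M (z ++ y) = M z + M y.
Proof.
move=> E; have := M_cat z y; rewrite E normr_le0 => /eqP ?; lra.
Qed.

Lemma chunk_cat z y : chunk y ->
  [/\ M (z ++ y) = M z + M y, sg (z ++ y) = sg y &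
   ((nH z)%:R - (nC z)%:R) * sg y + 1 <=
   ((nH (z ++ y))%:R - (nC (z ++ y))%:R) * sg y].
Proof.
move=> cy; have [_ _ F0 _] := chunk_stats cy.
have /andP[ny _] := cy.
split; [exact: M_cat0|exact: sg_cat|].
have [t tb [Es EF Esg EO]] := chunkE cy.
have [eH [eC [[/natR_eq E1 /natR_eq E2 _ E4 E5] [_ E6]]]] := cat_count z y.
move: E4 E5; rewrite -!(ler_nat R) !natrD => /andP[E4 E4'] /andP[E5 E5'].
have [E7 E8] : eH = 0%N /\ eC = 0%N by lia.
move: E1 E2 E4 E5 E4' E5'; rewrite Esg !natrD E7 E8 /nH /nC Es.
by case: t tb EO {Es Esg} => // _ ->; rewrite /cH /cC /= => *; lra.
Qed.

(** The suffix grows to the left: while it has no burger, one more letter either keeps it so or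
    completes a chunk. The prefix [z] that remains is independent of the chunk [y]. *)
Lemma Ex_chunk k (F : word -> R) :
  Ex k F = Ex k (fun x => (nb x)%:R * F x) +
  \sum_(j < k) Ex j.+1 (fun y => (chunk y)%:R *
     Ex (k - j.+1) (fun z => F (z ++ y))).
Proof.
pose T i := Ex i (fun y => (nb y)%:R * Ex (k - i) (fun z => F (z ++ y))).
have E0 : T 0 = Ex k F.
  by rewrite /T /= subn0 mul1r; apply: Ex_ext => x _; rewrite cats0.
have Ek : T k = Ex k (fun x => (nb x)%:R * F x).
  by rewrite /T subnn; apply: Ex_ext => x _.
rewrite -E0 -Ek; suff H n : (n <= k)%N -> T 0 = T n + \sum_(j < n)
    Ex j.+1 (fun y => (chunk y)%:R * Ex (k - j.+1) (fun z => F (z ++ y))).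
  exact: H.
elim: n => [_|n IH lnk]; first by rewrite big_ord0 addr0.
rewrite big_ord_recr /= (IH (ltnW lnk)) [in RHS]addrCA [RHS]addrC.
congr (_ + _); rewrite addrC; rewrite {1}/T.
have -> : (k - n = (k - n.+1).+1)%N by lia.
transitivity (Lx (fun t => Ex n (fun y => (nb y)%:R *
    Ex (k - n.+1) (fun z => F (z ++ t :: y))))).
  rewrite -Ex_Lx; apply: Ex_ext => y _.
  rewrite Ex_rcons Ex_Lx /letter_ex.
  have E t : Ex (k - n.+1) (fun x => F (rcons x t ++ y)) =
             Ex (k - n.+1) (fun z => F (z ++ t :: y)).
    by apply: Ex_ext => z _; rewrite cat_rcons.
  by rewrite !E; ring.
rewrite /T /= -/(letter_ex _) /letter_ex.
have E t : Ex n (fun y => (nb y)%:R *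
    Ex (k - n.+1) (fun z => F (z ++ t :: y))) =
    Ex n (fun x => (nb (t :: x))%:R * Ex (k - n.+1) (fun z => F (z ++ t :: x)))
  + Ex n (fun x => (chunk (t :: x))%:R *
       Ex (k - n.+1) (fun z => F (z ++ t :: x))).
  rewrite -ExD; apply: Ex_ext => x _; rewrite -mulrDl; congr (_ * _).
  rewrite /chunk /=; have := @nb_cat [:: t] x; rewrite cat1s.
  by case: (nb (t :: x)) => [->//|_]; rewrite ?addr0 ?add0r.
by rewrite !E; ring.
Qed.

End word_expectation.

(** * Second and fourth moments of the net count and the discrepancy *)

Section moments.
Context {R : realType} (p : R) (hp0 : 0 < p) (hp : p < 1 / 2).

Local Ltac plra := move: hp0 hp => ? ?; lra.
Local Ltac pnra := move: hp0 hp => ? ?; nra.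

Local Notation Lx := (letter_ex p).
Local Notation Ex := (word_ex p).
Local Notation S := (@netS R).
Local Notation M := (@discM R).
Local Notation sg := (@topsg R).

Lemma Lx_le (F G : theta -> R) : (forall t, F t <= G t) -> Lx F <= Lx G.
Proof.
move=> FG; rewrite /letter_ex.
have := (FG BH, FG BC, FG OH, FG OC, FG OF) => -[[[[? ?] ?] ?] ?].
have ? : (1 - p) / 4 * F OH <= (1 - p) / 4 * G OH by apply: ler_wpM2l => //; plra.
have ? : (1 - p) / 4 * F OC <= (1 - p) / 4 * G OC by apply: ler_wpM2l => //; plra.
have ? : p / 2 * F OF <= p / 2 * G OF by apply: ler_wpM2l => //; plra.
by plra.
Qed.

Lemma Ex_le k (F G : word -> R) : (forall x, size x = k -> F x <= G x) ->
  Ex k F <= Ex k G.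
Proof.
elim: k F G => [|k IH] F G FG; first exact: FG.
by apply: Lx_le => t; apply: IH => x xk; apply: FG; rewrite /= xk.
Qed.

Lemma Ex_ge0 k (F : word -> R) : (forall x, size x = k -> 0 <= F x) ->
  0 <= Ex k F.
Proof. by move=> F0; rewrite -(Ex_cst p k 0); exact: Ex_le. Qed.

Lemma Ex_le1 k (F : word -> R) : (forall x, size x = k -> F x <= 1) ->
  Ex k F <= 1.
Proof. by move=> F0; rewrite -[leRHS](Ex_cst p k 1); exact: Ex_le. Qed.

Definition pr (k : nat) (P : word -> bool) : R := Ex k (fun x => (P x)%:R).

Lemma pr_ge0 k P : 0 <= pr k P.
Proof. by apply: Ex_ge0 => x _; exact: ler0n. Qed.

Lemma pr_le1 k P : pr k P <= 1.
Proof. by apply: Ex_le1 => x _; case: (P x). Qed.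

Lemma pr_le k (P Q : word -> bool) :
  (forall x, size x = k -> P x -> Q x) -> pr k P <= pr k Q.
Proof.
move=> PQ; apply: Ex_le => x /PQ; case: (P x) => [->//|_]; exact: ler0n.
Qed.

Lemma Ex_markov k (F : word -> R) (c : R) : 0 < c ->
  (forall x, size x = k -> 0 <= F x) -> pr k (fun x => c <= F x) <= Ex k F / c.
Proof.
move=> c0 F0; rewrite -ExZr; apply: Ex_le => x xk.
rewrite ler_pdivlMr//; case: (leP c (F x)) => [|_]; first by rewrite mul1r.
by rewrite mul0r; exact: F0.
Qed.

Lemma prU k (P Q : word -> bool) :
  pr k (fun x => P x || Q x) <= pr k P + pr k Q.
Proof.
rewrite -ExD; apply: Ex_le => x _.
by case: (P x); case: (Q x) => /=; rewrite ?addr0 ?add0r// lerDl.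
Qed.

Lemma S1 t : S [:: t] = if is_burger t then 1 else - 1.
Proof.
by case: t; rewrite /netS /nH /nC /oH /oC /oF /stack /orders /reduce_state /=
  /cH /cC /kH /kC /kF /=; ring.
Qed.

Lemma S_cons t x : S (t :: x) = S [:: t] + S x.
Proof. by rewrite -cat1s S_cat. Qed.

Lemma S_nil : S [::] = 0.
Proof.
by rewrite /netS /nH /nC /oH /oC /oF /cH /cC /kH /kC /kF /=; ring.
Qed.

Lemma M_nil : M [::] = 0.
Proof. by rewrite /discM /nH /nC /oH /oC /cH /cC /kH /kC /=; ring. Qed.

Lemma ES k : Ex k S = 0.
Proof.
elim: k => [|k IH]; first by rewrite /= S_nil.
rewrite /= /letter_ex.
have E t : Ex k (fun x => S (t :: x)) = S [:: t].
  transitivity (Ex k (fun x => S [:: t] + S x)).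
    by apply: Ex_ext => x _; exact: S_cons.
  by rewrite ExD IH Ex_cst addr0.
by rewrite !E !S1 /=; plra.
Qed.

Let sgn (t : theta) : R := if is_burger t then 1 else - 1.

Lemma ES2 k : Ex k (fun x => S x ^+ 2) = k%:R.
Proof.
elim: k => [|k IH]; first by rewrite /= S_nil; ring.
rewrite /= /letter_ex.
have E t : Ex k (fun x => S (t :: x) ^+ 2) = 1 + k%:R.
  transitivity (Ex k (fun x => 1 + (2 * sgn t) * S x + S x ^+ 2)).
    apply: Ex_ext => x _; rewrite S_cons S1 /sgn; case: (is_burger t); ring.
  by rewrite !ExD IH Ex_cst ExZ ES mulr0 addr0.
by rewrite !E -[k.+1%:R]natr1; field.
Qed.

Lemma ES3 k : Ex k (fun x => S x ^+ 3) = 0.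
Proof.
elim: k => [|k IH]; first by rewrite /= S_nil; ring.
rewrite /= /letter_ex.
have E t : Ex k (fun x => S (t :: x) ^+ 3) =
    sgn t * (1 + 3 * k%:R).
  transitivity (Ex k (fun x => sgn t + 3 * S x +
      (3 * sgn t) * S x ^+ 2 + S x ^+ 3)).
    apply: Ex_ext => x _; rewrite S_cons S1 /sgn; case: (is_burger t); ring.
  by rewrite !ExD IH Ex_cst !ExZ ES ES2; ring.
by rewrite !E /sgn /=; field.
Qed.

Lemma ES4 k : Ex k (fun x => S x ^+ 4) <= 3 * k%:R ^+ 2.
Proof.
elim: k => [|k IH]; first by rewrite /= S_nil; plra.
rewrite /= /letter_ex.
have E t : Ex k (fun x => S (t :: x) ^+ 4) =
    1 + 6 * k%:R + Ex k (fun x => S x ^+ 4).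
  transitivity (Ex k (fun x => 1 + (4 * sgn t) * S x + 6 * S x ^+ 2 +
      (4 * sgn t) * S x ^+ 3 + S x ^+ 4)).
    apply: Ex_ext => x _; rewrite S_cons S1 /sgn; case: (is_burger t); ring.
  by rewrite !ExD Ex_cst !ExZ ES ES2 ES3; ring.
rewrite !E -[k.+1%:R]natr1; apply: le_trans (_ : 1 + 6 * k%:R + 3 * k%:R ^+ 2 <= _).
  by rewrite [leLHS](_ : _ = 1 + 6 * k%:R + Ex k (fun x => S x ^+ 4));
    [rewrite lerD2l|field].
by have := ler0n R k; plra.
Qed.

Lemma M_rcons x : [/\ M (rcons x BH) = M x + 1, M (rcons x BC) = M x - 1,
  M (rcons x OH) = M x - 1, M (rcons x OC) = M x + 1 &
  M (rcons x OF) = M x - sg x].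
Proof.
have [[E1 E2 E3 E4 _] [F1 F2 F3 F4 _]] := stats_rconsB x.
have [_ _ _ [G1 _ _]] := @stats_rcons_ord R x OH isT.
have [_ _ _ [G2 _ _]] := @stats_rcons_ord R x OC isT.
have [_ _ _ [G3 _ _]] := @stats_rcons_ord R x OF isT.
by split => //; rewrite /discM ?E1 ?E2 ?E3 ?E4 ?F1 ?F2 ?F3 ?F4 -?natr1; ring.
Qed.

Definition pi_ k : R := Ex k (fun x => (nb x)%:R).
Definition e_ k : R := Ex k (fun x => (nb x)%:R * (no x)%:R).

Lemma pi_ge0 k : 0 <= pi_ k. Proof. exact: pr_ge0. Qed.

Lemma e_ge0 k : 0 <= e_ k.
Proof. by apply: Ex_ge0 => x _; rewrite mulr_ge0. Qed.

Lemma pi0 : pi_ 0 = 1. Proof. by []. Qed.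

Lemma pi_decr k : pi_ k.+1 <= pi_ k.
Proof.
rewrite /pi_ /=; apply: le_trans (_ : Lx (fun=> pi_ k) <= _).
  apply: Lx_le => t; apply: pr_le => x _.
  by rewrite -cat1s; exact: nb_cat.
by rewrite /letter_ex /pi_; plra.
Qed.

Lemma pi_mono m n : (m <= n)%N -> pi_ n <= pi_ m.
Proof.
elim: n => [|n IH]; first by rewrite leqn0 => /eqP ->.
rewrite leq_eqVlt => /orP[/eqP ->//|]; rewrite ltnS => /IH.
exact: le_trans (pi_decr n).
Qed.

Lemma Ex_chunk_ge0 k (F : word -> R) : (forall x, nb x -> F x = 0) ->
  (forall j y, chunk y -> 0 <= Ex j (fun z => F (z ++ y))) -> 0 <= Ex k F.
Proof.
move=> F0 Fc; rewrite Ex_chunk addr_ge0//.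
  apply: Ex_ge0 => x _; case: (boolP (nb x)) => [/F0 ->|_]; first by rewrite mulr0.
  by rewrite mul0r.
apply: sumr_ge0 => j _; apply: Ex_ge0 => y _.
by case: (boolP (chunk y)) => [/Fc H|_]; rewrite ?mul1r ?mul0r.
Qed.

Lemma EM k : Ex k M = 0.
Proof. by apply: Ex_odd => x _; exact: M_flip. Qed.

Lemma EM3 k : Ex k (fun x => M x ^+ 3) = 0.
Proof. by apply: Ex_odd => x _; rewrite M_flip; ring. Qed.

Lemma sg2_chunk y : chunk y -> sg y ^+ 2 = 1.
Proof. by case/(@chunk_stats R) => _ _ _ [->|->]; ring. Qed.

(** Given the chunk [y], the prefix contributes a multiple of [M z], of mean zero, and [y] itself
    contributes [1 + no y]. *)
Lemma EMsg_ge0 k : 0 <= Ex k (fun x => M x * sg x).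
Proof.
apply: Ex_chunk_ge0 => [x /sg_nb ->|j y cy]; first by rewrite mulr0.
have [My _ _ _] := @chunk_stats R y cy; have s2 := sg2_chunk cy.
have -> : Ex j (fun z => M (z ++ y) * sg (z ++ y)) =
    Ex j (fun z => sg y * M z + (1 + (no y)%:R)).
  apply: Ex_ext => z _; have [-> -> _] := @chunk_cat R z y cy.
  by rewrite My mulrDl -[X in _ + X]mulrA mulrC [(1 + _) * _]mulrC mulrA -expr2 s2 mul1r.
by rewrite ExD ExZ EM Ex_cst mulr0 add0r addr_ge0.
Qed.

(** Expanding the cube on a chunk, odd powers of [M z] have mean zero and even ones have nonnegative
    coefficients. *)
Lemma EM3sg_ge0 k : 0 <= Ex k (fun x => M x ^+ 3 * sg x).
Proof.
apply: Ex_chunk_ge0 => [x /sg_nb ->|j y cy]; first by rewrite mulr0.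
have [My _ _ sy] := @chunk_stats R y cy.
set l : R := 1 + (no y)%:R.
have l0 : 0 <= l by rewrite addr_ge0.
have -> : Ex j (fun z => M (z ++ y) ^+ 3 * sg (z ++ y)) =
    Ex j (fun z => sg y * M z ^+ 3 + (3 * l) * M z ^+ 2 +
      (3 * l ^+ 2 * sg y) * M z + l ^+ 3).
  apply: Ex_ext => z _; have [-> -> _] := @chunk_cat R z y cy.
  by rewrite My -/l; case: sy => ->; ring.
rewrite !ExD !ExZ EM EM3 Ex_cst !mulr0 add0r addr0.
have h : 0 <= Ex j (fun z => M z ^+ 2) by apply: Ex_ge0 => x _; exact: sqr_ge0.
by rewrite addr_ge0 ?exprn_ge0// !mulr_ge0.
Qed.

(* Optional stopping for [S] along the shortest suffix containing a burger. *)
Lemma EMsg k : Ex k (fun x => M x * sg x) = 2 * (1 - pi_ k) - e_ k.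
Proof.
(* On a chunk [M y * sg y + S y = 2], as the numbers of orders cancel; subtracting this value makes
   every chunk term vanish. *)
pose F x := (~~ nb x)%:R * (M x * sg x + S x - 2).
have F0 : Ex k F = 0.
  rewrite Ex_chunk.
  rewrite (_ : Ex k _ = 0) ?add0r.
    rewrite big1// => j _; rewrite -[RHS](Ex_cst p j.+1 0).
    apply: Ex_ext => y _; case: (boolP (chunk y)) => [cy|_]; last by rewrite mul0r.
    rewrite mul1r; have [My Sy _ sy] := @chunk_stats R y cy.
    transitivity (Ex (k - j.+1) (fun z => sg y * M z + S z)).
      apply: Ex_ext => z _; have [Mzy szy _] := @chunk_cat R z y cy.
      have ny : ~~ nb (z ++ y) by apply: contraL cy => /nb_cat h; rewrite /chunk h.
      by rewrite /F ny mul1r Mzy szy S_cat My Sy; case: sy => ->; ring.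
    by rewrite ExD ExZ EM ES; ring.
  rewrite -[RHS](Ex_cst p k 0); apply: Ex_ext => x _.
  by rewrite /F; case: (nb x); rewrite ?mul0r ?mulr0.
have E : Ex k F = Ex k (fun x => M x * sg x) + Ex k S + e_ k -
    Ex k (fun=> 2) + 2 * pi_ k.
  rewrite -!ExD -ExB -ExZ -ExD.
  apply: Ex_ext => x _; rewrite /F.
  case: (boolP (nb x)) => [nx|_] /=; last by ring.
  have [_ _ ->] := @nb_nil R x nx; rewrite (@sg_nb R x nx); ring.
by move: E; rewrite F0 ES Ex_cst => ?; plra.
Qed.

Lemma EM2S k : Ex k.+1 (fun x => M x ^+ 2) =
  Ex k (fun x => M x ^+ 2) + 1 - p / 2 * pi_ k - p * Ex k (fun x => M x * sg x).
Proof.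
rewrite Ex_rcons -[X in _ + X - _ * pi_ k](Ex_cst p k 1) -!ExZ -ExD -!ExB; apply: Ex_ext => x _.
have [E1 E2 E3 E4 E5] := M_rcons x; have := @sg_sqr R x.
rewrite /letter_ex E1 E2 E3 E4 E5 => s2.
have -> : (M x - sg x) ^+ 2 = M x ^+ 2 - 2 * (M x * sg x) + sg x ^+ 2 by ring.
by rewrite s2; field.
Qed.

(** The corrections to linear growth come only from words without burgers and are nonnegative, which
    gives [EM2_ge]. *)
Lemma EM2_eq k : Ex k (fun x => M x ^+ 2) = (1 - 2 * p) * k%:R +
  p * \sum_(t < k) (3 / 2 * pi_ t + e_ t).
Proof.
elim: k => [|k IH]; first by rewrite /= M_nil big_ord0; ring.
by rewrite EM2S IH EMsg big_ord_recr /= -[k.+1%:R]natr1; field.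
Qed.

Lemma EM2_ge k : (1 - 2 * p) * k%:R <= Ex k (fun x => M x ^+ 2).
Proof.
rewrite EM2_eq lerDl; apply: mulr_ge0; first exact: ltW.
apply: sumr_ge0 => i _; have := pi_ge0 i; have := e_ge0 i; plra.
Qed.

Lemma EM2_le k : Ex k (fun x => M x ^+ 2) <= k%:R.
Proof.
elim: k => [|k IH]; first by rewrite /= M_nil; plra.
have h1 : 0 <= p * pi_ k by rewrite mulr_ge0 ?pi_ge0 ?ltW.
have h2 : 0 <= p * Ex k (fun x => M x * sg x) by rewrite mulr_ge0 ?EMsg_ge0 ?ltW.
by rewrite EM2S -[k.+1%:R]natr1; plra.
Qed.

Lemma EM4_le k : Ex k (fun x => M x ^+ 4) <= 3 * k%:R ^+ 2 + k%:R.
Proof.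
elim: k => [|k IH]; first by rewrite /= M_nil; plra.
apply: le_trans (_ : Ex k (fun x => M x ^+ 4 + 6 * M x ^+ 2 + 1 -
   (2 * p) * (M x ^+ 3 * sg x) - (2 * p) * (M x * sg x)) <= _).
  rewrite Ex_rcons; apply: Ex_le => x _.
  have [E1 E2 E3 E4 E5] := M_rcons x; have := @sg_sqr R x.
  rewrite /letter_ex E1 E2 E3 E4 E5 => s2.
  have -> : (M x - sg x) ^+ 4 = M x ^+ 4 - 4 * (M x ^+ 3 * sg x) +
    6 * M x ^+ 2 * sg x ^+ 2 - 4 * M x * (sg x * sg x ^+ 2) + (sg x ^+ 2) ^+ 2.
    by ring.
  have -> : sg x * sg x ^+ 2 = sg x.
    by rewrite s2; case: (boolP (nb x)) => [/sg_nb ->|_] /=; ring.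
  rewrite s2; have := sqr_ge0 (M x).
  by case: (nb x) => /= m2; pnra.
rewrite !ExB !ExD !ExZ Ex_cst.
have h1 : 0 <= p * Ex k (fun x => M x * sg x) by rewrite mulr_ge0 ?EMsg_ge0 ?ltW.
have h2 : 0 <= p * Ex k (fun x => M x ^+ 3 * sg x) by rewrite mulr_ge0 ?EM3sg_ge0 ?ltW.
have h3 := EM2_le k; rewrite -[k.+1%:R]natr1; plra.
Qed.

(** A flexible order remains unfulfilled exactly when it arrives at a time without burgers. *)
Lemma EoF k : Ex k (fun x => (oF x)%:R) = p / 2 * \sum_(t < k) pi_ t.
Proof.
elim: k => [|k IH]; first by rewrite /= big_ord0 mulr0.
rewrite Ex_rcons big_ord_recr /= mulrDr -IH -ExZ -ExD; apply: Ex_ext => x _.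
have [[_ _ _ _ E1] [_ _ _ _ E2]] := stats_rconsB x.
have [E3 _ _ _] := @stats_rcons_ord R x OH isT.
have [E4 _ _ _] := @stats_rcons_ord R x OC isT.
have [E5 _ _ _] := @stats_rcons_ord R x OF isT.
by rewrite /letter_ex E1 E2 E3 E4 E5 !andbF eqxx andbT /= !natrD; field.
Qed.

Lemma EhC_ge0 k : 0 <= Ex k (fun x => ((nH x)%:R - (nC x)%:R) * sg x).
Proof.
apply: Ex_chunk_ge0 => [x /sg_nb ->|j y cy]; first by rewrite mulr0.
apply: le_trans (_ : Ex j (fun z => ((nH z)%:R - (nC z)%:R) * sg y + 1) <= _).
  rewrite ExD ExZr Ex_cst.
  have -> : Ex j (fun z => (nH z)%:R - (nC z)%:R) = 0.
    by apply: Ex_odd => z _; have [-> -> _ _ _] := stats_flip z; ring.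
  by rewrite mul0r add0r.
by apply: Ex_le => z _; have [_ -> ->] := @chunk_cat R z y cy.
Qed.

(** A flexible order takes the top burger, which on average belongs to the majority kind
    ([EhC_ge0]); its effect on the sum of squares thus has the favourable sign. *)
Lemma Ebeta2 k : Ex k (fun x => (nH x)%:R ^+ 2 + (nC x)%:R ^+ 2) <= 2 * k%:R.
Proof.
elim: k => [|k IH]; first by rewrite /= /nH /nC /cH /cC /=; plra.
apply: le_trans (_ : Ex k (fun x => (nH x)%:R ^+ 2 + (nC x)%:R ^+ 2 + 2
   - (p / 2) * (((nH x)%:R - (nC x)%:R) * sg x)) <= _).
  rewrite Ex_rcons; apply: Ex_le => x _.
  have [[E1 E2 _ _ _] [F1 F2 _ _ _]] := stats_rconsB x.
  have [_ _ _ [_ G2 G1]] := @stats_rcons_ord R x OH isT.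
  have [_ _ _ [_ H1 H2]] := @stats_rcons_ord R x OC isT.
  have [_ _ _ [_ I1 I2]] := @stats_rcons_ord R x OF isT.
  rewrite /letter_ex E1 E2 F1 F2 G1 G2 H1 H2 I1 I2.
  have predE n : (n.-1)%:R ^+ 2 <= n%:R ^+ 2 - 2 * n%:R + 1 :> R.
    by case: n => [|n] /=; rewrite -?[n.+1%:R]natr1; plra.
  have nz : nb x -> nH x = 0%N /\ nC x = 0%N by case/(@nb_nil R).
  have q1 := predE (nH x); have q2 := predE (nC x).
  have q3 : 0 <= (1 - p) * ((nH x)%:R ^+ 2 - 2 * (nH x)%:R + 1 - ((nH x).-1)%:R ^+ 2).
    by apply: mulr_ge0; [plra|rewrite subr_ge0].
  have q4 : 0 <= (1 - p) * ((nC x)%:R ^+ 2 - 2 * (nC x)%:R + 1 - ((nC x).-1)%:R ^+ 2).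
    by apply: mulr_ge0; [plra|rewrite subr_ge0].
  have n11 : (1 == -1 :> R) = false by apply/negbTE/eqP => ?; plra.
  have n01 : (0 == -1 :> R) = false by apply/negbTE/eqP => ?; plra.
  have m11 : (-1 == 1 :> R) = false by apply/negbTE/eqP => ?; plra.
  have m01 : (0 == 1 :> R) = false by apply/negbTE/eqP => ?; plra.
  move: nz; rewrite /nb /topsg; have := stack_all x.
  case: (stack x) => [|[] s] //= _ => [/(_ isT)[-> ->]|_|_];
    rewrite ?eqxx ?n11 ?n01 ?m11 ?m01 -?[(nH x).+1%:R]natr1 -?[(nC x).+1%:R]natr1 /=; plra.
rewrite !ExB !ExD !ExZ Ex_cst.
have h1 : 0 <= p * Ex k (fun x => ((nH x)%:R - (nC x)%:R) * sg x).
  by rewrite mulr_ge0 ?EhC_ge0 ?ltW.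
by move: IH; rewrite ExD -[k.+1%:R]natr1; plra.
Qed.

Lemma Eno2 k : Ex k (fun x => (no x)%:R ^+ 2) <= 10 * k%:R.
Proof.
apply: le_trans (_ : Ex k (fun x => 4 * ((nH x)%:R ^+ 2 + (nC x)%:R ^+ 2) +
   2 * S x ^+ 2) <= _).
  apply: Ex_le => x _.
  have -> : (no x)%:R = (nH x)%:R + (nC x)%:R - S x :> R by rewrite S_no; ring.
  move: (nH x)%:R (nC x)%:R (S x) => a b s.
  have := (sqr_ge0 (a - b), sqr_ge0 (a + b + s)) => -[? ?]; pnra.
by rewrite ExD !ExZ ES2; have := Ebeta2 k; plra.
Qed.

Lemma ESM k : Ex k (fun x => S x * M x) = 0.
Proof. by apply: Ex_odd => x _; rewrite S_flip M_flip; ring. Qed.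

End moments.

(** * The number of flexible orders is negligible at diffusive scale *)

(** Minus the minimum of [netS] over all prefixes: the number of unfulfilled orders if every order
    accepted every burger. *)
Fixpoint rmin (x : word) : nat :=
  if x is t :: x' then if is_burger t then (rmin x').-1 else (rmin x').+1
  else 0.

Definition lastnb (x : word) : nat :=
  \max_(s < (size x).+1 | nb (take s x)) s.

Definition noret (x : word) : bool :=
  all (fun s => ~~ nb (take s.+1 x)) (iota 0 (size x)).

Definition firstret (x : word) : bool :=
  [&& x != [::], nb x & noret (take (size x).-1 x)].

(** [rmin] of the first renewal block. If the stack is never empty again, [find] returns the size
    and the whole word is taken. *)
Definition blk (x : word) : nat :=
  rmin (take (find (fun s => nb (take s.+1 x)) (iota 0 (size x))).+1 x).

(** Unfulfilled orders never interact with later letters, so a time without burgers is a renewal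
    time. *)
Lemma nb_nb u v : nb u -> nb (u ++ v) = nb v.
Proof.
rewrite /nb => /eqP ub; rewrite stack_cat ub.
suff -> : (act [::] (orders v)).2 = [::] by rewrite cats0.
elim/last_ind: (orders v) (orders_all v) => // w x IH.
rewrite all_rcons => /andP[ox /IH E].
by rewrite act_rcons E reduce_step_ord.
Qed.

Lemma noret_rcons x t : noret (rcons x t) = noret x && ~~ nb (rcons x t).
Proof.
rewrite /noret size_rcons -addn1 iotaD all_cat /= add0n andbT.
have -> : take (size x).+1 (rcons x t) = rcons x t.
  by rewrite -(size_rcons x t) take_size.
congr (_ && _).
apply: eq_in_all => s; rewrite mem_iota add0n => /andP[_ sx].
by rewrite -cats1 takel_cat.
Qed.

Lemma firstret_rcons x t : firstret (rcons x t) = noret x && nb (rcons x t).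
Proof.
rewrite /firstret size_rcons /= -cats1 take_size_cat//.
by case: x => [|a x] /=; rewrite andbC.
Qed.

Lemma firstretP v : firstret v -> exists w t,
  [/\ v = rcons w t, noret w & nb v].
Proof.
case: (lastP v) => [//|w t]; rewrite firstret_rcons => /andP[? ?].
by exists w, t.
Qed.

Lemma noretP x s : noret x -> (0 < s <= size x)%N -> ~~ nb (take s x).
Proof.
move=> /allP H /andP[s0 sx]; case: s s0 sx => // s _ sx.
by apply: H; rewrite mem_iota.
Qed.

Lemma noret_or x : noret x \/ exists v z, x = v ++ z /\ firstret v.
Proof.
elim/last_ind: x => [|x t IH]; first by left.
case: IH => [nx|[v [z [-> fv]]]].
  case: (boolP (nb (rcons x t))) => nt.
    right; exists (rcons x t), [::]; rewrite cats0; split => //.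
    by rewrite firstret_rcons nx.
  by left; rewrite noret_rcons nx.
by right; exists v, (rcons z t); rewrite rcons_cat.
Qed.

Lemma find_firstret v z : firstret v ->
  find (fun s => nb (take s.+1 (v ++ z))) (iota 0 (size (v ++ z))) =
  (size v).-1.
Proof.
move=> /firstretP[w [t [-> nw nv]]].
rewrite size_cat size_rcons iotaD find_cat.
have -> : has (fun s => nb (take s.+1 (rcons w t ++ z))) (iota 0 (size w).+1).
  apply/hasP; exists (size w); first by rewrite mem_iota /= add0n.
  by rewrite -(size_rcons w t) take_size_cat.
rewrite -[(size w).+1]addn1 iotaD find_cat add0n.
have -> : has (fun s => nb (take s.+1 (rcons w t ++ z))) (iota 0 (size w)) = false.
  apply/negbTE/hasPn => s; rewrite mem_iota add0n /= => sw.
  by rewrite -cats1 -catA takel_cat//; apply: (noretP nw).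
rewrite size_iota /=.
have -> : take (size w).+1 (rcons w t ++ z) = rcons w t.
  by rewrite -(size_rcons w t) take_size_cat.
by rewrite nv addn0 addn1.
Qed.

Lemma blk_firstret v z : firstret v -> blk (v ++ z) = rmin v.
Proof.
move=> fv; rewrite /blk find_firstret//.
case/firstretP: fv => w [t [-> _ _]].
by rewrite size_rcons /= -(size_rcons w t) take_size_cat.
Qed.

Lemma blk_noret x : noret x -> blk x = rmin x.
Proof.
move=> nx; rewrite /blk.
rewrite (_ : find _ _ = size x) ?take_oversize//.
rewrite -[RHS](size_iota 0); apply: hasNfind.
by rewrite -all_predC.
Qed.

Section rmin_real.
Context {R : realType}.
Local Notation S := (@netS R).

Lemma netS_cons t x : S (t :: x) = (if is_burger t then 1 else -1) + S x.
Proof.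
rewrite -cat1s S_cat; congr (_ + _).
by case: t; rewrite /netS /nH /nC /oH /oC /oF /stack /orders /reduce_state /=
  /cH /cC /kH /kC /kF /=; ring.
Qed.

Lemma rmin_cat u v : (rmin (u ++ v))%:R =
  Num.max (rmin u)%:R ((rmin v)%:R - S u) :> R.
Proof.
elim: u => [|t u IH] /=.
  have -> : S [::] = 0.
    by rewrite /netS /nH /nC /oH /oC /oF /cH /cC /kH /kC /kF /=; ring.
  by rewrite subr0 max_r.
rewrite netS_cons; case: (is_burger t); last first.
  rewrite -!natr1 IH; set a := _%:R; set b := _%:R; set c := S u.
  by rewrite !maxEle; case: ifP => h1; case: ifP => h2; move: h1 h2; lra.
have predE n : (n.-1)%:R = Num.max 0 (n%:R - 1) :> R.
  case: n => [|n]; first by rewrite max_l//; lra.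
  by rewrite /= max_r -natr1; have := ler0n R n; lra.
rewrite !predE IH; set b := (rmin v)%:R; set c := S u.
have := ler0n R (rmin u); have := ler0n R (rmin v).
move: (rmin u)%:R; rewrite -/b => a b0 a0.
rewrite !maxEle.
by do !(case: ifP); lra.
Qed.

Lemma rmin_rcons u t : (rmin u <= rmin (rcons u t))%N.
Proof.
by elim: u => //= a u IH; case: (is_burger a) => //; rewrite -!subn1 leq_sub2r.
Qed.

Lemma rmin_no u : (rmin u <= no u)%N.
Proof.
elim/last_ind: u => // u t IH; rewrite -(ler_nat R) -cats1 rmin_cat ge_max.
apply/andP; split.
  by rewrite ler_nat (leq_trans IH)// no_catl.
have noS w : - S w <= (no w)%:R.
  by rewrite S_no; have := ler0n R (nH w); have := ler0n R (nC w); lra.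
rewrite /=; case: (boolP (is_burger t)) => bt /=.
  rewrite sub0r (le_trans (noS u))// ler_nat; exact: no_catl.
apply: le_trans (noS (u ++ [:: t])); rewrite S_cat netS_cons (negbTE bt).
have -> : S [::] = 0.
  by rewrite /netS /nH /nC /oH /oC /oF /cH /cC /kH /kC /kF /=; ring.
by lra.
Qed.

Lemma rmin_nb u v : nb u -> rmin (u ++ v) = (no u + rmin v)%N.
Proof.
move=> nu; apply/eqP; rewrite -(eqr_nat R) rmin_cat natrD.
have [_ _ ->] := @nb_nil R u nu; rewrite opprK addrC; apply/eqP.
rewrite max_r//; have := rmin_no u; rewrite -(ler_nat R).
by have := ler0n R (rmin v); lra.
Qed.

Lemma rmin_nbE u : nb u -> rmin u = no u.
Proof. by move=> nu; have := rmin_nb [::] nu; rewrite cats0 addn0. Qed.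

End rmin_real.

Lemma rmin_size u : (rmin u <= size u)%N.
Proof.
elim: u => //= t u IH; case: (is_burger t) => //.
by rewrite (leq_trans _ (leqW IH))// leq_pred.
Qed.

Lemma blk_rcons x t : (blk x <= blk (rcons x t))%N.
Proof.
case: (noret_or x) => [nx|[v [z [-> fv]]]]; last first.
  by rewrite rcons_cat !blk_firstret.
rewrite (blk_noret nx); case: (boolP (nb (rcons x t))) => nt.
  rewrite -[rcons x t]cats0 blk_firstret ?firstret_rcons ?nx//.
  exact: rmin_rcons.
by rewrite blk_noret ?noret_rcons ?nx//; exact: rmin_rcons.
Qed.

Lemma blk_size x : (blk x <= size x)%N.
Proof.
rewrite /blk (leq_trans (rmin_size _))// size_take_min geq_minr //.
Qed.

Lemma lastnb_nb x : nb x -> lastnb x = size x.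
Proof.
move=> nx; apply/eqP; rewrite eqn_leq; apply/andP; split.
  by apply/bigop.bigmax_leqP => i _; rewrite -ltnS ltn_ord.
by apply: (bigop.bigmax_sup ord_max) => //=; rewrite take_size.
Qed.

(** A time without burgers after [z] would be a renewal time of [y]. The rest of [y] is a suffix of
    [behead y] and has no burger either, so [y] would have none. *)
Lemma lastnb_chunk z y : chunk y -> lastnb (z ++ y) = lastnb z.
Proof.
move=> cy; apply/eqP; rewrite eqn_leq; apply/andP; split; last first.
  apply/bigop.bigmax_leqP => i ni.
  have iz : (i < (size (z ++ y)).+1)%N.
    by rewrite size_cat (leq_trans (ltn_ord i))// ltnS leq_addr.
  apply: (bigop.bigmax_sup (Ordinal iz)) => //=.
  by rewrite takel_cat// -ltnS ltn_ord.
apply/bigop.bigmax_leqP => i ni; have iz : (i < (size z).+1)%N.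
  rewrite ltnS leqNgt; apply/negP => zi; move: ni.
  rewrite take_cat ltnNge (ltnW zi) /=; set j := (i - _)%N => /nb_cat.
  have j0 : (0 < j)%N by rewrite subn_gt0.
  move: cy => /andP[ny ny'].
  move=> nj; move: ny; rewrite -(cat_take_drop j y) nb_nb//.
  have -> : drop j y = drop j.-1 (behead y).
    by case: (y) j0 => [|a y0] //; case: (j).
  by move: ny'; rewrite -{1}(cat_take_drop j.-1 (behead y)) => /nb_cat ->.
by apply: (bigop.bigmax_sup (Ordinal iz)) => //=;
  move: ni; rewrite takel_cat// -ltnS.
Qed.

Lemma lastnb_cat v z : nb v -> lastnb (v ++ z) = (size v + lastnb z)%N.
Proof.
move=> nv; apply/eqP; rewrite eqn_leq; apply/andP; split.
  apply/bigop.bigmax_leqP => i ni.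
  case: (ltnP i (size v)) => [/ltnW iv|vi].
    by rewrite (leq_trans iv) ?leq_addr.
  have iz : (i - size v < (size z).+1)%N.
    by rewrite ltnS leq_subLR -size_cat -ltnS ltn_ord.
  rewrite -leq_subLR; apply: (bigop.bigmax_sup (Ordinal iz)) => //=.
  by move: ni; rewrite take_cat ltnNge vi /= nb_nb.
have [i ni ->] : {i : 'I_(size z).+1 | nb (take i z) & lastnb z = i}.
  have : (0 < #|[pred i : 'I_(size z).+1 | nb (take i z)]|)%N.
    by apply/card_gt0P; exists ord0; rewrite inE take0.
  by move=> /(eq_bigmax_cond (fun i : 'I_(size z).+1 => i : nat))[i ni E];
    exists i => //; rewrite -E; apply: eq_bigl => j; rewrite inE.
have iz : (size v + i < (size (v ++ z)).+1)%N.
  by rewrite size_cat ltnS leq_add2l -ltnS ltn_ord.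
apply: (bigop.bigmax_sup (Ordinal iz)) => //=.
by rewrite take_cat ltnNge leq_addr /= addKn nb_nb.
Qed.

Lemma lastnb_noret x : noret x -> lastnb x = 0%N.
Proof.
move=> nx; apply/eqP; rewrite -leqn0; apply/bigop.bigmax_leqP => i ni.
rewrite leqNgt; apply: contraL ni => i0; apply: (noretP nx).
by rewrite i0 -ltnS ltn_ord.
Qed.

Lemma lastnb_le x : (lastnb x <= size x)%N.
Proof. by apply/bigop.bigmax_leqP => i _; rewrite -ltnS. Qed.

Lemma lastnb_split x : nb (take (lastnb x) x) /\ noret (drop (lastnb x) x).
Proof.
have [n] := ubnP (size x); elim: n x => // n IH x xn.
case: (noret_or x) => [nx|[v [z [E fv]]]].
  by rewrite (lastnb_noret nx) take0 drop0.
have [w [t [Ev nw nv]]] := firstretP fv.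
have /IH[h1 h2] : (size z < n)%N.
  by move: xn; rewrite E size_cat Ev size_rcons; lia.
rewrite E (lastnb_cat _ nv) take_cat drop_cat ltnNge leq_addr /= addKn nb_nb//.
Qed.

(** * Renewal structure of the times without burgers *)

Section renewal.
Context {R : realType} (p : R) (hp0 : 0 < p) (hp : p < 1 / 2).

Local Ltac plra := move: hp0 hp => ? ?; lra.

Local Notation Ex := (word_ex p).
Local Notation S := (@netS R).
Local Notation M := (@discM R).
Local Notation pi_ := (pi_ p).
Local Notation e_ := (e_ p).

Lemma Ex_rmin k (f : nat -> R) : Ex k.+1 (fun x => f (rmin x)) =
  1 / 2 * Ex k (fun x => f (rmin x).-1) + 1 / 2 * Ex k (fun x => f (rmin x).+1).
Proof. by rewrite /= /letter_ex /=; field. Qed.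

(** Read from right to left, [rmin] is a simple walk whose downward steps at 0 are suppressed, and
    [r ^+ 2 + r] then grows by exactly 1 in mean. *)
Lemma Ermin2 k : Ex k (fun x => (rmin x)%:R ^+ 2) =
  k%:R - Ex k (fun x => (rmin x)%:R).
Proof.
elim: k => [|k IH]; first by rewrite /=; ring.
rewrite (Ex_rmin k (fun n => n%:R ^+ 2)) (Ex_rmin k (fun n => n%:R)).
have : Ex k (fun x => (rmin x).-1%:R ^+ 2 + (rmin x).+1%:R ^+ 2) =
    Ex k (fun x => (2 * (rmin x)%:R ^+ 2 + 2 * (rmin x)%:R + 2) -
      ((rmin x).-1%:R + (rmin x).+1%:R)).
  apply: Ex_ext => x _; case: (rmin x) => [|n] /=; first by ring.
  by rewrite -[n.+2%:R]natr1 -[n.+1%:R]natr1; ring.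
rewrite ExB !ExD !ExZ !Ex_cst IH -[k.+1%:R]natr1 => ?; lra.
Qed.

Lemma Ermin4 k : Ex k (fun x => (rmin x)%:R ^+ 4) <= 3 * k%:R ^+ 2 + k%:R.
Proof.
elim: k => [|k IH]; first by rewrite /=; lra.
rewrite (Ex_rmin k (fun n => n%:R ^+ 4)).
have h : Ex k (fun x => (rmin x).-1%:R ^+ 4 + (rmin x).+1%:R ^+ 4) <=
    Ex k (fun x => 2 * (rmin x)%:R ^+ 4 + 12 * (rmin x)%:R ^+ 2 + 2).
  apply: (Ex_le hp0 hp) => x _; case: (rmin x) => [|n] /=; first by lra.
  by rewrite -[n.+2%:R]natr1 -[n.+1%:R]natr1; lra.
have h2 : Ex k (fun x => (rmin x)%:R ^+ 2) <= k%:R.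
  rewrite Ermin2 gerBl; apply: (Ex_ge0 hp0 hp) => x _; exact: ler0n.
move: h; rewrite !ExD !ExZ !Ex_cst -[k.+1%:R]natr1 => h; lra.
Qed.

Lemma Ex_sqr_le k (F : word -> R) :
  Ex k F ^+ 2 <= Ex k (fun x => F x ^+ 2).
Proof.
have : 0 <= Ex k (fun x => (F x ^+ 2 - (2 * Ex k F) * F x) + Ex k F ^+ 2).
  apply: (Ex_ge0 hp0 hp) => x _.
  by rewrite (_ : _ + _ = (F x - Ex k F) ^+ 2) ?sqr_ge0//; ring.
by rewrite ExD ExB ExZ Ex_cst => ?; lra.
Qed.

Lemma Ermin1 k : Ex k (fun x => (rmin x)%:R) <= Num.sqrt k%:R.
Proof.
have r0 : 0 <= Ex k (fun x => (rmin x)%:R).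
  by apply: (Ex_ge0 hp0 hp) => x _; exact: ler0n.
rewrite -(ler_pXn2r (n := 2))// ?nnegrE ?sqrtr_ge0// sqr_sqrtr ?ler0n//.
by apply: le_trans (Ex_sqr_le _ _) _; rewrite Ermin2 gerBl.
Qed.

Definition nbsum (f : word -> R) (x : word) : R :=
  \sum_(s < (size x).+1) (nb (take s x))%:R * f (drop s x).

Lemma nbsum_ge0 f x : (forall y, 0 <= f y) -> 0 <= nbsum f x.
Proof. by move=> f0; apply: sumr_ge0 => i _; rewrite mulr_ge0. Qed.

Lemma nbsum_noret f x : noret x -> nbsum f x = f x.
Proof.
move=> nx; rewrite /nbsum big_ord_recl take0 drop0 mul1r big1 ?addr0// => i _.
by rewrite (negbTE (noretP nx _)) ?mul0r//= /bump /= add1n ltn_ord.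
Qed.

Lemma nbsum_firstret f v z : firstret v ->
  nbsum f (v ++ z) = f (v ++ z) + nbsum f z.
Proof.
move=> /firstretP[w [t [Ev nw nv]]].
have sv : size v = (size w).+1 by rewrite Ev size_rcons.
rewrite /nbsum big_ord_recl take0 drop0 mul1r; congr (_ + _).
rewrite -(big_mkord xpredT (fun s => (nb (take s z))%:R * f (drop s z))).
rewrite -(big_mkord xpredT (fun s => (nb (take s.+1 (v ++ z)))%:R *
  f (drop s.+1 (v ++ z)))).
rewrite size_cat sv addSn (@big_cat_nat _ _ _ (size w)) ?leqW ?leq_addr//=.
rewrite big_nat big1 ?add0r; last first.
  move=> s /andP[_ sw].
  have -> : take s.+1 (v ++ z) = take s.+1 w.
    by rewrite Ev -cats1 -catA takel_cat.
  by rewrite (negbTE (noretP nw _)) ?mul0r.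
rewrite -{1}[size w]add0n big_addn -addnS addKn.
apply: eq_bigr => s _.
have -> : (s + size w).+1 = (size v + s)%N by rewrite sv addSn addnC.
by rewrite take_cat drop_cat ltnNge leq_addr /= addKn nb_nb.
Qed.

Lemma Ex_nbsum k f :
  Ex k (nbsum f) = \sum_(s < k.+1) pi_ s * Ex (k - s) f.
Proof.
transitivity (Ex k (fun x =>
    \sum_(s < k.+1) (nb (take s x))%:R * f (drop s x))).
  by apply: Ex_ext => x <-.
rewrite (Ex_sum p k k.+1 (fun s x => (nb (take s x))%:R * f (drop s x))).
apply: eq_bigr => s _.
have sk : (s <= k)%N by rewrite -ltnS.
rewrite -{1}(subnKC sk) Ex_cat -ExZr; apply: Ex_ext => u us.
rewrite -ExZ; apply: Ex_ext => v _.
by rewrite -us take_size_cat// drop_size_cat.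
Qed.

(** [rmin] is additive over renewal blocks; the unfinished last block counts as well. *)
Lemma rmin_nbsum x : (rmin x)%:R = nbsum (fun y => (blk y)%:R) x.
Proof.
have [n] := ubnP (size x); elim: n x => // n IH x xn.
case: (noret_or x) => [nx|[v [z [E fv]]]].
  by rewrite nbsum_noret// blk_noret.
have [w [t [Ev nw nv]]] := firstretP fv.
rewrite E nbsum_firstret// -IH ?blk_firstret//; last first.
  by move: xn; rewrite E size_cat Ev size_rcons addSn !ltnS; apply: leq_trans;
    rewrite ltnS leq_addl.
by rewrite (@rmin_nb R _ _ nv) (@rmin_nbE R _ nv) natrD.
Qed.

Lemma Ermin_eq k : Ex k (fun x => (rmin x)%:R) =
  \sum_(s < k.+1) pi_ s * Ex (k - s) (fun y => (blk y)%:R).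
Proof. by rewrite -Ex_nbsum; apply: Ex_ext => x _; exact: rmin_nbsum. Qed.

Lemma Ex_rcons_le (F : word -> R) : (forall x t, F x <= F (rcons x t)) ->
  forall m n, (m <= n)%N -> Ex m F <= Ex n F.
Proof.
move=> Fm m; elim=> [|n IH]; first by rewrite leqn0 => /eqP ->.
rewrite leq_eqVlt => /orP[/eqP ->//|]; rewrite ltnS => /IH/le_trans; apply.
rewrite Ex_rcons; apply: (Ex_le hp0 hp) => x _.
have := Lx_le hp0 hp (fun t => Fm x t); rewrite {1}/letter_ex => h.
by apply: le_trans h; plra.
Qed.

Definition b_ k : R := Ex k (fun y => (blk y)%:R).

Lemma b_mono m n : (m <= n)%N -> b_ m <= b_ n.
Proof. by apply: Ex_rcons_le => x t; rewrite ler_nat blk_rcons. Qed.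

Lemma b_ge0 k : 0 <= b_ k.
Proof. by apply: (Ex_ge0 hp0 hp) => x _; exact: ler0n. Qed.

Lemma b1 : b_ 1 = 1 / 2.
Proof.
have E t : blk [:: t] = ~~ is_burger t :> nat by case: t.
by rewrite /b_ /= /letter_ex !E /=; field.
Qed.

Definition P_ k : R := \sum_(s < k) pi_ s.

Lemma P_ge0 k : 0 <= P_ k.
Proof. by apply: sumr_ge0 => i _; exact: pi_ge0. Qed.

(** In a word of length [2 * k], each renewal time before [k] is followed by at least [k] letters
    and so contributes at least [b_ k] to the mean of [rmin], which is at most the square root of
    the length. *)
Lemma P_b_le k : P_ k * b_ k <= Num.sqrt (2 * k%:R).
Proof.
apply: le_trans (_ : Ex (k + k) (fun x => (rmin x)%:R) <= _); last first.
  by apply: le_trans (Ermin1 _) _; rewrite addnn -mul2n natrM.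
rewrite Ermin_eq mulr_suml.
rewrite -(big_mkord xpredT (fun i => pi_ i * b_ k)).
rewrite -(big_mkord xpredT (fun s => pi_ s * b_ (k + k - s))).
rewrite [leRHS](@big_cat_nat _ _ _ k) ?leqW ?leq_addr//= -[leLHS]addr0.
apply: lerD; last by apply: sumr_ge0 => i _; rewrite mulr_ge0 ?pi_ge0 ?b_ge0.
rewrite !big_nat; apply: ler_sum => i /andP[_ ik].
by rewrite ler_wpM2l ?pi_ge0// b_mono// -addnBA ?leq_addr// ltnW.
Qed.

Lemma P_le k : P_ k <= 4 * Num.sqrt k%:R.
Proof.
case: k => [|k]; first by rewrite /P_ big_ord0 mulr_ge0// sqrtr_ge0.
have := P_b_le k.+1; have := @b_mono 1 k.+1 isT; rewrite b1 => h1 h2.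
have h3 : P_ k.+1 * (1 / 2) <= P_ k.+1 * b_ k.+1.
  by rewrite ler_wpM2l// P_ge0.
have h4 : Num.sqrt (2 * k.+1%:R) <= 2 * Num.sqrt k.+1%:R :> R.
  rewrite sqrtrM//; apply: ler_wpM2r; first exact: sqrtr_ge0.
  rewrite -(ler_pXn2r (n := 2))// ?nnegrE ?sqrtr_ge0// sqr_sqrtr//; lra.
lra.
Qed.

Definition rho (x : word) : R := (no (take (lastnb x) x))%:R.
Definition Mg (x : word) : R := M (take (lastnb x) x).
Definition ZZ (x : word) : R :=
  (M x ^+ 2 - Mg x ^+ 2) - (S x ^+ 2 - rho x ^+ 2).

Lemma sum_chunk k : \sum_(j < k) Ex j.+1 (fun y => (chunk y)%:R) = 1 - pi_ k.
Proof.
have := Ex_chunk p k (fun=> 1); rewrite Ex_cst => E.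
have E1 : Ex k (fun x => (nb x)%:R * 1) = pi_ k.
  by apply: Ex_ext => x _; rewrite mulr1.
have E2 : \sum_(j < k) Ex j.+1 (fun y => (chunk y)%:R *
    Ex (k - j.+1) (fun=> 1)) = \sum_(j < k) Ex j.+1 (fun y => (chunk y)%:R).
  by apply: eq_bigr => j _; apply: Ex_ext => y _; rewrite Ex_cst mulr1.
by rewrite -E2; move: E; rewrite E1 => E; rewrite [X in X - _]E addrC addKr.
Qed.

Lemma chunk1 j : Ex j.+1 (fun y => (chunk y)%:R) = pi_ j - pi_ j.+1.
Proof.
have := sum_chunk j.+1; rewrite big_ord_recr /= -/(Ex j.+1 _) sum_chunk => h.
by move: h; rewrite -/(Ex j.+1 (fun y => (chunk y)%:R)) => h; lra.
Qed.

Lemma sum_chunk_no k :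
  \sum_(j < k) Ex j.+1 (fun y => (chunk y)%:R * (no y)%:R) <= 1.
Proof.
have := Ex_chunk p k S; rewrite (ES hp0 hp) => E.
have E1 : Ex k (fun x => (nb x)%:R * S x) = - e_ k.
  rewrite -ExN; apply: Ex_ext => x _; case: (boolP (nb x)) => [nx|_].
    by have [_ _ ->] := @nb_nil R x nx; ring.
  by rewrite !mul0r oppr0.
have E2 j : Ex j.+1 (fun y => (chunk y)%:R * Ex (k - j.+1) (fun z => S (z ++ y))) =
    Ex j.+1 (fun y => (chunk y)%:R) - Ex j.+1 (fun y => (chunk y)%:R * (no y)%:R).
  rewrite -ExB; apply: Ex_ext => y _; case: (boolP (chunk y)) => [cy|_].
    have [_ Sy _ _] := @chunk_stats R y cy.
    rewrite !mul1r -Sy -[RHS](Ex_cst p (k - j.+1)) -[RHS]add0r.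
    rewrite -(ES hp0 hp (k - j.+1)) -ExD; apply: Ex_ext => z _.
    by rewrite S_cat.
  by rewrite !mul0r subr0.
move: E; rewrite E1 (eq_bigr _ (fun (j : 'I_k) _ => E2 j)) big_split /= sumrN sum_chunk.
have := pi_ge0 hp0 hp k; have := e_ge0 hp0 hp k; plra.
Qed.

(** Removing a chunk does not move the last time without burgers, and the cross terms have mean
    zero. The 4 comes from [(1 + no y) ^+ 2 - (1 - no y) ^+ 2]. *)
Lemma EZ_rec k : Ex k ZZ = \sum_(j < k)
  (Ex j.+1 (fun y => (chunk y)%:R) * Ex (k - j.+1) ZZ +
   4 * Ex j.+1 (fun y => (chunk y)%:R * (no y)%:R)).
Proof.
rewrite Ex_chunk (_ : Ex k _ = 0) ?add0r; last first.
  rewrite -[RHS](Ex_cst p k); apply: Ex_ext => x _.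
  case: (boolP (nb x)) => [nx|_]; last by rewrite mul0r.
  rewrite /ZZ /Mg /rho (lastnb_nb nx) take_size.
  by have [_ _ ->] := @nb_nil R x nx; ring.
apply: eq_bigr => j _; rewrite -ExZr -ExZ -ExD; apply: Ex_ext => y _.
case: (boolP (chunk y)) => [cy|_]; last by rewrite !mul0r mulr0 addr0.
have [My Sy _ sy] := @chunk_stats R y cy.
rewrite !mul1r; transitivity (Ex (k - j.+1) (fun z => ZZ z + (2 * M y) * M z +
    (- (2 * S y)) * S z + (M y ^+ 2 - S y ^+ 2))).
  apply: Ex_ext => z _; have [Mzy _ _] := @chunk_cat R z y cy.
  rewrite /ZZ /Mg /rho (lastnb_chunk _ cy) takel_cat ?lastnb_le//.
  by rewrite Mzy S_cat; ring.
have aff (F : word -> R) (u v w : R) : Ex (k - j.+1)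
    (fun z => F z + u * M z + v * S z + w) = Ex (k - j.+1) F + w.
  by rewrite !ExD !ExZ EM (ES hp0 hp) Ex_cst !mulr0 !addr0.
by rewrite aff My Sy; case: sy => ->; ring.
Qed.

(** The hypothesis makes [a * k%:R + b] a supersolution of [EZ_rec], whose source term is at most 4
    by [sum_chunk_no]. *)
Lemma EZ_le (a b : R) : 0 <= a -> 0 <= b ->
  (forall k, 4 <= a * P_ k + b * pi_ k) -> forall k, Ex k ZZ <= a * k%:R + b.
Proof.
move=> a0 b0 H; elim/ltn_ind => k IH.
(* Summation by parts, since [P_ n] is the sum of the [pi_ j] for [j < n]. *)
have abel n : \sum_(j < n) (pi_ j - pi_ j.+1) * (n - j.+1)%:R = n%:R - P_ n.
  elim: n => [|n IHn]; first by rewrite /P_ !big_ord0 subr0.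
  rewrite big_ord_recr /= subnn mulr0 addr0.
  transitivity (\sum_(j < n) ((pi_ j - pi_ j.+1) * (n - j.+1)%:R +
      (pi_ j - pi_ j.+1))).
    apply: eq_bigr => j _; rewrite subSn// -natr1; ring.
  rewrite big_split /= IHn /P_ big_ord_recr /= -natr1.
  rewrite (_ : \sum_(i < n) (pi_ i - pi_ i.+1) = pi_ 0 - pi_ n).
    by rewrite pi0; ring.
  elim: n {IH IHn} => [|n IHn]; first by rewrite big_ord0 subrr.
  by rewrite big_ord_recr /= IHn; ring.
have := H k; rewrite EZ_rec big_split /= -mulr_sumr.
have := sum_chunk_no k.
set s2 := \sum_(i < k) Ex i.+1 _ => hs2 Hk.
have : \sum_(j < k) Ex j.+1 (fun y => (chunk y)%:R) * Ex (k - j.+1) ZZ <=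
    \sum_(j < k) (pi_ j - pi_ j.+1) * (a * (k - j.+1)%:R + b).
  apply: ler_sum => j _; rewrite chunk1; apply: ler_wpM2l.
    by rewrite subr_ge0; exact: pi_decr.
  by apply: IH; rewrite -subSn// subSS leq_subr.
have -> : \sum_(j < k) (pi_ j - pi_ j.+1) * (a * (k - j.+1)%:R + b) =
    a * (k%:R - P_ k) + b * (1 - pi_ k).
  rewrite -abel -sum_chunk !mulr_sumr -big_split /=; apply: eq_bigr => j _.
  by rewrite -/(Ex j.+1 (fun y => (chunk y)%:R)) chunk1; ring.
move: (\sum_(j < k) _) => s1 hs1; lra.
Qed.

End renewal.

(** * The discrepancy at the last time without burgers *)

Section flexible_orders.
Context {R : realType} (p : R) (hp0 : 0 < p) (hp : p < 1 / 2).


Local Notation Ex := (word_ex p).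
Local Notation M := (@discM R).
Local Notation b_ := (b_ p).

Lemma Ex_firstret k (F : word -> R) :
  Ex k F = Ex k (fun x => (noret x)%:R * F x) +
  \sum_(j < k) Ex j.+1 (fun v => (firstret v)%:R *
     Ex (k - j.+1) (fun z => F (v ++ z))).
Proof.
pose T i := Ex i (fun y => (noret y)%:R * Ex (k - i) (fun z => F (y ++ z))).
have E0 : T 0 = Ex k F by rewrite /T /= subn0 mul1r.
have Ek : T k = Ex k (fun x => (noret x)%:R * F x).
  by rewrite /T subnn; apply: Ex_ext => x _; rewrite /= cats0.
rewrite -E0 -Ek; suff H n : (n <= k)%N -> T 0 = T n + \sum_(j < n)
    Ex j.+1 (fun y => (firstret y)%:R * Ex (k - j.+1) (fun z => F (y ++ z))).
  exact: H.
elim: n => [_|n IH lnk]; first by rewrite big_ord0 addr0.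
rewrite big_ord_recr (IH (ltnW lnk)) [in RHS]addrCA [RHS]addrC.
congr (_ + _); rewrite addrC {1}/T.
have -> : (k - n = (k - n.+1).+1)%N by lia.
rewrite {1}/T !Ex_rcons -ExD; apply: Ex_ext => y _.
rewrite /= /letter_ex !noret_rcons !firstret_rcons.
have E t : Ex (k - n.+1) (fun x => F (rcons y t ++ x)) =
           Ex (k - n.+1) (fun z => F (y ++ t :: z)).
  by apply: Ex_ext => z _; rewrite cat_rcons.
rewrite !E; case: (noret y); rewrite /= ?mul0r; last by ring.
by do 5!(case: (nb _)) => /=; ring.
Qed.

Lemma Mg_flip x : Mg (map flip x) = - Mg x :> R.
Proof.
rewrite /Mg.
have -> : lastnb (map flip x) = lastnb x.
  rewrite /lastnb size_map; apply: eq_bigl => i.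
  by rewrite -map_take nb_flip.
by rewrite -map_take M_flip.
Qed.

Lemma EMg k : Ex k (@Mg R) = 0.
Proof. by apply: Ex_odd => x _; exact: Mg_flip. Qed.

Lemma M_no v : nb v -> M v ^+ 2 <= (no v)%:R ^+ 2 :> R.
Proof.
move=> nv; have [h1 h2 _] := @nb_nil R v nv.
rewrite /discM h1 h2 noE !natrD.
have := (ler0n R (oH v), ler0n R (oC v), ler0n R (oF v)) => -[[]].
by move: (oH v)%:R (oC v)%:R (oF v)%:R => a b c ? ? ?; nra.
Qed.

Lemma M_nbcat u v : nb u -> M (u ++ v) = M u + M v.
Proof.
rewrite /nb => /eqP ub.
have E : act [::] (orders v) = (orders v, [::]).
  elim/last_ind: (orders v) (orders_all v) => // w x IH.
  by rewrite all_rcons => /andP[ox /IH E]; rewrite act_rcons E reduce_step_ord.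
rewrite /discM /nH /nC /oH /oC orders_cat stack_cat ub E cats0.
by have [-> -> _] := k_cat (orders u) (orders v); rewrite /cH /cC /= !natrD; ring.
Qed.

Let psi (x : word) : R := nbsum (fun y => (blk y)%:R ^+ 2) x.

(** [Mg] is the sum of the discrepancies of the completed blocks. The symmetry of what follows the
    first block kills the cross term, and the discrepancy of a completed block is at most its number
    of orders, which is its [blk]. *)
Lemma EMg2 k : Ex k (fun x => Mg x ^+ 2) <= Ex k psi.
Proof.
rewrite -subr_le0 -ExB; elim/ltn_ind: k => k IH.
rewrite Ex_firstret -[leRHS]addr0; apply: lerD.
  rewrite -oppr_ge0 -ExN; apply: (Ex_ge0 hp0 hp) => x _.
  case: (boolP (noret x)) => [nx|_]; last by rewrite mul0r oppr0.
  rewrite /Mg /psi (lastnb_noret nx) take0 (nbsum_noret _ nx) M_nil.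
  by rewrite mul1r opprB subr_ge0 expr0n sqr_ge0.
rewrite -oppr_ge0 -sumrN; apply: sumr_ge0 => j _.
rewrite -ExN; apply: (Ex_ge0 hp0 hp) => v _.
case: (boolP (firstret v)) => [fv|_]; last by rewrite mul0r oppr0.
have [w [t [Ev nw nv]]] := firstretP fv.
rewrite mul1r oppr_ge0.
have -> : Ex (k - j.+1) (fun z => Mg (v ++ z) ^+ 2 - psi (v ++ z)) =
   Ex (k - j.+1) (fun z => (M v ^+ 2 - (no v)%:R ^+ 2) + (2 * M v) * Mg z +
     (Mg z ^+ 2 - psi z)).
  apply: Ex_ext => z _; rewrite /Mg /psi (lastnb_cat _ nv).
  rewrite (nbsum_firstret _ _ fv) (blk_firstret _ fv) (@rmin_nbE R _ nv).
  rewrite take_cat ltnNge leq_addr /= addKn (M_nbcat _ nv); ring.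
have h1 := M_no nv.
have h2 : Ex (k - j.+1) (fun z => Mg z ^+ 2 - psi z) <= 0.
  by apply: IH; rewrite -subSn// subSS leq_subr.
have aff (F G : word -> R) (u c : R) : Ex (k - j.+1)
    (fun z => u + c * F z + G z) = u + c * Ex (k - j.+1) F + Ex (k - j.+1) G.
  by rewrite !ExD ExZ Ex_cst.
by rewrite (aff (@Mg R) (fun z => Mg z ^+ 2 - psi z)) EMg; lra.
Qed.

Lemma rmin_rho x : (rmin x)%:R = @rho R x + (blk (drop (lastnb x) x))%:R.
Proof.
have [nu nw] := lastnb_split x.
rewrite -{1}(cat_take_drop (lastnb x) x) (@rmin_nb R _ _ nu) natrD.
by rewrite (blk_noret nw).
Qed.

Lemma blk_psi x : (blk (drop (lastnb x) x))%:R ^+ 2 <= psi x.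
Proof.
have lx : (lastnb x < (size x).+1)%N by rewrite ltnS lastnb_le.
have [nu _] := lastnb_split x.
rewrite /psi /nbsum (bigD1 (Ordinal lx))//= nu mul1r lerDl.
by apply: sumr_ge0 => i _; rewrite mulr_ge0 ?sqr_ge0.
Qed.

Lemma nbsum_le x s : (s <= size x)%N -> nb (take s x) ->
  (blk (drop s x) <= rmin x)%N.
Proof.
move=> sx ns; rewrite -(ler_nat R) (@rmin_nbsum R x) /nbsum.
have lx : (s < (size x).+1)%N by [].
rewrite (bigD1 (Ordinal lx))//= ns mul1r lerDl.
by apply: sumr_ge0 => i _; rewrite mulr_ge0.
Qed.

(** If [rmin] is at most [X], no block exceeds [X] and the truncation changes nothing; otherwise
    [psi x] is at most [rmin ^+ 2], which the fourth power absorbs. *)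
Lemma psi_le x (X : R) : 0 < X ->
  psi x <= nbsum (fun y => Num.min (blk y)%:R X ^+ 2) x +
    (rmin x)%:R ^+ 4 / X ^+ 2.
Proof.
move=> X0; case: (leP (rmin x)%:R X) => rX.
  rewrite -[leLHS]addr0; apply: lerD; last first.
    by rewrite divr_ge0// exprn_ge0// ltW.
  apply: ler_sum => s _; case: (boolP (nb (take s x))) => [ns|_]; last by rewrite !mul0r.
  rewrite !mul1r min_l//; apply: le_trans rX; rewrite ler_nat nbsum_le//.
  by rewrite -ltnS.
apply: le_trans (_ : (rmin x)%:R ^+ 2 <= _).
  rewrite (@rmin_nbsum R x) expr2 {1}/nbsum mulr_suml; apply: ler_sum => s _.
  case: (boolP (nb (take s x))) => [ns|_]; last by rewrite !mul0r.
  rewrite !mul1r expr2 ler_wpM2l// -(@rmin_nbsum R x) ler_nat nbsum_le//.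
  by rewrite -ltnS.
rewrite -[leLHS]add0r; apply: lerD.
  by apply: nbsum_ge0 => y; exact: sqr_ge0.
rewrite ler_pdivlMr ?exprn_gt0// -[4%N]/(2 + 2)%N exprD.
rewrite ler_wpM2l ?sqr_ge0// lerXn2r ?nnegrE ?ltW//.
exact: lt_trans rX.
Qed.

Lemma Emin_le (X Y : R) j : 0 <= X -> 0 <= Y ->
  Ex j (fun y => Num.min (blk y)%:R X ^+ 2) <=
  Y * b_ j + X * (b_ j - Ex j (fun y => Num.min (blk y)%:R Y)).
Proof.
move=> X0 Y0; rewrite -ExB -!ExZ -ExD; apply: (Ex_le hp0 hp) => y _.
have := ler0n R (blk y); move: (blk y)%:R => b b0.
rewrite /Num.min; case: ifP => h1; case: ifP => h2; nra.
Qed.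

End flexible_orders.

Lemma ex_nat_gt {R : realType} (x : R) : exists n : nat, x < n%:R.
Proof.
exists (Num.bound `|x|); apply: le_lt_trans (ler_norm x) _.
exact: archi_boundP.
Qed.

(** * The contradiction for bounded block means, and its consequence for flexible orders *)

Section flexible_orders_small.
Context {R : realType} (p : R) (hp0 : 0 < p) (hp : p < 1 / 2).

Local Ltac plra := move: hp0 hp => ? ?; lra.

Local Notation Ex := (word_ex p).
Local Notation M := (@discM R).
Local Notation pi_ := (pi_ p).
Local Notation P_ := (P_ p).
Local Notation b_ := (b_ p).

(** The exact second moment of [rmin] is confronted with the bound on that of [rho]; the two differ
    by the last block. [d] splits the square of [rho + blk], and [psi] enters twice, through [Mg]
    and through the last block, whence [2 + d + d^-1]. *)
Lemma renewal_ineq (a b d Q Y eta X : R) k :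
  0 <= a -> 0 <= b -> 0 < d -> 0 <= Y -> 0 < X ->
  (forall j, 4 <= a * P_ j + b * pi_ j) ->
  (forall j, b_ j <= Q) ->
  (forall j, b_ j - Ex j (fun y => Num.min (blk y)%:R Y) <= eta) ->
  k%:R - Num.sqrt k%:R <= (1 + d) * (2 * p * k%:R + a * k%:R + b) +
    (2 + d + d^-1) * (P_ k.+1 * (Y * Q + X * eta) +
      (3 * k%:R ^+ 2 + k%:R) / X ^+ 2).
Proof.
move=> a0 b0 d0 Y0 X0 H bQ bY.
pose psi := nbsum (fun y => (blk y)%:R ^+ 2 : R).
have hpsi : Ex k psi <= P_ k.+1 * (Y * Q + X * eta) +
      (3 * k%:R ^+ 2 + k%:R) / X ^+ 2.
  apply: le_trans (_ : Ex k (fun x =>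
      nbsum (fun y => Num.min (blk y)%:R X ^+ 2) x +
      (rmin x)%:R ^+ 4 / X ^+ 2) <= _).
    by apply: (Ex_le hp0 hp) => x _; exact: psi_le.
  rewrite ExD ExZr Ex_nbsum; apply: lerD; last first.
    by rewrite ler_wpM2r ?invr_ge0 ?exprn_ge0 ?(ltW X0)// Ermin4.
  rewrite mulr_suml; apply: ler_sum => i _; apply: ler_wpM2l; first exact: pi_ge0.
  apply: le_trans (Emin_le hp0 hp _ (ltW X0) Y0) _.
  by apply: lerD; [exact: ler_wpM2l|apply: ler_wpM2l => //; exact: ltW].
have hrho : Ex k (fun x => rho x ^+ 2) =
    Ex k (@ZZ R) + k%:R - Ex k (fun x => M x ^+ 2) + Ex k (fun x => Mg x ^+ 2).
  rewrite -(ES2 hp0 hp) -!(ExD, ExB); apply: Ex_ext => x _.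
  by rewrite /ZZ; ring.
have hr : Ex k (fun x => (rmin x)%:R ^+ 2) <=
    (1 + d) * Ex k (fun x => rho x ^+ 2) + (1 + d^-1) * Ex k psi.
  rewrite -!ExZ -ExD; apply: (Ex_le hp0 hp) => x _.
  have := @blk_psi R x; rewrite rmin_rho -/(psi x).
  move: (rho x) (blk _)%:R (psi x) => r b' s bs.
  apply: le_trans (_ : (1 + d) * r ^+ 2 + (1 + d^-1) * b' ^+ 2 <= _); last first.
    by rewrite lerD2l ler_wpM2l// addr_ge0// invr_ge0 ltW.
  rewrite -subr_ge0; have -> : (1 + d) * r ^+ 2 + (1 + d^-1) * b' ^+ 2 -
      (r + b') ^+ 2 = d^-1 * (d * r - b') ^+ 2 by field; rewrite gt_eqF.
  by rewrite mulr_ge0 ?sqr_ge0// invr_ge0 ltW.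
have h1 := EZ_le hp0 hp a0 b0 H k.
have h2 := EM2_ge hp0 hp k.
have h3 := EMg2 hp0 hp k.
have h4 := Ermin1 hp0 hp k.
rewrite Ermin2 in hr.
have hd : 0 <= d^-1 by rewrite invr_ge0 ltW.
have h5 : Ex k (fun x => rho x ^+ 2) <=
    2 * p * k%:R + a * k%:R + b + Ex k psi.
  by move: h3; rewrite -/psi hrho => h3; lra.
have h6 : (1 + d) * Ex k (fun x => rho x ^+ 2) <=
   (1 + d) * (2 * p * k%:R + a * k%:R + b + Ex k psi).
  by apply: ler_wpM2l => //; rewrite addr_ge0 ?ltW.
have h7 : (2 + d + d^-1) * Ex k psi <= (2 + d + d^-1) * (P_ k.+1 *
    (Y * Q + X * eta) + (3 * k%:R ^+ 2 + k%:R) / X ^+ 2).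
  by apply: ler_wpM2l => //; lra.
by lra.
Qed.

(** [b_] is nondecreasing and bounded, so it is within [eta] of its supremum at some [j0]. On words
    of length [j0] truncation at [j0] is void, and longer words only have a larger truncated
    mean. *)
Lemma b_ui Q eta : (forall j, b_ j <= Q) -> 0 < eta -> exists Y : R, 0 <= Y /\
  forall j, b_ j - Ex j (fun y => Num.min (blk y)%:R Y) <= eta.
Proof.
move=> bQ eta0.
have [j0 Hj0] : exists j0, forall j, b_ j <= b_ j0 + eta.
  apply/not_existsP => H.
  have {}H j0 : exists j, b_ j0 + eta < b_ j.
    have /existsNP[j /negP] := H j0; rewrite -ltNge => h; by exists j.
  have H2 n : exists j, eta * n%:R <= b_ j.
    elim: n => [|n [j hj]]; first by exists 0%N; rewrite mulr0 b_ge0.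
    have [i hi] := H j; exists i; rewrite -natr1; lra.
  have [n hn] := ex_nat_gt (Q / eta).
  have [j hj] := H2 n; have := bQ j.
  by move: hn; rewrite ltr_pdivrMr// mulrC => hn; lra.
exists j0%:R; split => // j.
have mono m n : (m <= n)%N -> Ex m (fun y => Num.min (blk y)%:R j0%:R) <=
    Ex n (fun y => Num.min (blk y)%:R j0%:R).
  apply: (Ex_rcons_le hp0 hp) => x t.
  rewrite le_min !ge_min lexx orbT andbT.
  by rewrite ler_nat blk_rcons.
have E i : (i <= j0)%N -> Ex i (fun y => Num.min (blk y)%:R j0%:R) = b_ i.
  move=> ij; apply: Ex_ext => x xi; rewrite min_l// ler_nat.
  by rewrite (leq_trans (blk_size x))// xi.
case: (leqP j j0) => [jj0|/ltnW jj0]; first by rewrite (E _ jj0) subrr ltW.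
have := mono _ _ jj0; rewrite (E _ (leqnn _)) => h1; have := Hj0 j; lra.
Qed.

Lemma P_mono m n : (m <= n)%N -> P_ m <= P_ n.
Proof.
move=> mn; rewrite /P_ -!(big_mkord xpredT (fun s => pi_ s)).
rewrite [leRHS](@big_cat_nat _ _ _ m)//= lerDl.
by apply: sumr_ge0 => i _; exact: pi_ge0.
Qed.

(** With bounded block means, [renewal_ineq] for [k = n ^ 2] and [X = K * n] would bound a fixed
    multiple of [n ^+ 2] by a multiple of [n]. *)
Lemma blk_unbounded : (forall B : R, exists k, B < P_ k) ->
  forall Q : R, exists j, Q < b_ j.
Proof.
move=> HP Q; apply/not_existsP => H.
have bQ j : b_ j <= Q by have /negP := H j; rewrite -leNgt.
have Q0 : 0 <= Q := le_trans (b_ge0 hp0 hp 0) (bQ 0%N).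
have pi_gt0 k : 0 < pi_ k.
  rewrite lt_neqAle pi_ge0// andbT eq_sym; apply/negP => /eqP pk.
  have [n hn] := HP (P_ k); have : P_ n <= P_ k; last by lra.
  case: (leqP n k) => [|/ltnW kn]; first exact: P_mono.
  rewrite {1}/P_ -(big_mkord xpredT (fun s => pi_ s)).
  rewrite (@big_cat_nat _ _ _ k)//= big_mkord -/(P_ k) gerDl big_nat.
  apply: sumr_le0 => i /andP[ki _]; rewrite -pk; exact: pi_mono.
(* [g] is the room between [2 * p] and 1; [d], [K] and [eta] below are chosen so that each error
   spends only a fraction of it. *)
pose g := 1 - 2 * p; have g0 : 0 < g by rewrite /g; plra.
have g1 : g < 1 by rewrite /g; plra.
pose d := g / 8; have d0 : 0 < d by rewrite divr_gt0.
pose A := 2 + d + d^-1.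
have A2 : 2 <= A by rewrite /A; have := invr_gt0 d; rewrite d0; lra.
have [K0 hK0] := HP (4 / d).
(* In [Hab], large [j] are settled by [d * P_ j] and the others by [pi_ j >= pi_ K0]. *)
pose b := 4 / pi_ K0.
have b0 : 0 < b by rewrite divr_gt0.
have Hab j : 4 <= d * P_ j + b * pi_ j.
  case: (leqP K0 j) => [/P_mono h|/ltnW/(pi_mono hp0 hp) h].
    apply: le_trans (_ : d * P_ j <= _); last by rewrite lerDl mulr_ge0 ?ltW.
    by rewrite mulrC -ler_pdivrMr// (le_trans (ltW hK0)).
  apply: le_trans (_ : b * pi_ j <= _).
    by rewrite /b mulrAC ler_pdivlMr// ler_pM2l.
  by rewrite lerDr mulr_ge0 ?P_ge0 ?ltW.
pose K := Num.sqrt (32 * A / g).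
have K2 : K ^+ 2 = 32 * A / g.
  by rewrite sqr_sqrtr// divr_ge0 ?ltW// mulr_gt0//; lra.
have K0' : 0 < K by rewrite sqrtr_gt0 divr_gt0// mulr_gt0//; lra.
pose eta := g / (64 * A * K).
have eta0 : 0 < eta by rewrite divr_gt0// !mulr_gt0//; lra.
have [Y [Y0 HY]] := b_ui bQ eta0.
pose c := 1 + 8 * A * (Y * Q).
have [n hn] := ex_nat_gt (2 * (c + 2 * b) / g).
have c0 : 0 <= c by rewrite addr_ge0// !mulr_ge0//; lra.
have n0 : (0 < n)%N.
  by rewrite -(ltr_nat R); apply: le_lt_trans hn; rewrite divr_ge0 ?mulr_ge0//; lra.
have nR1 : 1 <= n%:R :> R by rewrite ler1n.
have := @renewal_ineq d b d Q Y eta (K * n%:R) (n ^ 2) (ltW d0) (ltW b0) d0 Y0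
  _ Hab bQ HY.
rewrite natrX sqrtr_sqr normr_nat -/A => /(_ (mulr_gt0 K0' _)).
move=> /(_ (lt_le_trans ltr01 nR1)).
have hP : P_ (n ^ 2).+1 <= 8 * n%:R.
  apply: le_trans (P_le hp0 hp _) _.
  rewrite [8](_ : _ = 4 * 2); last by ring.
  rewrite -mulrA ler_pM2l//.
  rewrite -(ler_pXn2r (n := 2))// ?nnegrE ?sqrtr_ge0 ?mulr_ge0//.
  by rewrite sqr_sqrtr// -natr1 natrX; nra.
have hP1 : P_ (n ^ 2).+1 * (Y * Q + K * n%:R * eta) <=
    8 * n%:R * (Y * Q + K * n%:R * eta).
  apply: ler_wpM2r => //; apply: addr_ge0; first exact: mulr_ge0.
  by apply: mulr_ge0; [apply: mulr_ge0 => //|]; exact: ltW.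
have hP2 : A * (P_ (n ^ 2).+1 * (Y * Q + K * n%:R * eta)) <=
    A * (8 * n%:R * (Y * Q + K * n%:R * eta)).
  by apply: ler_wpM2l => //; lra.
have e1 : A * (8 * n%:R * (Y * Q + K * n%:R * eta)) =
   8 * A * (Y * Q) * n%:R + g / 8 * n%:R ^+ 2.
  rewrite /eta; field; rewrite !gt_eqF//; lra.
have e2 : A * ((3 * (n%:R ^+ 2) ^+ 2 + n%:R ^+ 2) / (K * n%:R) ^+ 2) <=
    g / 8 * n%:R ^+ 2.
  rewrite [(K * _) ^+ 2]exprMn K2.
  have -> : A * ((3 * (n%:R ^+ 2) ^+ 2 + n%:R ^+ 2) / (32 * A / g * n%:R ^+ 2)) =
     g / 32 * (3 * n%:R ^+ 2 + 1).
    field; rewrite !gt_eqF//; lra.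
  have : 1 <= n%:R ^+ 2 :> R by rewrite -natrX ler1n expn_gt0 n0.
  by nra.
rewrite mulrDr => h.
have h3 : n%:R ^+ 2 - n%:R <= (1 + d) * (2 * p * n%:R ^+ 2 + d * n%:R ^+ 2 + b) +
  (8 * A * (Y * Q) * n%:R + g / 8 * n%:R ^+ 2 + g / 8 * n%:R ^+ 2) by lra.
have h4 : (1 + d) * (2 * p * n%:R ^+ 2 + d * n%:R ^+ 2 + b) <=
   (1 - 3 / 4 * g) * n%:R ^+ 2 + 2 * b.
  have -> : 2 * p = 1 - g by rewrite /g; ring.
  have n2 := sqr_ge0 (n%:R : R).
  have gn : 0 <= g ^+ 2 * n%:R ^+ 2 by rewrite mulr_ge0 ?sqr_ge0.
  have gb : 0 <= (1 - g) * b by rewrite mulr_ge0//; lra.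
  by rewrite /d; nra.
have h5 : g / 2 * n%:R ^+ 2 <= (c + 2 * b) * n%:R by rewrite /c; nra.
move: hn; rewrite ltr_pdivrMr// => hn.
by nra.
Qed.

Lemma P_small (eps : R) : 0 < eps -> exists k0, forall k, (k0 <= k)%N ->
  P_ k <= eps * Num.sqrt k%:R.
Proof.
move=> eps0; case: (pselect (exists B, forall k, P_ k <= B)) => [[B HB]|HB].
  have [n hn] := ex_nat_gt ((B / eps) ^+ 2).
  exists n => k nk; apply: le_trans (HB k) _.
  rewrite mulrC -ler_pdivrMr//; apply: le_trans (ler_norm _) _.
  by rewrite -sqrtr_sqr ler_wsqrtr// (le_trans (ltW hn))// ler_nat.
have HP (B : R) : exists k, B < P_ k.
  apply/not_existsP => H; apply: HB; exists B => k.
  by have /negP := H k; rewrite -leNgt.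
have [j hj] := blk_unbounded HP (2 / eps).
exists j => k jk; have bk := b_mono hp0 hp jk.
have := P_b_le hp0 hp k.
have h1 : Num.sqrt (2 * k%:R) <= 2 * Num.sqrt k%:R :> R.
  rewrite sqrtrM//; apply: ler_wpM2r; first exact: sqrtr_ge0.
  by rewrite -(ler_pXn2r (n := 2))// ?nnegrE ?sqrtr_ge0// sqr_sqrtr//; lra.
have h2 : P_ k * (2 / eps) <= P_ k * b_ k.
  by apply: ler_wpM2l; [exact: P_ge0|exact: le_trans (ltW hj) bk].
move=> h3; have : P_ k * (2 / eps) <= 2 * Num.sqrt k%:R by lra.
by rewrite mulrA ler_pdivrMr// => h; lra.
Qed.

Lemma EoF_small (eps : R) : 0 < eps -> exists k0, forall k, (k0 <= k)%N ->
  Ex k (fun x => (oF x)%:R) <= eps * Num.sqrt k%:R.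
Proof.
move=> eps0; have [k0 H] := P_small eps0; exists k0 => k /H h.
rewrite EoF; apply: le_trans h; rewrite -/(P_ k).
by have := P_ge0 hp0 hp k; move: hp0 hp => ? ?; nra.
Qed.

End flexible_orders_small.

(** * Probabilities at diffusive scale *)

Section anticoncentration.
Context {R : realType} (p : R) (hp0 : 0 < p) (hp : p < 1 / 2).

Local Ltac plra := move: hp0 hp => ? ?; lra.

Local Notation Ex := (word_ex p).
Local Notation pr := (pr p).
Local Notation S := (@netS R).
Local Notation M := (@discM R).

Lemma pr_compl k (Q : word -> bool) : pr k (fun x => ~~ Q x) = 1 - pr k Q.
Proof.
rewrite /pr -{2}(Ex_cst p k 1) -ExB; apply: Ex_ext => x _.
by case: (Q x) => /=; ring.
Qed.

(** The integrated bound is pointwise: on the event it amounts to a completed square, elsewhere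
    [Z ^+ 2] is below [v / 2]. *)
Lemma paley_zygmund k (Z : word -> R) (v B : R) : 0 < v -> 0 < B ->
  v <= Ex k (fun x => Z x ^+ 2) -> Ex k (fun x => Z x ^+ 4) <= B * v ^+ 2 ->
  1 / (4 * B) <= pr k (fun x => v / 2 <= Z x ^+ 2).
Proof.
move=> v0 B0 h2 h4.
have Bv : 0 < 4 * B * v by rewrite !mulr_gt0.
have : Ex k (fun x => Z x ^+ 2) <= Ex k (fun x => v / 2 +
    (4 * B * v)^-1 * Z x ^+ 4 + (B * v) * (v / 2 <= Z x ^+ 2)%R%:R).
  apply: (Ex_le hp0 hp) => x _; case: (leP (v / 2) (Z x ^+ 2)) => /= hZ.
    rewrite -subr_ge0.
    have -> : v / 2 + (4 * B * v)^-1 * Z x ^+ 4 + B * v * 1 - Z x ^+ 2 =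
      v / 2 + (4 * B * v)^-1 * (Z x ^+ 2 - 2 * B * v) ^+ 2.
      by field; rewrite !gt_eqF.
    apply: addr_ge0; first by rewrite divr_ge0// ltW.
    by rewrite mulr_ge0 ?sqr_ge0// invr_ge0 ltW.
  have : 0 <= (4 * B * v)^-1 * Z x ^+ 4.
    apply: mulr_ge0; first by rewrite invr_ge0 ltW.
    by rewrite -[4%N]/(2 * 2)%N exprM sqr_ge0.
  by lra.
rewrite !ExD !ExZ Ex_cst => h.
have : (4 * B * v)^-1 * Ex k (fun x => Z x ^+ 4) <= v / 4.
  by rewrite ler_pdivrMl//; apply: le_trans h4 _; lra.
move=> h5; rewrite ler_pdivrMr; last by lra.
rewrite -/(pr k _) in h *.
have h6 : v * 1 <= v * (pr k (fun x => v / 2 <= Z x ^+ 2) * (4 * B)) by lra.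
by move: h6; rewrite ler_pM2l.
Qed.

(** The linear term has mean zero but makes the test polynomial at most [s ^+ 2 / 4] unless [Z] is
    very negative; its mean is at least [3 / 4 * s ^+ 2], so the left tail must carry mass. *)
Lemma paley_zygmund_neg k (Z : word -> R) (s B : R) : 0 < s -> 1 <= B ->
  Ex k Z = 0 ->
  s ^+ 2 <= Ex k (fun x => Z x ^+ 2) -> Ex k (fun x => Z x ^+ 4) <= B * s ^+ 4 ->
  1 / (10 * B ^+ 2) <= pr k (fun x => Z x <= - (s / (16 * B))).
Proof.
move=> s0 B1 h1 h2 h4; have B0 : 0 < B by lra.
set c := 1 / (16 * B).
have c0 : 0 < c by rewrite divr_gt0//; lra.
have Bc : B * c = 1 / 16 by rewrite /c; field; rewrite gt_eqF.
have c1 : c <= 1 / 16 by rewrite /c ler_pdivrMr//; lra.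
have : Ex k (fun x => (Z x ^+ 2 - (4 * B * s ^+ 2)^-1 * Z x ^+ 4) -
    (2 * B * s) * Z x) <= Ex k (fun x => s ^+ 2 / 4 +
    (5 * B ^+ 2 * s ^+ 2) * (Z x <= - (s / (16 * B)))%R%:R).
  apply: (Ex_le hp0 hp) => x _.
  have -> : s / (16 * B) = c * s by rewrite /c; field; rewrite gt_eqF.
  set y := Z x / s; have -> : Z x = y * s by rewrite /y mulfVK// gt_eqF.
  rewrite -[- (c * s)]mulNr (ler_pM2r s0).
  have -> : (y * s) ^+ 2 - (4 * B * s ^+ 2)^-1 * (y * s) ^+ 4 -
      2 * B * s * (y * s) =
      s ^+ 2 * (y ^+ 2 - y ^+ 4 / (4 * B) - 2 * B * y).
    by field; rewrite !gt_eqF.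
  set b := (_ <= _)%R%:R.
  have -> : s ^+ 2 / 4 + 5 * B ^+ 2 * s ^+ 2 * b =
    s ^+ 2 * (1 / 4 + 5 * B ^+ 2 * b) by ring.
  apply: ler_wpM2l; first exact: sqr_ge0.
  have q4 : 0 <= y ^+ 4 / (4 * B).
    by rewrite divr_ge0//; [rewrite -[4%N]/(2 * 2)%N exprM sqr_ge0|lra].
  rewrite /b; case: (leP y (- c)) => hy /=.
    have h : 0 <= (y ^+ 2 / (2 * B) - 3 / 2) ^+ 2 * B.
      by rewrite mulr_ge0 ?sqr_ge0// ltW.
    have e : (y ^+ 2 / (2 * B) - 3 / 2) ^+ 2 * B =
        y ^+ 4 / (4 * B) - 3 / 2 * y ^+ 2 + 9 / 4 * B.
      by field; rewrite gt_eqF.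
    rewrite e in h; have h' := sqr_ge0 (y + 2 * B).
    have BB : B <= B ^+ 2 by rewrite expr2 ler_peMr// ltW.
    by nra.
  case: (leP 0 y) => y0.
    case: (leP y (2 * B)) => yB; first by nra.
    have : y ^+ 2 <= y ^+ 4 / (4 * B).
      rewrite ler_pdivlMr; last by lra.
      rewrite -[4%N in leRHS]/(2 + 2)%N exprD ler_wpM2l ?sqr_ge0//; nra.
    have : 0 <= B * y by rewrite mulr_ge0// ltW.
    by lra.
  have : (- y) ^+ 2 <= c ^+ 2.
    by rewrite lerXn2r ?nnegrE; lra.
  have : c ^+ 2 <= 1 / 16 by rewrite expr2; nra.
  have : B * - y <= B * c by apply: ler_wpM2l; lra.
  by rewrite Bc sqrrN; lra.
rewrite ExB ExB ExD !ExZ Ex_cst h1 mulr0 subr0 -/(pr k _) => h.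
have : (4 * B * s ^+ 2)^-1 * Ex k (fun x => Z x ^+ 4) <= s ^+ 2 / 4.
  rewrite ler_pdivrMl; last by rewrite !mulr_gt0 ?exprn_gt0//; lra.
  by rewrite [leRHS](_ : _ = B * s ^+ 4)//; field.
move=> h5; rewrite ler_pdivrMr; last by rewrite mulr_gt0 ?exprn_gt0.
have s2 : 0 < s ^+ 2 by rewrite exprn_gt0.
set q := pr k _ in h *.
have h6 : s ^+ 2 * 1 <= s ^+ 2 * (q * (10 * B ^+ 2)) by lra.
by move: h6; rewrite ler_pM2l.
Qed.

Lemma S_tail k (K : R) : 0 < K -> pr k (fun x => K * Num.sqrt k%:R < `|S x|)
  <= K ^- 2.
Proof.
move=> K0; case: k => [|k].
  rewrite /pr /= S_nil normr0 sqrtr0 mulr0 ltxx.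
  by rewrite invr_ge0 exprn_ge0// ltW.
set w := Num.sqrt _; have w0 : 0 < w by rewrite sqrtr_gt0.
apply: le_trans (_ : pr k.+1 (fun x => K ^+ 2 * k.+1%:R <= S x ^+ 2) <= _).
  apply: (pr_le hp0 hp) => x _ /ltW h.
  rewrite -(sqr_sqrtr (ler0n R k.+1)) -/w -exprMn -[leRHS]real_normK ?num_real//.
  by rewrite lerXn2r ?nnegrE// mulr_ge0// ltW.
apply: le_trans (Ex_markov hp0 hp _ _) _.
- by rewrite mulr_gt0// exprn_gt0.
- by move=> x _; exact: sqr_ge0.
rewrite (ES2 hp0 hp) ler_pdivrMr ?mulr_gt0 ?exprn_gt0//.
by rewrite mulrA mulVf ?mul1r// expf_neq0// gt_eqF.
Qed.

Lemma M_tail k (K : R) : 0 < K -> pr k (fun x => K * Num.sqrt k%:R < `|M x|)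
  <= K ^- 2.
Proof.
move=> K0; case: k => [|k].
  rewrite /pr /= M_nil normr0 sqrtr0 mulr0 ltxx.
  by rewrite invr_ge0 exprn_ge0// ltW.
set w := Num.sqrt _; have w0 : 0 < w by rewrite sqrtr_gt0.
apply: le_trans (_ : pr k.+1 (fun x => K ^+ 2 * k.+1%:R <= M x ^+ 2) <= _).
  apply: (pr_le hp0 hp) => x _ /ltW h.
  rewrite -(sqr_sqrtr (ler0n R k.+1)) -/w -exprMn -[leRHS]real_normK ?num_real//.
  by rewrite lerXn2r ?nnegrE// mulr_ge0// ltW.
apply: le_trans (Ex_markov hp0 hp _ _) _.
- by rewrite mulr_gt0// exprn_gt0.
- by move=> x _; exact: sqr_ge0.
rewrite ler_pdivrMr ?mulr_gt0 ?exprn_gt0//.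
rewrite mulrA mulVf ?mul1r ?EM2_le// expf_neq0// gt_eqF//.
Qed.

Lemma no_tail k (y : R) : 0 < y -> pr k (fun x => y <= (no x)%:R)
  <= 10 * k%:R / y ^+ 2.
Proof.
move=> y0.
apply: le_trans (_ : pr k (fun x => y ^+ 2 <= (no x)%:R ^+ 2) <= _).
  by apply: (pr_le hp0 hp) => x _ h; rewrite lerXn2r ?nnegrE// ltW.
apply: le_trans (Ex_markov hp0 hp _ _) _.
- by rewrite exprn_gt0.
- by move=> x _; exact: sqr_ge0.
by apply: ler_wpM2r; [rewrite invr_ge0 exprn_ge0// ltW|exact: Eno2].
Qed.

Lemma oF_tail (eps : R) : 0 < eps -> forall c : R, 0 < c -> exists k0, forall k,
  (k0 <= k)%N -> pr k (fun x => c * Num.sqrt k%:R < (oF x)%:R) <= eps.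
Proof.
move=> e0 c c0; have [k0 H] := EoF_small hp0 hp (mulr_gt0 e0 c0).
exists k0.+1 => k kk.
have w0 : 0 < Num.sqrt k%:R :> R by rewrite sqrtr_gt0 ltr0n (leq_trans _ kk).
apply: le_trans (_ : pr k (fun x => c * Num.sqrt k%:R <= (oF x)%:R) <= _).
  by apply: (pr_le hp0 hp) => x _ /ltW.
apply: le_trans (Ex_markov hp0 hp _ _) _.
- by rewrite mulr_gt0.
- by move=> x _; exact: ler0n.
by rewrite ler_pdivrMr ?mulr_gt0// mulrA H// ltnW.
Qed.

(** [S + M] is [2 * (nH - oH) - oF]. As [oF] is negligible, a very negative value forces many
    unfulfilled hamburger orders. The 56 is [8 * 3 + 8 * 4], from the fourth moments of [S] and
    [M]. *)
Lemma kill : exists c c0 : R, [/\ 0 < c, 0 < c0 & exists k0, forall k,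
  (k0 <= k)%N -> c0 <= pr k (fun x => c * Num.sqrt k%:R <= (oH x)%:R)].
Proof.
pose c : R := 1 / (16 * 56); have c0 : 0 < c by rewrite divr_gt0.
pose q : R := 1 / (10 * 56 ^+ 2); have q0 : 0 < q by rewrite divr_gt0.
have [k0 H] := oF_tail (divr_gt0 q0 (ltr0n R 2)) (divr_gt0 c0 (ltr0n R 2)).
exists (c / 4), (q / 2); rewrite !divr_gt0//; split => //.
exists k0.+1 => k kk; have {}H := H k (ltnW kk).
set w := Num.sqrt k%:R.
have k1 : 1 <= k%:R :> R by rewrite ler1n (leq_trans _ kk).
have w0 : 0 < w by rewrite sqrtr_gt0; lra.
have w2 : w ^+ 2 = k%:R by rewrite sqr_sqrtr.
have := @paley_zygmund_neg k (fun x => S x + M x) w 56 w0.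
have -> : w / (16 * 56) = c * w by rewrite /c; ring.
rewrite -/q => /(_ _ _ _ _)-PZ.
have {PZ}PZ : q <= pr k (fun x => S x + M x <= - (c * w)).
  apply: PZ; first by lra.
  - have -> : Ex k (fun x => S x + M x) = Ex k S + Ex k M.
      by rewrite -(ExD p k S M).
    by rewrite (ES hp0 hp) EM addr0.
  - rewrite w2; have -> : Ex k (fun x => (S x + M x) ^+ 2) = Ex k (fun x =>
        S x ^+ 2) + 2 * Ex k (fun x => S x * M x) + Ex k (fun x => M x ^+ 2).
      by rewrite -ExZ -!ExD; apply: Ex_ext => x _; ring.
    rewrite (ES2 hp0 hp) ESM mulr0 addr0 lerDl.
    by apply: (Ex_ge0 hp0 hp) => x _; exact: sqr_ge0.
  - have -> : w ^+ 4 = k%:R ^+ 2 by rewrite -[4%N]/(2 * 2)%N exprM w2.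
    apply: le_trans (_ : Ex k (fun x => 8 * S x ^+ 4 + 8 * M x ^+ 4) <= _).
      apply: (Ex_le hp0 hp) => x _; move: (S x) (M x) => a b.
      have h1 := sqr_ge0 (a - b); have h2 := sqr_ge0 (a ^+ 2 - b ^+ 2).
      have h3 := sqr_ge0 (a + b).
      have h4 : (a + b) ^+ 2 <= 2 * (a ^+ 2 + b ^+ 2) by lra.
      have h5 : ((a + b) ^+ 2) ^+ 2 <= (2 * (a ^+ 2 + b ^+ 2)) ^+ 2.
        rewrite lerXn2r// nnegrE// mulr_ge0// addr_ge0// sqr_ge0//.
      by move: h5; rewrite -exprM; lra.
    rewrite ExD !ExZ; have := ES4 hp0 hp k; have := EM4_le hp0 hp k.
    have : k%:R <= k%:R ^+ 2 :> R by rewrite expr2 ler_peMr//; lra.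
    by lra.
have : pr k (fun x => S x + M x <= - (c * w)) <=
    pr k (fun x => (c / 4 * w <= (oH x)%:R) || (c / 2 * w < (oF x)%:R)).
  apply: (pr_le hp0 hp) => x _ h.
  case: (leP (oF x)%:R (c / 2 * w)) => hF; rewrite ?orbT// orbF.
  by move: h; rewrite /netS /discM; have := ler0n R (nH x); lra.
move=> /le_trans/(_ (prU hp0 hp _ _ _)) h.
by lra.
Qed.

Lemma S_pos : exists c c0 : R, [/\ 0 < c, 0 < c0 & forall (b : bool) k,
  (0 < k)%N -> c0 <= pr k (fun x => c * Num.sqrt k%:R <= (-1) ^+ b * S x)].
Proof.
pose c : R := 1 / (16 * 3); have c0 : 0 < c by rewrite divr_gt0.
pose q : R := 1 / (10 * 3 ^+ 2); have q0 : 0 < q by rewrite divr_gt0.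
exists c, q; split => // b k k0.
have w0 : 0 < Num.sqrt k%:R :> R by rewrite sqrtr_gt0 ltr0n.
set w := Num.sqrt _ in w0 *.
have w2 : w ^+ 2 = k%:R by rewrite sqr_sqrtr.
have := @paley_zygmund_neg k (fun x => (-1) ^+ (~~ b) * S x) w 3 w0.
have -> : w / (16 * 3) = c * w by rewrite /c; ring.
rewrite -/q => /(_ _ _ _ _)-PZ.
have {PZ}PZ : q <= pr k (fun x => (-1) ^+ (~~ b) * S x <= - (c * w)).
  apply: PZ; first by lra.
  - have -> : Ex k (fun x => (-1) ^+ (~~ b) * S x) = (-1) ^+ (~~ b) * Ex k S.
      by rewrite -ExZ.
    by rewrite (ES hp0 hp) mulr0.
  - rewrite w2 -(ES2 hp0 hp); apply: (Ex_le hp0 hp) => x _.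
    by rewrite exprMn sqrr_sign mul1r.
  - rewrite -[4%N in leRHS]/(2 * 2)%N exprM w2; apply: le_trans (ES4 hp0 hp k).
    apply: (Ex_le hp0 hp) => x _.
    by rewrite exprMn -[4%N in X in X * _]/(2 * 2)%N exprM sqrr_sign expr1n mul1r.
apply: le_trans PZ _; apply: (pr_le hp0 hp) => x _.
by case: b => /=; rewrite ?expr0 ?expr1; lra.
Qed.

Lemma M_big : exists c c0 : R, [/\ 0 < c, 0 < c0 & forall k,
  (0 < k)%N -> c0 <= pr k (fun x => c * Num.sqrt k%:R <= `|M x|)].
Proof.
pose g := 1 - 2 * p; have g0 : 0 < g by rewrite /g; plra.
pose B := 4 / g ^+ 2; have B0 : 0 < B by rewrite divr_gt0 ?exprn_gt0.
exists (Num.sqrt (g / 2)), (1 / (4 * B)).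
have g2 : 0 < g / 2 by lra.
have B4 : 0 < 1 / (4 * B) by rewrite divr_gt0// mulr_gt0.
rewrite sqrtr_gt0; split => //.
move=> k k0; have k1 : 1 <= k%:R :> R by rewrite ler1n.
apply: le_trans (_ : pr k (fun x => g * k%:R / 2 <= M x ^+ 2) <= _).
  apply: paley_zygmund => //; first by rewrite mulr_gt0//; lra.
    exact: EM2_ge.
  have -> : B * (g * k%:R) ^+ 2 = 4 * k%:R ^+ 2.
    by rewrite /B; field; rewrite gt_eqF.
  apply: le_trans (EM4_le hp0 hp k) _.
  have : k%:R <= k%:R ^+ 2 :> R by rewrite expr2 ler_peMr//; lra.
  by lra.
apply: (pr_le hp0 hp) => x _ h.
rewrite -sqrtrM ?(ltW g2)// -[leRHS]sqrtr_sqr.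
have -> : g / 2 * k%:R = g * k%:R / 2 by ring.
rewrite ler_wsqrtr// real_normK//; exact: num_real.
Qed.

End anticoncentration.

Lemma split_nat A k1 k2 t : (2 < A)%N -> ((2 * A + k1 + 2 * k2).+2 <= t)%N ->
  let t1 := (t %/ A)%N in let t2 := (t - t1)%N in
  [/\ (0 < t)%N, (t1 * A <= t)%N, (t <= t1 * (2 * A))%N & (0 < t1)%N] /\
  [/\ (t <= 2 * t2)%N, (0 < t2)%N, (k1 <= t)%N & (k2 <= t2)%N].
Proof.
move=> A2 tt t1 t2.
have t1A : (t1 * A <= t)%N by rewrite leq_divM.
have t1_gt0 : (0 < t1)%N by rewrite divn_gt0; lia.
have h := divn_eq t A; have h' := ltn_pmod t (ltnW (ltnW A2)).
rewrite -/t1 in h; rewrite /t2; move: t1 t1A t1_gt0 h {t2} => t1 t1A t1_gt0 h.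
by split; split; nia.
Qed.

(** * Entering each quadrant with probability bounded below *)

Section quadrant.
Context {R : realType} (p : R) (hp0 : 0 < p) (hp : p < 1 / 2).


Local Notation Ex := (word_ex p).
Local Notation pr := (pr p).
Local Notation S := (@netS R).
Local Notation M := (@discM R).

Lemma pr_and k (P Q : word -> bool) :
  pr k P <= pr k (fun x => P x && Q x) + pr k (fun x => ~~ Q x).
Proof.
rewrite -ExD; apply: (Ex_le hp0 hp) => x _.
by case: (P x); case: (Q x) => /=; rewrite ?addr0 ?add0r.
Qed.

Lemma pr_flip k (P : word -> bool) :
  pr k (fun x => P (map flip x)) = pr k P.
Proof. exact: (Ex_flip p k (fun x => (P x)%:R)). Qed.

(* [b1] and [b2] are the signs of the net number of burgers and of the
   discrepancy. *)
Definition quad (c K phi w : R) (b1 b2 : bool) (x : word) : bool :=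
  [&& c * w <= (-1) ^+ b1 * S x <= K * w, c * w <= (-1) ^+ b2 * M x <= K * w,
      (oF x)%:R <= phi * w & (no x)%:R <= K * w].

Lemma sum_big (m a b : R) : m <= `|a| -> (m <= `|a + b|) || (m <= `|- a + b|).
Proof.
move=> ma; apply/orP; case: (leP 0 (a * b)) => ab; [left|right].
  have : `|a| <= `|a + b|; last by lra.
  rewrite -(ler_pXn2r (n := 2))// ?nnegrE// !real_normK ?num_real//.
  by have := sqr_ge0 b; nra.
have : `|a| <= `|- a + b|; last by lra.
rewrite -(ler_pXn2r (n := 2))// ?nnegrE// !real_normK ?num_real//.
by have := sqr_ge0 b; nra.
Qed.

(** The second piece may cancel the discrepancy of the first. Flipping the first piece preserves its
    law and [E1], and by [sum_big] one of the two versions is not cancelled. *)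
Lemma flip_half t1 t2 (m : R) (E1 E2 : word -> bool) :
  (forall u, E1 (map flip u) = E1 u) -> (forall u, E1 u -> m <= `|M u|) ->
  1 / 2 * (pr t1 E1 * pr t2 E2) <= Ex t1 (fun u => Ex t2 (fun v =>
    [&& E1 u, E2 v & m <= `|M u + M v|]%:R)).
Proof.
move=> E1f E1m.
pose H u := Ex t2 (fun v => (E2 v && (m <= `|M u + M v|))%:R).
have -> : Ex t1 (fun u => Ex t2 (fun v =>
    [&& E1 u, E2 v & m <= `|M u + M v|]%:R)) =
    Ex t1 (fun u => (E1 u)%:R * H u).
  apply: Ex_ext => u _; rewrite -ExZ; apply: Ex_ext => v _.
  by case: (E1 u); rewrite ?mul1r ?mul0r.
have -> : Ex t1 (fun u => (E1 u)%:R * H u) = 1 / 2 *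
    Ex t1 (fun u => (E1 u)%:R * (H u + H (map flip u))).
  have := Ex_flip p t1 (fun u => (E1 u)%:R * H u).
  have -> : Ex t1 (fun u => (E1 u)%:R * (H u + H (map flip u))) =
      Ex t1 (fun u => (E1 u)%:R * H u) +
      Ex t1 (fun u => (E1 (map flip u))%:R * H (map flip u)).
    by rewrite -ExD; apply: Ex_ext => u _; rewrite E1f; ring.
  by move=> ->; field.
apply: ler_wpM2l => //; rewrite -ExZr; apply: (Ex_le hp0 hp) => u _.
case: (boolP (E1 u)) => [eu|_]; last by rewrite !mul0r.
rewrite !mul1r /H -ExD; apply: (Ex_le hp0 hp) => v _.
rewrite M_flip; have := sum_big (M v) (E1m u eu).
case: (E2 v) => /=; last by rewrite addr0.
by case: (m <= _); case: (m <= _) => //= _; rewrite ?addr0 ?add0r// lerDl.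
Qed.

Lemma quad_flip (c K phi w : R) b1 b2 x : quad c K phi w b1 (~~ b2) (map flip x) =
  quad c K phi w b1 b2 x.
Proof.
rewrite /quad S_flip M_flip no_flip; have [_ _ _ _ ->] := stats_flip x.
by rewrite signrN mulrNN.
Qed.

(** A short piece has large discrepancy and controlled net count, a long piece then imposes the sign
    of the net count. Flipping the whole word exchanges the two signs of the discrepancy, which are
    thus equally likely. *)
Lemma quadrant : exists c K c' : R, [/\ 0 < c, c < K, 0 < c' &
  forall phi : R, 0 < phi -> exists t0, forall t, (t0 <= t)%N ->
  forall b1 b2, c' <= pr t (quad c K phi (Num.sqrt t%:R) b1 b2)].
Proof.
have [c1 [c0 [c1_gt0 c0_gt0 HM]]] := M_big hp0 hp.
have [c2 [c3 [c2_gt0 c3_gt0 HS]]] := S_pos hp0 hp.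
pose K1 := Num.sqrt (2 / c0).
have K1_gt0 : 0 < K1 by rewrite sqrtr_gt0 divr_gt0.
have K12 : K1 ^- 2 = c0 / 2.
  rewrite sqr_sqrtr; last by apply: divr_ge0 => //; exact: ltW.
  by field; rewrite gt_eqF.
(* [A] makes the first piece so short that the bound on its net count is at most half of the net
   count of the second piece. *)
have [A hA] := ex_nat_gt (2 + 8 * K1 ^+ 2 / c2 ^+ 2).
have c22 : 0 < c2 ^+ 2 by rewrite exprn_gt0.
have A2 : (2 < A)%N.
  rewrite -(ltr_nat R); apply: le_lt_trans hA.
  rewrite lerDl; apply: divr_ge0; last exact: ltW.
  by apply: mulr_ge0 => //; exact: sqr_ge0.
have A0 : 0 < A%:R :> R by rewrite ltr0n (ltn_trans _ A2).
pose r := Num.sqrt (1 / (2 * A%:R)) : R.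
have r0 : 0 < r by rewrite sqrtr_gt0 divr_gt0// mulr_gt0.
pose c := Num.min (K1 * r) (c1 / 2 * r).
have c_gt0 : 0 < c by rewrite lt_min !mulr_gt0//; lra.
pose q := c0 * c3; have q0 : 0 < q by rewrite mulr_gt0.
pose q' := q / 20; have q'0 : 0 < q' by rewrite divr_gt0.
pose K := Num.sqrt (20 / q') + c + 1.
have K_gt0 : 0 < Num.sqrt (20 / q') by rewrite sqrtr_gt0 divr_gt0.
have K0 : 0 < K by rewrite /K; lra.
have K2 : K ^- 2 <= q' / 20.
  have : (Num.sqrt (20 / q')) ^+ 2 <= K ^+ 2.
    by rewrite lerXn2r ?nnegrE ?ltW// /K; lra.
  rewrite sqr_sqrtr; last by apply: divr_ge0 => //; exact: ltW.
  move=> h.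
  rewrite -[leRHS]invrK lef_pV2 ?posrE ?exprn_gt0 ?invr_gt0 ?divr_gt0//.
  by rewrite invf_div.
exists c, K, (q / 32); split => //; first by rewrite /K; lra.
  by rewrite divr_gt0.
move=> phi phi0.
have [k1 H1] := oF_tail hp0 hp (divr_gt0 q0 (ltr0n R 64)) phi0.
have c1r : 0 < c1 / 2 * r by rewrite mulr_gt0// divr_gt0.
have [k2 H2] := oF_tail hp0 hp (divr_gt0 q0 (ltr0n R 64)) c1r.
exists ((2 * A + k1 + 2 * k2).+2)%N => t tt b1 b2.
pose t1 := (t %/ A)%N; pose t2 := (t - t1)%N.
have [[t0 t1A t1B t1_gt0] [t22 t2_gt0 tk1 tk2]] := split_nat A2 tt.
rewrite -/t1 -/t2 in t1A t1B t1_gt0 t22 t2_gt0 tk1 tk2.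
set w := Num.sqrt _; have w0 : 0 < w by rewrite sqrtr_gt0 ltr0n.
have t12 : (t = t1 + t2)%N by rewrite /t2 subnKC// leq_div.
have w1r : r * w <= Num.sqrt t1%:R.
  have -> : r * w = Num.sqrt (1 / (2 * A%:R) * t%:R).
    by rewrite sqrtrM// divr_ge0// mulr_ge0// ltW.
  rewrite ler_wsqrtr// mulrAC mul1r ler_pdivrMr ?mulr_gt0//.
  by rewrite -natrM -natrM ler_nat.
have w2w : Num.sqrt t2%:R <= w by rewrite ler_wsqrtr// ler_nat t12 leq_addl.
have w12 : 2 * K1 * Num.sqrt t1%:R <= c2 * Num.sqrt t2%:R.
  have c20 := ltW c2_gt0; have K10 := ltW K1_gt0.
  rewrite -(ler_pXn2r (n := 2))// ?nnegrE ?mulr_ge0 ?sqrtr_ge0//.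
  rewrite !exprMn (sqr_sqrtr (ler0n _ t1)) (sqr_sqrtr (ler0n _ t2)).
  have hA' : 8 * K1 ^+ 2 <= A%:R * c2 ^+ 2.
    by rewrite -ler_pdivrMr//; lra.
  have a1 : t1%:R * A%:R <= t%:R :> R by rewrite -natrM ler_nat.
  have a2 : t%:R <= 2 * t2%:R :> R by rewrite -natrM ler_nat.
  have a3 : 8 * K1 ^+ 2 * t1%:R <= A%:R * c2 ^+ 2 * t1%:R.
    by apply: ler_wpM2r.
  have a4 : c2 ^+ 2 * (t1%:R * A%:R) <= c2 ^+ 2 * (2 * t2%:R).
    by rewrite ler_pM2l//; lra.
  by lra.
pose m := c1 * Num.sqrt t1%:R.
pose E1 u := (m <= `|M u|) && (`|S u| <= K1 * Num.sqrt t1%:R).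
pose E2 v := (c2 * Num.sqrt t2%:R <= (-1) ^+ b1 * S v).
have hE1 : c0 / 2 <= pr t1 E1.
  have h1 := HM t1 t1_gt0.
  have := pr_and t1 (fun u => m <= `|M u|) (fun u => `|S u| <= K1 * Num.sqrt t1%:R).
  have -> : pr t1 (fun x => ~~ (`|S x| <= K1 * Num.sqrt t1%:R)) =
      pr t1 (fun x => K1 * Num.sqrt t1%:R < `|S x|).
    by apply: Ex_ext => x _; rewrite ltNge.
  have := S_tail hp0 hp t1 K1_gt0; rewrite K12 -/E1 -/m.
  by rewrite /m in h1 *; lra.
have hE2 : c3 <= pr t2 E2 by exact: HS.
have hF := @flip_half t1 t2 m E1 E2 _ _.
have {}hF : 1 / 2 * (pr t1 E1 * pr t2 E2) <= Ex t1 (fun u => Ex t2 (fun v =>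
    [&& E1 u, E2 v & m <= `|M u + M v|]%:R)).
  apply: hF => [u|u /andP[]//].
  by rewrite /E1 M_flip S_flip normrN.
have hq : q / 4 <= 1 / 2 * (pr t1 E1 * pr t2 E2).
  have : c0 / 2 * c3 <= pr t1 E1 * pr t2 E2.
    by apply: ler_pM => //; lra.
  by rewrite /q; lra.
pose G x := (c * w <= (-1) ^+ b1 * S x) && (c * w <= `|M x|).
have hG : q / 4 <= pr t G + q / 64.
  apply: le_trans hq _; apply: le_trans hF _.
  apply: le_trans (_ : Ex t1 (fun u => Ex t2 (fun v => (G (u ++ v))%:R +
      (c1 / 2 * r * Num.sqrt t2%:R < (oF v)%:R)%R%:R)) <= _).
    apply: (Ex_le hp0 hp) => u _; apply: (Ex_le hp0 hp) => v _.
    case: (ltP _ (oF v)%:R) => hoF; first by case: [&& _, _ & _] => /=; rewrite ?lerDr ?addr_ge0.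
    rewrite addr0 ler_nat; case: and3P => //= -[/andP[h1 h1'] h2 h3].
    have h4 : c1 / 2 * r * Num.sqrt t2%:R <= m / 2.
      have : c1 / 2 * (r * Num.sqrt t2%:R) <= c1 / 2 * Num.sqrt t1%:R.
        apply: ler_wpM2l; first by lra.
        by apply: le_trans w1r; rewrite ler_pM2l.
      by rewrite /m; lra.
    have cw1 : c * w <= K1 * Num.sqrt t1%:R.
      apply: le_trans (_ : K1 * (r * w) <= _); last by rewrite ler_pM2l.
      by rewrite mulrA ler_pM2r// ge_min lexx.
    have cw2 : c * w <= m / 2.
      apply: le_trans (_ : c1 / 2 * (r * w) <= _).
        by rewrite mulrA ler_pM2r// ge_min lexx orbT.
      have : c1 / 2 * (r * w) <= c1 / 2 * Num.sqrt t1%:R.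
        by apply: ler_wpM2l => //; lra.
      by rewrite /m; lra.
    rewrite lt0b /G S_cat; apply/andP; split.
      move: h1' h2; rewrite /E2 ler_norml => /andP[h1'1 h1'2] h2.
      by move: h2; case: (b1) => /=; rewrite ?expr0 ?expr1 ?mul1r ?mulN1r => h2; lra.
    have := @M_cat R u v; set d := M (u ++ v) - M u - M v => hd.
    have e : M u + M v = M (u ++ v) - d by rewrite /d; ring.
    have : `|M u + M v| <= `|M (u ++ v)| + `|d| by rewrite e; exact: ler_normB.
    by lra.
  rewrite t12 /pr Ex_cat -/(pr _ _).
  have -> : Ex t1 (fun u => Ex t2 (fun v => (G (u ++ v))%:R +
      (c1 / 2 * r * Num.sqrt t2%:R < (oF v)%:R)%R%:R)) =
      Ex t1 (fun u => Ex t2 (fun v => (G (u ++ v))%:R)) +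
      pr t2 (fun v => c1 / 2 * r * Num.sqrt t2%:R < (oF v)%:R).
    rewrite -[X in _ + X](Ex_cst p t1) -ExD; apply: Ex_ext => u _.
    by rewrite ExD.
  by rewrite lerD2l; exact: H2.
have hS := S_tail hp0 hp t K0; have hM := M_tail hp0 hp t K0.
have hO := no_tail hp0 hp t (mulr_gt0 K0 w0).
have hFt := H1 t; rewrite -/w in hS hM hFt.
have {}hFt : pr t (fun x => phi * w < (oF x)%:R) <= q / 64 by exact: hFt.
have {}hO : pr t (fun x => K * w <= (no x)%:R) <= q' / 2.
  apply: le_trans hO _; rewrite exprMn sqr_sqrtr//.
  have t0R : t%:R != 0 :> R by rewrite pnatr_eq0 -lt0n.
  have -> : 10 * t%:R / (K ^+ 2 * t%:R) = 10 * K ^- 2 by field; rewrite t0R gt_eqF.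
  by lra.
have : pr t G <= pr t (fun x => quad c K phi w b1 false x ||
    (quad c K phi w b1 true x || ((K * w < `|S x|) || ((K * w < `|M x|) ||
    ((phi * w < (oF x)%:R) || (K * w <= (no x)%:R)))))).
  apply: (pr_le hp0 hp) => x _.
  rewrite /G /quad expr0 expr1 mul1r mulN1r.
  case: (ltP (K * w) `|S x|) => hs; rewrite ?orbT//=.
  case: (ltP (K * w) `|M x|) => hm; rewrite ?orbT//=.
  case: (ltP (phi * w) (oF x)%:R) => hf; rewrite ?orbT//=.
  case: (leP (K * w) (no x)%:R) => hn; rewrite ?orbT//= orbF (ltW hn) !andbT.
  move=> /andP[-> cM].
  have -> /= : (-1) ^+ b1 * S x <= K * w.
    by apply: le_trans (ler_norm _) _; rewrite normrM normr_sign mul1r.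
  move: hm; rewrite ler_norml => /andP[hm1 hm2].
  have [M0|M0] := leP 0 (M x).
    by rewrite ger0_norm// in cM; rewrite cM hm2.
  rewrite ltr0_norm// in cM; rewrite cM [- M x <= _](_ : _ = true) ?orbT//.
  by lra.
move=> /le_trans/(_ (prU hp0 hp _ _ _)) h1.
have h2 := prU hp0 hp t (quad c K phi w b1 true) (fun x => (K * w < `|S x|) ||
    ((K * w < `|M x|) || ((phi * w < (oF x)%:R) || (K * w <= (no x)%:R)))).
have h3 := prU hp0 hp t (fun x => K * w < `|S x|)
    (fun x => (K * w < `|M x|) || ((phi * w < (oF x)%:R) || (K * w <= (no x)%:R))).
have h4 := prU hp0 hp t (fun x => K * w < `|M x|)
    (fun x => (phi * w < (oF x)%:R) || (K * w <= (no x)%:R)).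
have h5 := prU hp0 hp t (fun x => phi * w < (oF x)%:R) (fun x => K * w <= (no x)%:R).
have hfl b : pr t (quad c K phi w b1 b) = pr t (quad c K phi w b1 (~~ b)).
  rewrite -[RHS]pr_flip; apply: Ex_ext => x _.
  by rewrite quad_flip.
have eq' : q = 20 * q' by rewrite /q' mulrCA mulfV ?mulr1.
have e1 := hfl false; rewrite /= in e1.
have -> : pr t (quad c K phi w b1 b2) = pr t (quad c K phi w b1 true).
  by case: b2.
clear - h1 h2 h3 h4 h5 e1 eq' q'0 hG hS hM hFt hO K2; lra.
Qed.
End quadrant.

(** * Local estimates for the number of burgers *)

Definition nbur (x : word) : nat := count is_burger x.

Lemma nbur_cat u v : nbur (u ++ v) = (nbur u + nbur v)%N.
Proof. exact: count_cat. Qed.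

Lemma bin_incr k i : (i.*2 < k)%N -> ('C(k, i) <= 'C(k, i.+1))%N.
Proof.
move=> ik; have := mul_bin_left k i => h.
rewrite -(@leq_pmul2l i.+1)// h leq_mul2r; apply/orP; right; lia.
Qed.

Lemma bin_mono k i j : (i <= j)%N -> (j.*2 <= k.+1)%N -> ('C(k, i) <= 'C(k, j))%N.
Proof.
elim: j => [|j IH]; first by rewrite leqn0 => /eqP ->.
rewrite leq_eqVlt => /orP[/eqP ->//|]; rewrite ltnS => ij jk.
by apply: leq_trans (IH ij _) (bin_incr _); lia.
Qed.

(* Unimodality: [i] is at least as close to [k / 2] as [j] is. *)
Lemma bin_unimodal k i j : (i <= k)%N -> (j <= k)%N ->
  (`|i.*2%:Z - k%:Z| <= `|j.*2%:Z - k%:Z|)%R -> ('C(k, j) <= 'C(k, i))%N.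
Proof.
wlog ik : i / (i.*2 <= k)%N.
  move=> H ik jk h; case: (leqP i.*2 k) => [h'|h']; first exact: H.
  rewrite -[leqRHS]bin_sub//; apply: H => //; try lia.
move=> _; wlog jk : j / (j.*2 <= k)%N.
  move=> H jk h; case: (leqP j.*2 k) => [h'|h']; first exact: H.
  rewrite -[leqLHS]bin_sub//; apply: H => //; lia.
by move=> _ h; apply: bin_mono; lia.
Qed.

(** The induction step reduces to [(2m + 1)(2m + 3) <= 4 (m + 1)^2]. *)
Lemma bin_central m : ('C(m.*2, m) ^ 2 * m.*2.+1 <= 16 ^ m)%N.
Proof.
elim: m => [//|m IH].
have E : (m.+1 * 'C(m.+1.*2, m.+1) = 2 * m.*2.+1 * 'C(m.*2, m))%N.
  have e1 := mul_bin_diag m.*2.+2 m.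
  have e2 := mul_bin_left m.*2.+1 m.
  have e3 := mul_bin_diag m.*2.+1 m.
  rewrite /= in e1 e2 e3; rewrite doubleS.
  have e4 : (m.*2.+1 - m = m.+1)%N by lia.
  rewrite e4 in e2.
  have e5 : 'C(m.*2.+1, m.+1) = 'C(m.*2.+1, m).
    by apply/eqP; rewrite -(eqn_pmul2l (ltn0Sn m)) e2.
  have e6 : (m.+1 * 'C(m.*2.+1, m) = m.*2.+1 * 'C(m.*2, m))%N.
    by rewrite -e5 e3.
  by rewrite -e1; nia.
rewrite -(@leq_pmul2l (m.+1 ^ 2)) ?expn_gt0// mulnA -expnMn E [(16 ^ m.+1)%N]expnS doubleS.
move: IH; rewrite expnMn; move: ('C(_, _) ^ 2)%N (16 ^ m)%N => c d IH.
have h : (c * m.*2.+1 * (4 * (m.*2.+1 * m.*2.+3)) <=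
    d * (4 * (m.*2.+1 * m.*2.+3)))%N by rewrite leq_mul2r IH orbT.
apply: leq_trans (_ : d * (4 * (m.*2.+1 * m.*2.+3)) <= _)%N.
  by apply: leq_trans h; rewrite leq_eqVlt; apply/orP; left; apply/eqP;
    rewrite -!mul2n; nia.
have -> : (m.+1 ^ 2 * (16 * d) = d * (16 * m.+1 ^ 2))%N by lia.
by rewrite leq_mul2l; apply/orP; right; rewrite -!mul2n; nia.
Qed.

Section srw_local.
Context {R : realType} (p : R) (hp0 : 0 < p) (hp : p < 1 / 2).


Local Notation Ex := (word_ex p).
Local Notation pr := (pr p).
Local Notation S := (@netS R).

Lemma Ex_nbur k (f : nat -> R) : Ex k.+1 (fun x => f (nbur x)) =
  1 / 2 * Ex k (fun x => f (nbur x)) + 1 / 2 * Ex k (fun x => f (nbur x).+1).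
Proof. by rewrite /= /letter_ex /=; field. Qed.

Lemma pr_nbur k i : pr k (fun x => nbur x == i) = 'C(k, i)%:R / 2 ^+ k.
Proof.
elim: k i => [|k IH] i.
  by rewrite /pr /= bin0n eq_sym expr0 divr1.
have -> : pr k.+1 (fun x => nbur x == i) = 1 / 2 *
    pr k (fun x => nbur x == i) + 1 / 2 * pr k (fun x => (nbur x).+1 == i).
  exact: (Ex_nbur k (fun n => (n == i)%:R)).
rewrite IH; case: i => [|i].
  rewrite !bin0 (_ : pr k _ = 0); last first.
    by rewrite /pr -[RHS](Ex_cst p k); apply: Ex_ext => x _.
  by rewrite exprS; field; rewrite expf_neq0.
have -> : pr k (fun x => (nbur x).+1 == i.+1) = pr k (fun x => nbur x == i).
  by apply: Ex_ext => x _; rewrite eqSS.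
by rewrite IH binS natrD exprS; field; rewrite expf_neq0.
Qed.

Lemma S_nbur x : S x = 2 * (nbur x)%:R - (size x)%:R.
Proof.
elim: x => [|t x IH]; first by rewrite S_nil /=; ring.
rewrite netS_cons IH /nbur /= natrD -[(size x).+1%:R]natr1.
by case: (is_burger t) => /=; ring.
Qed.

Lemma nbur_up k i : (0 < k)%N -> pr k (fun x => nbur x == i) <= (Num.sqrt k%:R)^-1.
Proof.
have even m j : pr m.*2 (fun x => nbur x == j) <= (Num.sqrt m.*2.+1%:R)^-1.
  rewrite pr_nbur; set w := Num.sqrt _.
  have w0 : 0 < w by rewrite sqrtr_gt0.
  rewrite ler_pdivrMr ?exprn_gt0// mulrC ler_pdivlMr//.
  have := bin_central m; rewrite -(ler_nat R) natrM !natrX => h.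
  apply: le_trans (_ : 'C(m.*2, m)%:R * w <= _).
    rewrite ler_wpM2r ?(ltW w0)// ler_nat.
    case: (leqP j m.*2) => jm; last by rewrite bin_small.
    by apply: bin_unimodal => //; lia.
  rewrite -(ler_pXn2r (n := 2))// ?nnegrE ?mulr_ge0 ?exprn_ge0 ?(ltW w0)//.
  rewrite exprMn sqr_sqrtr// (le_trans h)//.
  have -> : (2 ^+ m.*2) ^+ 2 = 16 ^+ m :> R; last by [].
  by rewrite -exprM -muln2 -mulnA mulnC exprM -natrX.
case: k => // k _; rewrite -(odd_double_half k.+1).
case: (boolP (odd k.+1)) => ok; last first.
  rewrite add0n; apply: le_trans (even _ _) _.
  rewrite lef_pV2 ?posrE ?sqrtr_gt0 ?ltr0n//; last by lia.
  by rewrite ler_wsqrtr// ler_nat.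
rewrite add1n; set m := (k.+1)./2.
have -> : pr m.*2.+1 (fun x => nbur x == i) = 1 / 2 *
    pr m.*2 (fun x => nbur x == i) + 1 / 2 * pr m.*2 (fun x => (nbur x).+1 == i).
  exact: (Ex_nbur _ (fun n => (n == i)%:R)).
have h1 := even m i.
have h2 : pr m.*2 (fun x => (nbur x).+1 == i) <= (Num.sqrt m.*2.+1%:R)^-1.
  apply: le_trans (even m i.-1); apply: (pr_le hp0 hp) => x _ /eqP <- //=.
by lra.
Qed.

Lemma sum_window k n (c : R) : 0 <= c ->
  \sum_(i < k.+1 | (`|i.*2%:Z - k%:Z| <= n%:Z)%R) c <= n.+1%:R * c.
Proof.
move=> c0; rewrite sumr_const -[leLHS]mulr_natl ler_wpM2r// ler_nat.
rewrite cardE -(size_map val) -(size_iota ((k - n).+1./2) n.+1).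
apply: uniq_leq_size.
  by rewrite map_inj_uniq ?enum_uniq//; exact: val_inj.
move=> j /mapP[[i ik]]; rewrite mem_enum => h0 ->; rewrite mem_iota.
have h : (`|i.*2%:Z - k%:Z| <= n%:Z)%R := h0.
have h1 : (k <= i.*2 + n)%N by lia.
have h2 : (i.*2 <= k + n)%N by lia.
have := odd_double_half (k - n).+1.
move: ((k - n).+1./2) (odd (k - n).+1) => a b.
by move=> E; cbn -[leq addn double]; case: b E; lia.
Qed.

(** A fixed mass lies in [c * w <= |S| <= K * w]. It is spread over at most [(K + 2) * w] values,
    all at least as far from the centre as [i] and hence, by unimodality, no more likely than
    [i]. *)
Lemma nbur_low : exists c q : R, [/\ 0 < c, 0 < q & forall k i, (0 < k)%N ->
  `|2 * i%:R - k%:R| <= c * Num.sqrt k%:R ->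
  q / Num.sqrt k%:R <= pr k (fun x => nbur x == i)].
Proof.
have [c [c0 [c_gt0 c0_gt0 HS]]] := S_pos hp0 hp.
pose K := Num.sqrt (2 / c0); have K0 : 0 < K by rewrite sqrtr_gt0 divr_gt0.
have K2 : K ^- 2 = c0 / 2.
  rewrite sqr_sqrtr; last by apply: divr_ge0 => //; exact: ltW.
  by field; rewrite gt_eqF.
have qgt : 0 < c0 / (2 * (K + 2)) by rewrite divr_gt0// mulr_gt0//; lra.
pose c' := Num.min c (1 / 2).
exists c', (c0 / (2 * (K + 2))); split => //.
  by rewrite lt_min c_gt0 divr_gt0.
move=> k i k0; set w := Num.sqrt _ => hi.
have w0 : 0 < w by rewrite sqrtr_gt0 ltr0n.
have w1 : 1 <= w by rewrite -[leLHS]sqrtr1 ler_wsqrtr// ler1n.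
have wk : w ^+ 2 = k%:R by rewrite sqr_sqrtr.
have ik : (i <= k)%N.
  rewrite -(ler_nat R); move: hi; rewrite ler_norml => /andP[_ hi].
  have : c' * w <= 1 / 2 * w by rewrite ler_pM2r// ge_min lexx orbT.
  by nra.
pose n := (Num.truncn (K * w)).+1.
have hn : K * w < n%:R.
  by have /andP[] := truncn_itv (mulr_ge0 (ltW K0) (ltW w0)).
have hn2 : n.+1%:R <= (K + 2) * w.
  have /andP[h _] := truncn_itv (mulr_ge0 (ltW K0) (ltW w0)).
  by rewrite -natr1 /n -natr1; lra.
have : c0 / 2 <= pr k (fun x => (c * w <= `|S x|) && (`|S x| <= K * w)).
  have h1 := HS false k k0.
  have h2 := pr_and hp0 hp k (fun x => c * w <= `|S x|) (fun x => `|S x| <= K * w).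
  have h3 := S_tail hp0 hp k K0; rewrite K2 -/w in h3.
  have e : pr k (fun x => ~~ (`|S x| <= K * w)) = pr k (fun x => K * w < `|S x|).
    by apply: Ex_ext => x _; rewrite ltNge.
  have h4 : pr k (fun x => c * w <= (-1) ^+ false * S x) <= pr k (fun x => c * w <= `|S x|).
    apply: (pr_le hp0 hp) => x _; rewrite expr0 mul1r => h.
    exact: le_trans h (ler_norm _).
  by rewrite -/w in h1; lra.
have intr_nat (j : nat) : `|2 * j%:R - k%:R| = (`|j.*2%:Z - k%:Z|%:~R) :> R.
  by rewrite intr_norm intrB -!pmulrn -mul2n natrM.
pose cond j := (`|j.*2%:Z - k%:Z| <= n%:Z)%R && (`|i.*2%:Z - k%:Z| <= `|j.*2%:Z - k%:Z|)%R.
have hsum : pr k (fun x => (c * w <= `|S x|) && (`|S x| <= K * w)) <=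
    \sum_(j < k.+1) (cond j)%:R * pr k (fun x => nbur x == j).
  apply: le_trans (_ : Ex k (fun x => \sum_(j < k.+1)
      (cond j)%:R * (nbur x == j)%:R) <= _); last first.
    rewrite (Ex_sum p k k.+1 (fun j x => (cond j)%:R * (nbur x == j)%:R)).
    by apply: ler_sum => j _; rewrite ExZ.
  apply: (Ex_le hp0 hp) => x xk.
  case: andP => [[h1 h2]|_]; last by apply: sumr_ge0 => j _; rewrite mulr_ge0.
  have nk : (nbur x < k.+1)%N by rewrite ltnS -xk count_size.
  rewrite (bigD1 (Ordinal nk))//= eqxx mulr1.
  rewrite (_ : cond (nbur x)) /=; last first.
    rewrite S_nbur xk intr_nat in h1 h2.
    apply/andP; split.
      by rewrite -(ler_int R); apply: le_trans h2 (ltW hn).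
    rewrite -(ler_int R) -[leLHS]intr_nat; apply: le_trans hi _.
    by apply: le_trans h1; rewrite ler_pM2r// ge_min lexx.
  by rewrite lerDl; apply: sumr_ge0 => j _; rewrite mulr_ge0.
have hsum2 : \sum_(j < k.+1) (cond j)%:R * pr k (fun x => nbur x == j) <=
    n.+1%:R * pr k (fun x => nbur x == i).
  apply: le_trans (sum_window k n (pr_ge0 hp0 hp _ _)).
  rewrite [leRHS]big_mkcond /=; apply: ler_sum => j _.
  have nn a := pr_ge0 hp0 hp k (fun x => nbur x == a).
  rewrite /cond; case: ifP => hj; last by rewrite mul0r.
  rewrite andTb; case: (boolP (Num.norm _ <= Num.norm _)%R) => hij; last by rewrite mul0r nn.
  rewrite mul1r !pr_nbur ler_wpM2r ?invr_ge0 ?exprn_ge0// ler_nat.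
  by apply: bin_unimodal => //; rewrite -ltnS.
move=> h; rewrite ler_pdivrMr//.
have h5 : n.+1%:R * pr k (fun x => nbur x == i) <= (K + 2) * w * pr k (fun x => nbur x == i).
  by apply: ler_wpM2r => //; exact: pr_ge0.
rewrite ler_pdivrMr; last by rewrite mulr_gt0//; lra.
by lra.
Qed.

End srw_local.

(** * Isoperimetry on the discrete cube *)

Section cube.
Context {R : realType}.
Implicit Types f g : seq bool -> R.

Fixpoint cube_ex (n : nat) f : R :=
  if n is n'.+1 then
    (cube_ex n' (fun e => f (true :: e)) + cube_ex n' (fun e => f (false :: e))) / 2
  else f [::].

Lemma cube_le n f g : (forall e, size e = n -> f e <= g e) ->
  cube_ex n f <= cube_ex n g.
Proof.
elim: n f g => [|n IH] f g fg /=; first exact: fg.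
rewrite ler_pM2r ?invr_gt0//.
by apply: lerD; apply: IH => e en; apply: fg; rewrite /= en.
Qed.

Lemma cube_lin n (a b : R) f g :
  cube_ex n (fun e => a * f e + b * g e) = a * cube_ex n f + b * cube_ex n g.
Proof. by elim: n f g => //= n IH f g; rewrite !IH; field. Qed.

Lemma cube_cst n (c : R) : cube_ex n (fun=> c) = c.
Proof. by elim: n => //= n ->; field. Qed.

Fixpoint grad f (e : seq bool) : R :=
  if e is b :: e' then
    Num.sqrt (((f (true :: e') - f (false :: e')) / 2) ^+ 2 +
      grad (fun e => f (b :: e)) e' ^+ 2)
  else 0.

Lemma grad_ge0 f e : 0 <= grad f e.
Proof. by case: e => //= b e; exact: sqrtr_ge0. Qed.

Lemma minkowski (a b c a' b' c' : R) :
  Num.sqrt ((a + a') ^+ 2 + (b + b') ^+ 2 + (c + c') ^+ 2) <=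
  Num.sqrt (a ^+ 2 + b ^+ 2 + c ^+ 2) + Num.sqrt (a' ^+ 2 + b' ^+ 2 + c' ^+ 2).
Proof.
set x := a ^+ 2 + _ + _; set y := a' ^+ 2 + _ + _.
have x0 : 0 <= x by rewrite !addr_ge0 ?sqr_ge0.
have y0 : 0 <= y by rewrite !addr_ge0 ?sqr_ge0.
have h : a * a' + b * b' + c * c' <= Num.sqrt x * Num.sqrt y.
  rewrite -sqrtrM//; apply: le_trans (ler_norm _) _.
  rewrite -sqrtr_sqr ler_wsqrtr// /x /y.
  have := (sqr_ge0 (a * b' - b * a'), sqr_ge0 (a * c' - c * a'), sqr_ge0 (b * c' - c * b')).
  by move=> -[[h1 h2] h3]; nra.
rewrite -(ler_pXn2r (n := 2))// ?nnegrE ?addr_ge0 ?sqrtr_ge0//.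
have z0 : 0 <= (a + a') ^+ 2 + (b + b') ^+ 2 + (c + c') ^+ 2.
  by rewrite !addr_ge0 ?sqr_ge0.
rewrite (sqr_sqrtr z0) [leRHS]sqrrD (sqr_sqrtr x0) (sqr_sqrtr y0).
have -> : (a + a') ^+ 2 + (b + b') ^+ 2 + (c + c') ^+ 2 =
    x + y + 2 * (a * a' + b * b' + c * c') by rewrite /x /y; ring.
by lra.
Qed.

Lemma minkowski2 (a c a' c' : R) :
  Num.sqrt ((a + a') ^+ 2 + (c + c') ^+ 2) <=
  Num.sqrt (a ^+ 2 + c ^+ 2) + Num.sqrt (a' ^+ 2 + c' ^+ 2).
Proof. by have := minkowski a 0 c a' 0 c'; rewrite !addr0 !expr0n/= !addr0. Qed.

Lemma gradD f g e : grad (fun e => f e + g e) e <= grad f e + grad g e.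
Proof.
elim: e f g => [|b e IH] f g /=; first by rewrite addr0.
apply: le_trans (minkowski2 _ _ _ _); apply: ler_wsqrtr.
have /= h := IH (fun e => f (b :: e)) (fun e => g (b :: e)).
apply: lerD; last by rewrite lerXn2r// nnegrE ?addr_ge0 ?grad_ge0.
by rewrite le_eqVlt; apply/orP; left; apply/eqP; field.
Qed.

Lemma gradZ (c : R) f e : 0 <= c -> grad (fun e => c * f e) e = c * grad f e.
Proof.
move=> c0; elim: e f => [|b e IH] f /=; first by rewrite mulr0.
rewrite IH -[X in X * Num.sqrt _](ger0_norm c0) -sqrtr_sqr -sqrtrM ?sqr_ge0//.
by congr Num.sqrt; field.
Qed.

Local Notation J x := (x * (1 - x)).

(* Bobkov-type functional inequality with the profile [x (1 - x)]: the two-point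
   case is [(J - d^2)^2 + d^2 >= J^2] for [J <= 1/4], and it tensorizes by
   Minkowski's inequality. *)
Lemma cube_isoperimetry n f : (forall e, 0 <= f e <= 1) ->
  J (cube_ex n f) <= cube_ex n (fun e => Num.sqrt (J (f e) ^+ 2 + grad f e ^+ 2)).
Proof.
elim: n f => [|n IH] f f01 /=.
  by rewrite expr0n addr0 sqrtr_sqr ler_norm.
pose f1 e := f (true :: e); pose f0 e := f (false :: e).
pose g e := 1 / 2 * f1 e + 1 / 2 * f0 e.
have g01 e : 0 <= g e <= 1.
  by have := (f01 (true :: e), f01 (false :: e)); rewrite /g /f1 /f0 => -[] /andP[? ?] /andP[? ?]; lra.
have -> : (cube_ex n f1 + cube_ex n f0) / 2 = cube_ex n g by rewrite cube_lin; field.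
apply: le_trans (IH g g01) _.
set h1 := fun e => Num.sqrt _; set h2 := (X in (_ + cube_ex n X) / 2).
set h3 := (X in (cube_ex n X + _) / 2).
have -> : (cube_ex n h3 + cube_ex n h2) / 2 = cube_ex n (fun e => 1 / 2 * h3 e + 1 / 2 * h2 e).
  by rewrite cube_lin; field.
apply: cube_le => e _; rewrite /h1 /h2 /h3 /= -/(f1 e) -/(f0 e).
set d := (f1 e - f0 e) / 2.
have gd : grad g e <= 1 / 2 * grad f1 e + 1 / 2 * grad f0 e.
  by apply: le_trans (gradD _ _ _) _; rewrite !gradZ.
have G0 : 0 <= grad g e := grad_ge0 _ _.
have V1 : 0 <= grad f1 e := grad_ge0 _ _.
have V0 : 0 <= grad f0 e := grad_ge0 _ _.
rewrite !sqr_sqrtr ?addr_ge0 ?sqr_ge0//.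
apply: le_trans (_ : Num.sqrt ((J (f1 e) / 2 + J (f0 e) / 2) ^+ 2 +
   (d / 2 + d / 2) ^+ 2 + (grad f1 e / 2 + grad f0 e / 2) ^+ 2) <= _).
  apply: ler_wsqrtr.
  have -> : J (f1 e) / 2 + J (f0 e) / 2 = J (g e) - d ^+ 2 by rewrite /g /d; field.
  have J4 : J (g e) <= 1 / 4 by have := sqr_ge0 (g e - 1 / 2); nra.
  have hV : grad g e ^+ 2 <= (grad f1 e / 2 + grad f0 e / 2) ^+ 2.
    have e2 : grad f1 e / 2 + grad f0 e / 2 = 1 / 2 * grad f1 e + 1 / 2 * grad f0 e by ring.
    by rewrite e2 lerXn2r ?nnegrE//; apply: le_trans G0 gd.
  have : J (g e) ^+ 2 <= (J (g e) - d ^+ 2) ^+ 2 + d ^+ 2.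
    have -> : (J (g e) - d ^+ 2) ^+ 2 + d ^+ 2 = J (g e) ^+ 2 + d ^+ 2 * (1 - 2 * J (g e) + d ^+ 2) by ring.
    by rewrite lerDl mulr_ge0 ?sqr_ge0//; have := sqr_ge0 d; lra.
  by rewrite -splitr; lra.
apply: le_trans (minkowski _ _ _ _ _ _) _.
have half (a b c : R) : Num.sqrt ((a / 2) ^+ 2 + (b / 2) ^+ 2 + (c / 2) ^+ 2) =
    1 / 2 * Num.sqrt (a ^+ 2 + (b ^+ 2 + c ^+ 2)).
  have hs : Num.sqrt ((1 / 2) ^+ 2) = 1 / 2 :> R by rewrite sqrtr_sqr ger0_norm.
  rewrite -hs -sqrtrM ?sqr_ge0//.
  by congr Num.sqrt; field.
by rewrite !half lerD.
Qed.

Fixpoint bdry (A : seq bool -> bool) (e : seq bool) : bool :=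
  if e is b :: e' then
    (A (true :: e') != A (false :: e')) || bdry (fun e => A (b :: e)) e'
  else false.

Lemma bdryP A e : bdry A e ->
  exists u b v, e = u ++ b :: v /\ A (u ++ b :: v) != A (u ++ ~~ b :: v).
Proof.
elim: e A => //= b e IH A /orP[h|/IH[u [b' [v [-> h]]]]]; last by exists (b :: u), b', v.
by exists [::], b, e; split => //=; case: b => //; rewrite eq_sym.
Qed.

Lemma grad_bdry (A : seq bool -> bool) e :
  grad (fun e => (A e)%:R) e ^+ 2 <= (bdry A e)%:R * ((size e)%:R / 4).
Proof.
elim: e A => [|b e IH] A; first by rewrite /= expr0n mul0r.
cbn [grad bdry size]; rewrite sqr_sqrtr ?addr_ge0 ?sqr_ge0//.
have := IH (fun e => A (b :: e)); move: (grad _ _) => x; rewrite -[(size e).+1%:R]natr1.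
have := ler0n R (size e); move: (size e)%:R => s s0.
case: (bdry _ e); case: (A _); case: (A _) => /=; rewrite ?mul0r ?mul1r; lra.
Qed.

(** For an indicator the profile vanishes pointwise, and the gradient is at most half of sqrt n on
    the boundary and 0 elsewhere. *)
Lemma cube_boundary n (A : seq bool -> bool) :
  J (cube_ex n (fun e => (A e)%:R)) <=
  Num.sqrt n%:R / 2 * cube_ex n (fun e => (bdry A e)%:R).
Proof.
apply: le_trans (@cube_isoperimetry n (fun e => (A e)%:R) _) _.
  by move=> e; rewrite ler0n lern1 leq_b1.
have -> : Num.sqrt n%:R / 2 * cube_ex n (fun e => (bdry A e)%:R) =
    cube_ex n (fun e => Num.sqrt n%:R / 2 * (bdry A e)%:R + 0 * 0).
  by rewrite (@cube_lin n (Num.sqrt n%:R / 2) 0 _ (fun=> 0)) mul0r addr0.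
apply: cube_le => e en; have := grad_bdry A e; rewrite en.
have -> : (A e)%:R * (1 - (A e)%:R) = 0 :> R by case: (A e); rewrite /= ?subrr ?mulr0 ?mul0r.
rewrite expr0n add0r mul0r addr0 sqrtr_sqr ger0_norm ?grad_ge0// => h.
rewrite -(ler_pXn2r (n := 2))// ?nnegrE ?grad_ge0 ?mulr_ge0 ?sqrtr_ge0//.
apply: le_trans h _; rewrite !exprMn sqr_sqrtr//.
by case: (bdry A e) => /=; rewrite ?mul0r ?mul1r; lra.
Qed.

End cube.

(* A letter is a kind (burger, order, flexible order) together with a fair coin. *)
Definition mk_letter (k : option bool) (b : bool) : theta :=
  match k with
  | Some true => if b then BH else BC
  | Some false => if b then OC else OH
  | None => OF
  end.

Definition mk_word (ks : seq (option bool)) (e : seq bool) : word :=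
  [seq mk_letter kb.1 kb.2 | kb <- zip ks e].

Lemma nbur_mk ks e : size ks = size e ->
  nbur (mk_word ks e) = count (pred1 (Some true)) ks.
Proof.
rewrite /nbur /mk_word; elim: ks e => [|k ks IH] [|b e] //= [/IH ->].
by case: k => [[]|]; case: b.
Qed.

Lemma size_mk ks e : size ks = size e -> size (mk_word ks e) = size e.
Proof. by move=> h; rewrite size_map size_zip h minnn. Qed.

Lemma mk_word_cat ks1 ks2 e1 e2 : size ks1 = size e1 ->
  mk_word (ks1 ++ ks2) (e1 ++ e2) = mk_word ks1 e1 ++ mk_word ks2 e2.
Proof. by move=> h; rewrite /mk_word zip_cat// map_cat. Qed.

Lemma mk_word_neg ks e : size ks = size e ->
  mk_word ks (map negb e) = map flip (mk_word ks e).
Proof.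
rewrite /mk_word; elim: ks e => [|k ks IH] [|b e] //= [/IH ->].
by congr (_ :: _); case: k => [[]|]; case: b.
Qed.

Lemma mk_word_flip1 ks u b v : size ks = size (u ++ b :: v) ->
  exists x t y, mk_word ks (u ++ b :: v) = x ++ t :: y /\
    (mk_word ks (u ++ ~~ b :: v) = x ++ flip t :: y).
Proof.
move=> h; rewrite -(cat_take_drop (size u) ks).
have h1 : size (take (size u) ks) = size u.
  by rewrite size_takel// h size_cat leq_addr.
rewrite !mk_word_cat//; have : size (drop (size u) ks) = (size v).+1.
  by rewrite size_drop h size_cat /=; lia.
case: (drop _ ks) => [//|k ks2] _.
exists (mk_word (take (size u) ks) u), (mk_letter k b), (mk_word ks2 v); split => //=.
by congr (_ ++ _ :: _); clear h; case: k => [[]|]; case: b.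
Qed.

Lemma cube_neg_prefix (R : realType) n1 n2 (f : seq bool -> R) :
  cube_ex (n1 + n2) (fun e => f (map negb (take n1 e) ++ drop n1 e)) =
  cube_ex (n1 + n2) f.
Proof.
elim: n1 f => [|n1 IH] f /=.
  by congr cube_ex; apply/funext => e; rewrite take0 drop0.
by rewrite (IH (fun e => f (false :: e))) (IH (fun e => f (true :: e))) [X in X / 2]addrC.
Qed.

Section kinds.
Context {R : realType} (p : R) (hp0 : 0 < p) (hp : p < 1 / 2).
Local Ltac plra := move: hp0 hp => ? ?; lra.

Fixpoint kind_ex (n : nat) (F : seq (option bool) -> R) : R :=
  if n is n'.+1 then
    1 / 2 * kind_ex n' (fun ks => F (Some true :: ks)) +
    (1 - p) / 2 * kind_ex n' (fun ks => F (Some false :: ks)) +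
    p / 2 * kind_ex n' (fun ks => F (None :: ks))
  else F [::].

Lemma kind_ext n F G : (forall ks, size ks = n -> F ks = G ks) ->
  kind_ex n F = kind_ex n G.
Proof.
elim: n F G => [|n IH] F G FG /=; first exact: FG.
by congr (_ * _ + _ * _ + _ * _); apply: IH => e en; apply: FG; rewrite /= en.
Qed.

Lemma kind_le n F G : (forall ks, size ks = n -> F ks <= G ks) ->
  kind_ex n F <= kind_ex n G.
Proof.
elim: n F G => [|n IH] F G FG /=; first exact: FG.
by apply: lerD; first apply: lerD; apply: ler_wpM2l; rewrite ?IH//; try (plra);
  move=> e en; apply: FG; rewrite /= en.
Qed.

Lemma kind_lin n (a b : R) F G :
  kind_ex n (fun e => a * F e + b * G e) = a * kind_ex n F + b * kind_ex n G.
Proof. by elim: n F G => //= n IH F G; rewrite !IH; ring. Qed.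

Lemma word_ex_kind n (F : word -> R) : word_ex p n F =
  kind_ex n (fun ks => cube_ex n (fun e => F (mk_word ks e))).
Proof.
elim: n F => //= n IH F; rewrite /letter_ex !IH.
have half G H : kind_ex n (fun ks => (G ks + H ks) / 2) = (kind_ex n G + kind_ex n H) / 2.
  rewrite -[LHS](_ : kind_ex n (fun ks => 1 / 2 * G ks + 1 / 2 * H ks) = _).
    by rewrite kind_lin; field.
  by apply: kind_ext => ks _; field.
by rewrite !half /mk_word /=; field.
Qed.

End kinds.

(** * Hitting a given discrepancy *)

(* The saturated dynamics: an order that cannot be served consumes the deepest
   burger instead, so that changing one letter changes one burger at most. *)
Fixpoint satv (o : theta) (s : word) : word :=
  if s is b :: s' then if suitable o b || nilp s' then s' else b :: satv o s'
  else [::].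

Definition sat (t : theta) (s : word) : word :=
  if is_burger t then t :: s else satv t s.

Fixpoint sact (s x : word) : word := if x is t :: x' then sact (sat t s) x' else s.

Fixpoint msat (c : word -> nat) (s x : word) : nat :=
  if x is t :: x' then minn (c s) (msat c (sat t s) x') else c s.

(** After the first difference the stacks must coincide, so at most one burger differs, in its kind
    only. *)
Fixpoint near (s t : word) : bool :=
  match s, t with
  | a :: s', b :: t' => if a == b then near s' t' else s' == t'
  | [::], [::] => true
  | _, _ => false
  end.

Lemma near_refl s : near s s.
Proof. by elim: s => //= a s ->; rewrite eqxx. Qed.

Lemma near_sym s t : near s t = near t s.
Proof.
elim: s t => [|a s IH] [|b t] //=.
by rewrite [b == a]eq_sym IH [t == s]eq_sym.
Qed.

Lemma satv_all o s : all is_burger s -> all is_burger (satv o s).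
Proof. by elim: s => //= b s IH /andP[bb bs]; case: ifP => //= _; rewrite bb IH. Qed.

Lemma sat_all t s : all is_burger s -> all is_burger (sat t s).
Proof. by rewrite /sat => hs; case: ifP => /= [->//|_]; exact: satv_all. Qed.

Lemma sact_all s x : all is_burger s -> all is_burger (sact s x).
Proof. by elim: x s => //= t x IH s hs; apply: IH; exact: sat_all. Qed.

(** Only one kind of burger is unsuitable for a plain order, so the burgers of [r] above its first
    suitable one all equal [b]: adding [b] on top and removing that burger changes a single
    position. If none is suitable, the deepest [b] goes and nothing changes; this is why saturation
    consumes the deepest burger. *)
Lemma near_shift o b r : is_order o -> is_burger b -> ~~ suitable o b ->
  all is_burger r -> ~~ nilp r -> near r (b :: satv o r).
Proof.
move=> oo bb nob; elim: r => [//|a r IH] /= /andP[ba br] _.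
case: (boolP (suitable o a)) => oa.
  by rewrite orTb; case: eqP => [e|_]; [rewrite -e oa in nob|exact: eqxx].
have -> : a = b by case: o oo nob oa {IH} => // _; case: a ba; case: b bb.
rewrite orFb eqxx; case: (boolP (nilp r)) => [/nilP -> //|nr].
exact: IH.
Qed.

Lemma near_satv o s t : is_order o -> all is_burger s -> all is_burger t ->
  near s t -> near (satv o s) (satv o t).
Proof.
move=> oo; elim: s t => [|a s IH] [|b t] //= /andP[ba bs] /andP[bb bt].
case: eqP => [-> nst|ab /eqP ->].
  have -> : nilp s = nilp t by case: (s) (t) nst => [|? ?] [|? ?].
  by case: ifP => //= _; rewrite eqxx IH.
case: (boolP (nilp t)) => [/nilP ->|nt]; first by rewrite !orbT.
rewrite !orbF; case: (boolP (suitable o a)) => oa; case: (boolP (suitable o b)) => ob.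
- exact: near_refl.
- exact: near_shift.
- by rewrite near_sym; exact: near_shift.
- by move/eqP: ab; cbn [near] => /negbTE ->.
Qed.

Lemma near_sat u s t : all is_burger s -> all is_burger t ->
  near s t -> near (sat u s) (sat u t).
Proof.
move=> bs bt nst; rewrite /sat; case: (boolP (is_burger u)) => bu.
  by rewrite /= eqxx.
exact: near_satv.
Qed.

Lemma near_sact s t x : all is_burger s -> all is_burger t ->
  near s t -> near (sact s x) (sact t x).
Proof.
elim: x s t => //= u x IH s t bs bt nst.
by apply: IH; rewrite ?sat_all ?near_sat.
Qed.

Lemma near_flip u s : all is_burger s -> near (sat u s) (sat (flip u) s).
Proof.
move=> bs; rewrite /sat is_burger_flip; case: (boolP (is_burger u)) => bu.
  by rewrite /=; case: ifP => _; rewrite ?near_refl ?eqxx.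
case: s bs => [//|b r] /= /andP[bb br].
case: (boolP (nilp r)) => [/nilP ->|nr]; first by rewrite !orbT.
rewrite !orbF; case: (boolP (suitable u b)) => ub; case: (boolP (suitable (flip u) b)) => fb.
- exact: near_refl.
- by apply: near_shift => //; rewrite /is_order is_burger_flip.
- by rewrite near_sym; apply: near_shift.
- by case: u bu ub fb => //=; case: b bb => //= *; rewrite near_refl.
Qed.

Lemma near_size s t : near s t -> size s = size t.
Proof.
elim: s t => [|a s IH] [|b t] //=.
by case: ifP => _ => [/IH ->//|/eqP ->].
Qed.

Lemma near_count s t : near s t ->
  (cH s <= (cH t).+1)%N /\ (cC s <= (cC t).+1)%N.
Proof.
elim: s t => [|a s IH] [|b t] //=.
have [-> ->] := c_cons a s; have [-> ->] := c_cons b t.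
case: eqP => [-> /IH[h1 h2]|_ /eqP ->]; first by split; lia.
by split; case: a; case: b; lia.
Qed.

Lemma near_msat c s t x :
  (forall s t, all is_burger s -> all is_burger t -> near s t -> (c s <= (c t).+1)%N) ->
  all is_burger s -> all is_burger t -> near s t ->
  (msat c s x <= (msat c t x).+1)%N.
Proof.
move=> hc; elim: x s t => [|u x IH] s t bs bt nst /=; first exact: hc.
have h1 := hc _ _ bs bt nst.
have h2 := IH _ _ (sat_all u bs) (sat_all u bt) (near_sat u bs bt nst).
by move: h1 h2; rewrite /minn; case: ifP; case: ifP; lia.
Qed.

Lemma msat_flip c s x u y :
  (forall s t, all is_burger s -> all is_burger t -> near s t -> (c s <= (c t).+1)%N) ->
  all is_burger s ->
  (msat c s (x ++ u :: y) <= (msat c s (x ++ flip u :: y)).+1)%N.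
Proof.
move=> hc; elim: x s => [|t x IH] s bs /=.
  have := near_msat y hc (sat_all u bs) (sat_all (flip u) bs) (near_flip u bs).
  by rewrite /minn; case: ifP; case: ifP; lia.
have := IH _ (sat_all t bs).
by rewrite /minn; case: ifP; case: ifP; lia.
Qed.

Lemma sact_cat s x y : sact s (x ++ y) = sact (sact s x) y.
Proof. by elim: x s => //= t x IH s. Qed.

Lemma sact_flip s x u y : all is_burger s ->
  near (sact s (x ++ u :: y)) (sact s (x ++ flip u :: y)).
Proof.
move=> bs; rewrite !sact_cat /=; apply: near_sact; try exact: sat_all (sact_all _ bs).
exact: near_flip (sact_all _ bs).
Qed.

Lemma serve_satv o s s' : serve o s = Some s' -> satv o s = s'.
Proof.
elim: s s' => //= b s IH s'; case: ifP => [_ [->]//|_].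
by case: s IH => //= a s IH; case E: (if _ then _ else _) => [r|] //= [<-]; rewrite (IH _ E).
Qed.

Lemma act_cons s t x : is_burger t -> act s (t :: x) = act (t :: s) x.
Proof. by move=> bt; rewrite /act /= /reduce_step bt. Qed.

Lemma act_cons_ord s s' t x : is_order t -> serve t s = Some s' ->
  act s (t :: x) = act s' x.
Proof. by move=> ot ts; rewrite /act /= reduce_step_ord// ts. Qed.

Lemma alive_sact s x : alive s x -> (act s x).2 = sact s x.
Proof.
elim: x s => //= t x IH s; rewrite /alive /sat.
case: (boolP (is_burger t)) => bt; first by rewrite act_cons//; exact: IH.
case E: (serve t s) => [s'|]; first by rewrite (act_cons_ord _ bt E) (serve_satv E); exact: IH.
move=> /eqP; rewrite -cat1s act_cat /= {1}/act /= reduce_step_ord// E /=.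
by case: (act _ x).
Qed.

(** While both kinds are present every order is fulfilled, and the saturated dynamics is the true
    one. *)
Lemma msat_alive s x : all is_burger s ->
  (0 < msat cH s x)%N -> (0 < msat cC s x)%N -> alive s x.
Proof.
elim: x s => //= t x IH s bs; rewrite !leq_min => /andP[h1 h2] /andP[h3 h4].
have := IH _ (sat_all t bs) h2 h4; rewrite /alive /sat.
case: (boolP (is_burger t)) => bt; first by rewrite act_cons.
suff [s' E] : exists s', serve t s = Some s' by rewrite (act_cons_ord _ bt E) (serve_satv E).
case: t bt {IH h2 h4} => // _.
- case: (serve OH s) (serveH bs) => [s' _|h]; first by exists s'.
  by rewrite h in h1.
- case: (serve OC s) (serveC bs) => [s' _|h]; first by exists s'.
  by rewrite h in h3.
- by rewrite (serveF bs); case: s {bs h3} h1 => [|b s] h; [have := h|exists s].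
Qed.

Lemma msat_prefix c s x : exists y z, x = y ++ z /\ msat c s x = c (sact s y).
Proof.
elim: x s => [|t x IH] s /=; first by exists [::], [::].
have [y [z [e1 e2]]] := IH (sat t s).
rewrite /minn; case: ifP => _; first by exists [::], (t :: x).
by exists (t :: y), z; split; [rewrite e1|exact: e2].
Qed.

(** A prefix leaves at most [no x] orders unfulfilled, so the reserve [L] of each kind is never
    touched. *)
Lemma msat_ge s x L : all is_burger s -> (no x + L <= cH s)%N -> (no x + L <= cC s)%N ->
  (L <= msat cH s x)%N /\ (L <= msat cC s x)%N.
Proof.
move=> bs lH lC.
have main y z : x = y ++ z -> (L <= cH (sact s y))%N /\ (L <= cC (sact s y))%N.
  move=> e; have h := no_catl y z; rewrite -e in h.
  have hy := noE y.
  have ay : alive s y by apply: alive_suff => //; lia.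
  have [eH [eC [e1 e2 e3]]] := alive_act bs ay.
  by rewrite -(alive_sact ay); split; lia.
have [y [z [e ->]]] := msat_prefix cH s x; have [y' [z' [e' ->]]] := msat_prefix cC s x.
by split; [case: (main _ _ e)|case: (main _ _ e')].
Qed.

Definition disc (s : word) : int := (cH s)%:Z - (cC s)%:Z.

(** A flip moves the discrepancy by at most 2 and each minimum by at most 1. If no minimum is near
    [l], the flip crosses [d]; the window contains both sides of the crossing. *)
Lemma pivotal_nat (A A' : bool) (l mh mc mh' mc' : nat) (d D D' : int) :
  A = [&& d <= D, (l <= mh)%N & (l <= mc)%N] ->
  A' = [&& d <= D', (l <= mh')%N & (l <= mc')%N] -> A != A' ->
  (mh <= mh'.+1)%N -> (mh' <= mh.+1)%N -> (mc <= mc'.+1)%N -> (mc' <= mc.+1)%N ->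
  D <= D' + 2 -> D' <= D + 2 ->
  [|| [&& (l.-1 <= mh)%N, (l.-1 <= mc)%N & d - 2 <= D <= d + 1],
      (l.-1 <= mh <= l)%N | (l.-1 <= mc <= l)%N].
Proof. by case: A; case: A' => // *; lia. Qed.

(** * From the isoperimetric inequality to a pinned discrepancy *)

Section pin.
Context {R : realType} (p : R) (hp0 : 0 < p) (hp : p < 1 / 2).
Local Notation pr := (pr p).
Variables (s0 : word) (bs0 : all is_burger s0).

Definition pinned (d : int) (x : word) : bool :=
  alive s0 x && (d - 2 <= disc (act s0 x).2 <= d + 1).

Definition level (d : int) (l : nat) (x : word) : bool :=
  [&& d <= disc (sact s0 x), (l <= msat cH s0 x)%N & (l <= msat cC s0 x)%N].

Definition low (l : nat) (x : word) : bool :=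
  (l.-1 <= msat cH s0 x <= l)%N || (l.-1 <= msat cC s0 x <= l)%N.

Lemma level_bdry d l ks e : (1 < l)%N -> size ks = size e ->
  bdry (fun e => level d l (mk_word ks e)) e ->
  pinned d (mk_word ks e) || low l (mk_word ks e).
Proof.
move=> l1 se /bdryP[u [b [v [ee]]]]; rewrite ee in se *.
have [x [t [y [-> ->]]]] := mk_word_flip1 se => h.
have nH s t' : all is_burger s -> all is_burger t' -> near s t' -> (cH s <= (cH t').+1)%N.
  by move=> _ _ /near_count[].
have nC s t' : all is_burger s -> all is_burger t' -> near s t' -> (cC s <= (cC t').+1)%N.
  by move=> _ _ /near_count[].
have m1 := msat_flip x t y nH bs0; have m2 := msat_flip x (flip t) y nH bs0.
have m3 := msat_flip x t y nC bs0; have m4 := msat_flip x (flip t) y nC bs0.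
rewrite flipK in m2 m4.
have ns := sact_flip x t y bs0; have sz := near_size ns.
have [c1 c2] := near_count ns.
rewrite near_sym in ns; have [c3 c4] := near_count ns.
rewrite !size_burgers ?sact_all// in sz.
have D1 : disc (sact s0 (x ++ t :: y)) <= disc (sact s0 (x ++ flip t :: y)) + 2.
  by rewrite /disc; lia.
have D2 : disc (sact s0 (x ++ flip t :: y)) <= disc (sact s0 (x ++ t :: y)) + 2.
  by rewrite /disc; lia.
have /orP[/and3P[a1 a2 a3]|a] :=
  pivotal_nat (erefl (level d l _)) (erefl (level d l _)) h m1 m2 m3 m4 D1 D2; last first.
  by rewrite /low a orbT.
have a0 : alive s0 (x ++ t :: y) by apply: msat_alive => //; lia.
by rewrite /pinned a0 (alive_sact a0) a3.
Qed.

Lemma sum_window1 n m : \sum_(j < n) ((j.+1 <= m <= j.+2)%N%:R : R) <= 2 * (m <= n.+1)%N%:R.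
Proof.
have e a : \sum_(j < n) ((m == j + a)%N%:R : R) = (a <= m < n + a)%N%:R.
  elim: n => [|n IH]; first by rewrite big_ord0 add0n; case: (boolP (a <= m < a)%N) => //; lia.
  by rewrite big_ord_recr /= IH -natrD; congr (_%:R); lia.
apply: le_trans (_ : \sum_(j < n) ((m == j + 1)%N%:R + (m == j + 2)%N%:R) <= _).
  apply: ler_sum => j _; rewrite -natrD ler_nat; lia.
rewrite big_split /= !e -natrD -natrM ler_nat; lia.
Qed.

(** Each of the two minima meets the condition in [low] for at most two levels, whence the 4. *)
Lemma sum_low n x : \sum_(j < n) ((low j.+2 x)%:R : R) <=
  4 * ((msat cH s0 x <= n.+1)%N || (msat cC s0 x <= n.+1)%N)%:R.
Proof.
apply: le_trans (_ : \sum_(j < n) (((j.+1 <= msat cH s0 x <= j.+2)%N%:R : R) +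
    (j.+1 <= msat cC s0 x <= j.+2)%N%:R) <= _).
  by apply: ler_sum => j _; rewrite -natrD ler_nat /low /=; lia.
rewrite big_split /=; have := lerD (sum_window1 n (msat cH s0 x)) (sum_window1 n (msat cC s0 x)).
move/le_trans; apply; rewrite -!natrM -natrD ler_nat; lia.
Qed.

Variables (n1 n2 : nat) (i : nat) (d : int) (G : word -> word -> bool).
Hypothesis N0 : (0 < n1 + n2)%N.
Let N := (n1 + n2)%N.
Let w : R := Num.sqrt N%:R.
Let GG x := G (take n1 x) (drop n1 x).

Lemma pin_level l : (1 < l)%N ->
  (forall u v, size u = n1 -> size v = n2 -> G u v ->
     level d l (u ++ v) /\ disc (sact s0 (map flip u ++ v)) < d) ->
  pr N (fun x => (nbur x == i) && GG x) / w <=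
  pr N (fun x => (nbur x == i) && pinned d x) +
  pr N (fun x => (nbur x == i) && low l x).
Proof.
move=> l1 HG; have w0 : 0 < w by rewrite sqrtr_gt0 ltr0n.
rewrite -ExD -ExZr !(word_ex_kind p N).
apply: (kind_le hp0 hp) => ks sks.
case: (boolP (count (pred1 (Some true)) ks == i)) => hi; last first.
  rewrite -[leLHS](_ : cube_ex N (fun=> 0 : R) = _).
    apply: cube_le => e se; apply: addr_ge0; exact: ler0n.
  rewrite !cube_cst; apply/esym; rewrite -[RHS](cube_cst N 0).
  apply/eqP; rewrite eq_le; apply/andP; split; apply: cube_le => e se;
    by rewrite nbur_mk ?sks ?se// (negbTE hi) /= mul0r.
apply: le_trans (_ : cube_ex N (fun e => (bdry (fun e => level d l (mk_word ks e)) e)%:R) <= _);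
    last first.
  apply: cube_le => e se; have sz : size ks = size e by rewrite sks se.
  rewrite nbur_mk// hi /= -natrD ler_nat.
  by have := @level_bdry d l ks e l1 sz; case: bdry => // /(_ isT); case: pinned; case: low.
set A := fun e => level d l (mk_word ks e).
pose g : R := cube_ex N (fun e => (GG (mk_word ks e))%:R).
have -> : cube_ex N (fun e => ((nbur (mk_word ks e) == i) && GG (mk_word ks e))%:R / w) = g / w.
  rewrite /g -[RHS](_ : cube_ex N (fun e => w^-1 * (GG (mk_word ks e))%:R + 0 * 0) = _); last first.
    by rewrite (@cube_lin _ N w^-1 0 _ (fun=> 0)) mul0r addr0 mulrC.
  apply/eqP; rewrite eq_le; apply/andP; split; apply: cube_le => e se;
    by rewrite nbur_mk ?sks ?se// hi /= mul0r addr0 mulrC.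
have GGe e : size e = N -> GG (mk_word ks e) -> A e /\ ~~ A (map negb (take n1 e) ++ drop n1 e).
  move=> se ge; pose ks1 := take n1 ks; pose ks2 := drop n1 ks.
  pose e1 := take n1 e; pose e2 := drop n1 e.
  have s1 : size ks1 = n1 by rewrite size_takel// sks leq_addr.
  have s2 : size e1 = n1 by rewrite size_takel// se leq_addr.
  have s3 : size ks2 = n2 by rewrite size_drop sks addKn.
  have s4 : size e2 = n2 by rewrite size_drop se addKn.
  have e12 : mk_word ks e = mk_word ks1 e1 ++ mk_word ks2 e2.
    by rewrite -mk_word_cat ?s1 ?s2// !cat_take_drop.
  have z1 : size (mk_word ks1 e1) = n1 by rewrite size_mk ?s1.
  have z2 : size (mk_word ks2 e2) = n2 by rewrite size_mk ?s3.
  have [h1 h2] : level d l (mk_word ks1 e1 ++ mk_word ks2 e2) /\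
      disc (sact s0 (map flip (mk_word ks1 e1) ++ mk_word ks2 e2)) < d.
    by apply: HG => //; move: ge; rewrite /GG e12 take_size_cat// drop_size_cat.
  split; first by rewrite /A e12.
  rewrite /A -[ks](cat_take_drop n1) mk_word_cat; last by rewrite size_map -/ks1 s1 -/e1 s2.
  by rewrite mk_word_neg ?s1 ?s2// /level leNgt h2.
have h1 : g <= cube_ex N (fun e => (A e)%:R).
  apply: cube_le => e se; have := GGe e se.
  by case: (GG _) => [[]// -> //|_]; exact: ler0n.
have h2 : g <= 1 - cube_ex N (fun e => (A e)%:R).
  rewrite -(cube_neg_prefix n1 n2 (fun e => (A e)%:R)).
  rewrite -[leRHS](_ : cube_ex N (fun e => 1 * 1 + -1 * (A (map negb (take n1 e) ++ drop n1 e))%:R) = _).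
    apply: cube_le => e se; have := GGe e se.
    case: (GG _) => [[]// _ /negbTE -> //|_]; first by rewrite mulr0 addr0 mul1r.
    by case: (A _) => /=; lra.
  by rewrite (@cube_lin _ N 1 (-1) (fun=> 1)) cube_cst; ring.
have h3 := @cube_boundary R N A.
have h0 : 0 <= g by rewrite -[leLHS](cube_cst N 0); apply: cube_le => e _; exact: ler0n.
move: h1 h2 h3; set x := cube_ex N (fun e => (A e)%:R); set y := cube_ex N _.
move=> h1 h2 h3.
rewrite ler_pdivrMr//.
have : g / 2 <= x * (1 - x).
  case: (leP x (1 / 2)) => hx.
    have : 0 <= x * (1 / 2 - x) by apply: mulr_ge0; lra.
    by lra.
  have : 0 <= (1 - x) * (x - 1 / 2) by apply: mulr_ge0; lra.
  by lra.
by rewrite -/w in h3; move: h3; clear; lra.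
Qed.

(** [pin_level] is averaged over the levels [2, ..., L]. With [2 * L] burgers of each kind a word
    can be low only if [L <= no x], and then for at most 4 levels. *)
Lemma pin_avg L : (1 < L)%N ->
  (L.*2 <= cH s0)%N -> (L.*2 <= cC s0)%N ->
  (forall u v, size u = n1 -> size v = n2 -> G u v ->
     level d L (u ++ v) /\ disc (sact s0 (map flip u ++ v)) < d) ->
  pr N (fun x => (nbur x == i) && GG x) / w <=
  pr N (fun x => (nbur x == i) && pinned d x) +
  4 / L.-1%:R * pr N (fun x => (nbur x == i) && (L <= no x)%N).
Proof.
move=> L1 lH lC HG.
pose a := pr N (fun x => (nbur x == i) && GG x) / w.
pose b := pr N (fun x => (nbur x == i) && pinned d x).
have L0 : 0 < L.-1%:R :> R by rewrite ltr0n; lia.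
have h j : (j < L.-1)%N -> a - b <= pr N (fun x => (nbur x == i) && low j.+2 x).
  move=> jL; rewrite lerBlDl; apply: pin_level => // u v su sv /(HG u v su sv)[/and3P[h1 h2 h3] h4].
  by split => //; apply/and3P; split => //; lia.
have : L.-1%:R * (a - b) <= 4 * pr N (fun x => (nbur x == i) && (L <= no x)%N).
  have -> : L.-1%:R * (a - b) = \sum_(j < L.-1) (a - b).
    by rewrite sumr_const card_ord mulr_natl.
  apply: le_trans (ler_sum _ (fun j _ => h _ (ltn_ord j))) _.
  rewrite -(Ex_sum p N L.-1 (fun j x => ((nbur x == i) && low j.+2 x)%:R)) -ExZ.
  apply: (Ex_le hp0 hp) => x _; case: (nbur x == i) => /=; last by rewrite big1 ?mulr0.
  apply: le_trans (sum_low _ _) _; rewrite ler_pM2l// ler_nat.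
  case: (leqP L (no x)) => [_|hL]; first exact: leq_b1.
  have hx (m : nat) : (L.*2 <= m)%N -> (no x + L.+1 <= m)%N by lia.
  have [] := @msat_ge s0 x L.+1 bs0 (hx _ lH) (hx _ lC).
  by rewrite prednK; [lia|exact: ltnW].
rewrite -/a -/b mulrAC -lerBlDl ler_pdivlMr// [_ * L.-1%:R]mulrC.
exact.
Qed.

End pin.

Lemma oF_no x : (oF x <= no x)%N.
Proof. by rewrite noE leq_addl. Qed.

(** * Bad events under a pinned number of burgers *)

Section pin_stage.
Context {R : realType} (p : R) (hp0 : 0 < p) (hp : p < 1 / 2).
Local Notation Ex := (word_ex p).
Local Notation pr := (pr p).
Local Notation S := (@netS R).
Local Notation M := (@discM R).

Definition target (h c : nat) (s x : word) : bool :=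
  [&& alive s x, cH (act s x).2 == h & cC (act s x).2 == c].

Definition Tg n s h c : R := pr n (target h c s).

Lemma target_cat h c s x y : target h c s (x ++ y) =
  alive s x && target h c (act s x).2 y.
Proof. by rewrite /target alive_cat act_cat -!andbA. Qed.

Lemma Tg_cat a b s h c :
  Tg (a + b) s h c = Ex a (fun x => (alive s x)%:R * Tg b (act s x).2 h c).
Proof.
rewrite /Tg /pr Ex_cat; apply: Ex_ext => x _; rewrite -ExZ.
by apply: Ex_ext => y _; rewrite target_cat; case: (alive s x) => /=; rewrite ?mul1r ?mul0r.
Qed.

Lemma alive_disc s x : all is_burger s -> alive s x ->
  `|(disc (act s x).2)%:~R - (disc s)%:~R - M x| <= (oF x)%:R /\
  (size (act s x).2)%:R = (size s)%:R + S x.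
Proof.
move=> bs ax; have [eH [eC [/(@natR_eq R _ _) e1 /(@natR_eq R _ _) e2 /(@natR_eq R _ _) e3]]] := alive_act bs ax.
rewrite !size_burgers ?act_stack_all// /disc !intrB -!pmulrn /discM /netS.
move: e1 e2 e3; rewrite !natrD => e1 e2 e3.
have := (ler0n R eH, ler0n R eC) => -[? ?].
by split; [rewrite ler_norml; apply/andP; split; lra|lra].
Qed.

(** The bad event is charged to one half of the word and the pinned count to the other, independent
    half, which yields the inverse square root. *)
Lemma pinned_split k1 k2 i (Bd b1 b2 : word -> bool) : (0 < k1)%N -> (0 < k2)%N ->
  (forall u v, Bd (u ++ v) -> b1 u || b2 v) ->
  pr (k1 + k2) (fun x => (nbur x == i) && Bd x) <=
  pr k1 b1 / Num.sqrt k2%:R + pr k2 b2 / Num.sqrt k1%:R.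
Proof.
move=> k1_gt0 k2_gt0 hB.
apply: le_trans (_ : Ex k1 (fun u => Ex k2 (fun v =>
   (b1 u)%:R * (nbur v == i - nbur u)%N%:R + (b2 v)%:R * (nbur u == i - nbur v)%N%:R)) <= _).
  rewrite /pr Ex_cat; apply: (Ex_le hp0 hp) => u _; apply: (Ex_le hp0 hp) => v _.
  rewrite -!natrM -natrD ler_nat nbur_cat; have := hB u v.
  case: (Bd _); last by rewrite andbF.
  by move=> /(_ isT); case: (b1 u); case: (b2 v) => //= _; lia.
rewrite (_ : Ex k1 _ = Ex k1 (fun u => Ex k2 (fun v => (b1 u)%:R * (nbur v == i - nbur u)%N%:R)
   + Ex k2 (fun v => (b2 v)%:R * (nbur u == i - nbur v)%N%:R))); last first.
  by apply: Ex_ext => u _; rewrite ExD.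
rewrite ExD [X in _ + X]Ex_swap -!ExZr; apply: lerD; apply: (Ex_le hp0 hp) => u _;
  rewrite ExZ ler_wpM2l//; exact: nbur_up.
Qed.

Lemma pr_split k (P Q : word -> bool) :
  pr k P = pr k (fun x => P x && Q x) + pr k (fun x => P x && ~~ Q x).
Proof.
rewrite -ExD; apply: Ex_ext => x _.
by case: (P x); case: (Q x) => /=; rewrite ?addr0 ?add0r.
Qed.

Lemma MN_tail k (y : R) : 0 < y -> (0 < k)%N ->
  pr k (fun x => y <= `|M x| + 3 * (no x)%:R) <= 20 ^+ 2 * k%:R / y ^+ 2.
Proof.
move=> y0 k0; have k1 : 0 < k%:R :> R by rewrite ltr0n.
apply: le_trans (_ : pr k (fun x => (y / 3 < `|M x|) || (y / 6 <= (no x)%:R)) <= _).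
  apply: (pr_le hp0 hp) => x _ h; rewrite -[_ < _]negbK -leNgt -implybE.
  by apply/implyP => h'; lra.
apply: le_trans (prU hp0 hp _ _ _) _.
have w0 : 0 < Num.sqrt k%:R :> R by rewrite sqrtr_gt0.
have h1 := @M_tail R p hp0 hp k (y / 3 / Num.sqrt k%:R) (divr_gt0 (divr_gt0 y0 (ltr0n R 3)) w0).
have h2 := @no_tail R p hp0 hp k (y / 6) (divr_gt0 y0 (ltr0n R 6)).
rewrite divfK ?gt_eqF// in h1.
have e1 : (y / 3 / Num.sqrt k%:R) ^- 2 = 9 * (k%:R / y ^+ 2).
  rewrite !expr_div_n sqr_sqrtr; last exact: ltW.
  by field; rewrite !gt_eqF.
have e2 : 10 * k%:R / (y / 6) ^+ 2 = 360 * (k%:R / y ^+ 2) by field; rewrite gt_eqF.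
have : 0 <= k%:R / y ^+ 2 by rewrite divr_ge0 ?exprn_ge0// ltW.
move: h1 h2; rewrite e1 e2 -[20 ^+ 2 * _ / _]mulrA; clear; lra.
Qed.

(** From the local lower bound one subtracts the words with large discrepancy or many orders. By
    [pinned_split] these also carry an inverse square root, with a constant made small by [K]. *)
Lemma v_good : exists c q : R, [/\ 0 < c, 0 < q &
  forall B : nat, (0 < B)%N -> exists2 K : R, 0 < K & forall t j, (0 < t)%N ->
  `|2 * j%:R - (B * t + B * t)%N%:R| <= c * Num.sqrt (B * t + B * t)%N%:R ->
  q / Num.sqrt (B * t + B * t)%N%:R <=
  pr (B * t + B * t) (fun v => (nbur v == j) &&
     (`|M v| + 2 * (no v)%:R <= K * Num.sqrt t%:R))].
Proof.
have [c [q [c0 q0 H]]] := nbur_low hp0 hp.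
exists c, (q / 2); rewrite divr_gt0//; split => // B B0.
have B1 : 1 <= B%:R :> R by rewrite ler1n.
pose K := 1 + 8 * 40 ^+ 2 * B%:R / q.
have z0 : 0 <= 8 * 40 ^+ 2 * B%:R / q by rewrite !mulr_ge0// ?invr_ge0 ltW.
have K1 : 1 <= K by rewrite lerDl.
exists K => [|t j t0 hj]; first by rewrite (lt_le_trans _ K1).
have Bt0 : (0 < B * t)%N by rewrite muln_gt0 B0.
have t1 : 0 < t%:R :> R by rewrite ltr0n.
set w := Num.sqrt t%:R; have w0 : 0 < w by rewrite sqrtr_gt0.
have wt : w ^+ 2 = t%:R by rewrite sqr_sqrtr// ltW.
have h1 := H _ j _ hj; rewrite addn_gt0 Bt0 in h1; have {}h1 := h1 isT.
have Kw : 0 < K * w / 2 by rewrite !divr_gt0// mulr_gt0//; lra.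
pose bad v := K * w / 2 <= `|M v| + 3 * (no v)%:R.
have h2 : pr (B * t + B * t) (fun v => (nbur v == j) && ~~ (`|M v| + 2 * (no v)%:R <= K * w))
    <= pr (B * t) bad / Num.sqrt (B * t)%N%:R + pr (B * t) bad / Num.sqrt (B * t)%N%:R.
  apply: pinned_split => // u v; rewrite -ltNge => h.
  rewrite /bad -[_ || _]negbK negb_or -!ltNge; apply/negP => /andP[hu hv].
  have h3 := @M_cat R u v; have := no_cat u v; rewrite -(ler_nat R) natrD => h4.
  have h5 : (oF v)%:R <= (no v)%:R :> R by rewrite ler_nat oF_no.
  have h6 := ler_normD (M u) (M v).
  have h7 : `|M (u ++ v)| <= `|M (u ++ v) - M u - M v| + `|M u + M v|.
    by rewrite -[X in `|X| <= _](_ : M (u ++ v) - M u - M v + (M u + M v) = _) ?ler_normD//; ring.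
  have h8 := ler0n R (no u).
  by move: h h3 h4 h5 h6 h7 h8 hu hv; clear; lra.
have h3 := @MN_tail (B * t) (K * w / 2) Kw Bt0.
have h4 := @pr_split (B * t + B * t) (fun v => nbur v == j)
  (fun v => `|M v| + 2 * (no v)%:R <= K * w).
set s1 := Num.sqrt (B * t)%N%:R in h2; set s2 := Num.sqrt (B * t + B * t)%N%:R in h1 *.
have s10 : 0 < s1 by rewrite sqrtr_gt0 ltr0n.
have s20 : 0 < s2 by rewrite sqrtr_gt0 ltr0n addn_gt0 Bt0.
have s12 : s2 <= 2 * s1.
  rewrite -(ler_pXn2r (n := 2))// ?nnegrE ?mulr_ge0 ?sqrtr_ge0// exprMn.
  rewrite !sqr_sqrtr ?ler0n// natrD; have := ler0n R (B * t); clear; lra.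
have h5 : pr (B * t) bad <= q / 8.
  apply: le_trans h3 _; rewrite !exprMn exprVn wt natrM.
  have -> : 20 ^+ 2 * (B%:R * t%:R) / (K ^+ 2 * t%:R / 2 ^+ 2) = 40 ^+ 2 * B%:R / K ^+ 2 :> R.
    by field; rewrite !gt_eqF// (lt_le_trans _ K1).
  rewrite ler_pdivrMr; last by rewrite exprn_gt0// (lt_le_trans _ K1).
  apply: le_trans (_ : q / 8 * K <= _); last first.
    by rewrite ler_pM2l ?divr_gt0// expr2 ler_peMl//; lra.
  have -> : q / 8 * K = q / 8 + 40 ^+ 2 * B%:R by rewrite /K; field; rewrite gt_eqF.
  by rewrite lerDr divr_ge0// ltW.
have h6 : pr (B * t) bad / s1 <= q / 8 * (2 / s2).
  apply: ler_pM => //; rewrite ?invr_ge0 ?(ltW s10)//; first exact: pr_ge0.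
  by rewrite ler_pdivlMr// mulrC ler_pdivrMr.
have -> : q / 2 / s2 = q / s2 - 2 * (q / 8 * (2 / s2)) by field; rewrite gt_eqF.
by move: h1 h2 h4 h6; clear; lra.
Qed.
End pin_stage.

Section pin_stage_main.
Context {R : realType} (p : R) (hp0 : 0 < p) (hp : p < 1 / 2).
Local Ltac plra := move: hp0 hp => ? ?; lra.
Local Notation pr := (pr p).
Local Notation S := (@netS R).
Local Notation M := (@discM R).
Local Notation Tg := (Tg p).

(** With the number of burgers pinned, parity leaves only [h - c - 1] and [h - c + 1] in the window
    of [pinned]; one last burger of the appropriate kind reaches the target in either case. *)
Lemma target_last N s h c i x : all is_burger s -> size x = N ->
  (i.*2 + size s + 1 = N + h + c)%N -> nbur x == i ->
  pinned s (h%:Z - c%:Z + 1) x ->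
  target h c s (rcons x BH) || target h c s (rcons x BC).
Proof.
move=> bs xN e /eqP xi /andP[ax]; rewrite /disc => dx.
have [_] := @alive_disc R s x bs ax; rewrite S_nbur xi xN => sz.
have {}sz : (size (act s x).2 + N = size s + i.*2)%N.
  by apply/eqP; rewrite -(eqr_nat R) !natrD sz -mul2n natrM; apply/eqP; ring.
have bs' := act_stack_all x bs; rewrite size_burgers// in sz.
rewrite -!cats1 !target_cat ax /= /target /act /= /reduce_step /= /alive /act /= /reduce_step /=.
by have [-> ->] := c_cons BH (act s x).2; have [-> ->] := c_cons BC (act s x).2; lia.
Qed.

Lemma Tg_last N s h c i : all is_burger s ->
  (i.*2 + size s + 1 = N + h + c)%N ->
  1 / 4 * pr N (fun x => (nbur x == i) && pinned s (h%:Z - c%:Z + 1) x) <= Tg N.+1 s h c.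
Proof.
move=> bs e; rewrite /Tg /pr Ex_rcons -ExZ; apply: (Ex_le hp0 hp) => x xN.
have hs := @target_last N s h c i x bs xN e.
have h0 t : 0 <= (target h c s (rcons x t))%:R :> R by [].
have h1 : 0 <= (1 - p) / 4 * (target h c s (rcons x OH))%:R by apply: mulr_ge0 => //; plra.
have h2 : 0 <= (1 - p) / 4 * (target h c s (rcons x OC))%:R by apply: mulr_ge0 => //; plra.
have h3 : 0 <= p / 2 * (target h c s (rcons x OF))%:R by apply: mulr_ge0 => //; plra.
have h4 : ((nbur x == i) && pinned s (h%:Z - c%:Z + 1) x)%:R <=
    (target h c s (rcons x BH))%:R + (target h c s (rcons x BC))%:R :> R.
  rewrite -natrD ler_nat; case: (boolP (_ && _)) => // /andP[a b].
  by have := hs a b; case: (target h c s (rcons x BH)); case: (target h c s (rcons x BC)).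
by move: h1 h2 h3 h4; rewrite /letter_ex; lra.
Qed.

(** The discrepancy of [u] outweighs both the distance to [d] and all that [v] can change, so
    replacing [u] by its flip moves the final discrepancy across [d]. *)
Lemma pin_G s u v L (d : int) (X Y : R) : all is_burger s ->
  (no u + no v + L <= cH s)%N -> (no u + no v + L <= cC s)%N ->
  X <= M u - (oF u)%:R -> `|M v| + 2 * (no v)%:R <= Y ->
  `|(disc s)%:~R - d%:~R| + Y < X ->
  level s d L (u ++ v) /\ disc (sact s (map flip u ++ v)) < d.
Proof.
move=> bs lH lC hX hY hXY.
have main u' : no u' = no u -> oF u' = oF u ->
    alive s (u' ++ v) /\ `|(disc (sact s (u' ++ v)))%:~R - (disc s)%:~R - M u'| <=
    (oF u)%:R + `|M v| + 2 * (no v)%:R.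
  move=> e1 e2; have a : alive s (u' ++ v).
    have := (no_cat u' v, noE (u' ++ v)); rewrite e1 => -[n1 n2].
    apply: alive_suff => //; move: n1 n2 lH lC; clear; lia.
  split => //; rewrite -(alive_sact a).
  have [h1 _] := @alive_disc R s _ bs a; have h2 := @M_cat R u' v.
  have := oF_cat u' v; rewrite e2 -(ler_nat R) natrD => h3.
  have h4 : (oF v)%:R <= (no v)%:R :> R by rewrite ler_nat oF_no.
  set x := (disc (act s (u' ++ v)).2)%:~R in h1 *.
  rewrite -[X in `|X|](_ : x - (disc s)%:~R - M (u' ++ v) + (M (u' ++ v) - M u' - M v + M v) = _); last by ring.
  apply: le_trans (ler_normD _ _) _; have h5 := ler_normD (M (u' ++ v) - M u' - M v) (M v).
  by move: h1 h2 h3 h4 h5; clear; lra.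
have [a1 h1] := main u erefl erefl.
have [_ _ _ _ oFu] := stats_flip u.
have [a2 h2] := main (map flip u) (no_flip u) oFu.
rewrite M_flip in h2; split.
  apply/and3P; have [l1 l2] : (L <= msat cH s (u ++ v))%N /\ (L <= msat cC s (u ++ v))%N.
    by have := no_cat u v => n1; apply: msat_ge => //; move: n1 lH lC; clear; lia.
  split => //; rewrite -(ler_int R).
  move: h1 hX hY hXY; rewrite !ler_norml => /andP[h1 _] hX hY.
  have := ler_norm (d%:~R - (disc s)%:~R : R); rewrite distrC; move: h1 hX hY; clear; lra.
rewrite -(ltr_int R).
move: h2 hX hY hXY; rewrite ler_norml => /andP[_ h2] hX hY.
have := ler_norm ((disc s)%:~R - d%:~R : R); move: h2 hX hY; clear; lra.
Qed.

(** [Q] blocks of positive discrepancy are joined; each has a net count of sign opposite to the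
    current [S u], so that [S u] stays within the size of one block whatever [Q] is. *)
Lemma u_good : exists c K c' : R, [/\ 0 < c, 0 < K, 0 < c' &
  forall (phi : R), 0 < phi -> exists t0, forall t Q, (t0 <= t)%N ->
  c' ^+ Q <= pr (Q * t) (fun u =>
    [&& Q%:R * ((c - phi) * Num.sqrt t%:R) <= M u,
        (oF u)%:R <= Q%:R * (phi * Num.sqrt t%:R),
        `|S u| <= K * Num.sqrt t%:R &
        (no u)%:R <= Q%:R * (K * Num.sqrt t%:R)])].
Proof.
have [c [K [c' [c0 cK c'0 H]]]] := quadrant hp0 hp.
have K0 := lt_trans c0 cK.
exists c, K, c'; split => // phi phi0; have [t0 {}H] := H phi phi0.
exists t0 => t Q tt; set w := Num.sqrt t%:R; have w0 : 0 <= w := sqrtr_ge0 _.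
elim: Q => [|Q IH].
  rewrite expr0 /pr mul0n; cbn [word_ex]; rewrite M_nil S_nil normr0 !mul0r lexx.
  have -> : 0 <= K * w by rewrite mulr_ge0// ltW.
  by [].
set E := (fun u => [&& Q%:R * _ <= _, _, _ & _]) in IH.
rewrite mulSnr /pr Ex_cat exprSr.
apply: le_trans (_ : pr (Q * t) E * c' <= _); first by rewrite ler_pM2r.
rewrite /pr -ExZr; apply: (Ex_le hp0 hp) => u _.
case: (boolP (E u)) => [/and4P[u1 u2 u3 u4]|_]; last first.
  by rewrite mul0r; apply: (Ex_ge0 hp0 hp).
rewrite mul1r; apply: le_trans (H t tt (0 <= S u) false) _.
apply: (pr_le hp0 hp) => v _ /and4P[v1 v2 v3 v4].
have h1 := @M_cat R u v; have := oF_cat u v; have := no_cat u v.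
rewrite -!(ler_nat R) !natrD => h2 h3; rewrite S_cat.
rewrite expr0 mul1r in v2; rewrite -/w in v1 v2 v3 v4; rewrite -![Q.+1%:R]natr1.
have cw : 0 <= c * w by rewrite mulr_ge0// ltW.
move: h1; rewrite ler_norml => /andP[h1 _]; case/andP: v2 => v2 _.
apply/and4P; split.
- by move: h1 u1 v2 v3; clear; lra.
- by move: h3 u2 v3; clear; lra.
- move: u3 v1; rewrite !ler_norml => /andP[u3 u5].
  by case: (leP 0 (S u)) => hS; rewrite ?expr1 ?expr0 => /andP[v1 v5];
    apply/andP; split; move: u3 u5 v1 v5 hS cw; clear; lra.
- by move: h2 u4 v4; clear; lra.
Qed.

End pin_stage_main.

Lemma half_exists (N s a : nat) : odd a = odd (s + N.+1) -> (s + 1 <= N + a)%N ->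
  exists i, (i.*2 + s + 1 = N + a)%N.
Proof. by move=> h1 h2; exists ((N + a - s - 1)./2); lia. Qed.

Section pin_stage_statement.
Context {R : realType} (p : R) (hp0 : 0 < p) (hp : p < 1 / 2).
Local Notation pr := (pr p).
Local Notation S := (@netS R).
Local Notation M := (@discM R).
Local Notation Tg := (Tg p).

Lemma sqrt_mulnR (a t : nat) : Num.sqrt (a * t)%N%:R = Num.sqrt a%:R * Num.sqrt t%:R :> R.
Proof. by rewrite natrM sqrtrM. Qed.

(* Splitting off the prefix [u], the conditional probability given [u] is a
   local estimate for the net number of burgers of [v]. *)
Lemma prefix_prob n1 n2 i (Eu Ev : word -> bool) (g q r : R) : 0 <= q ->
  g <= pr n1 Eu -> (r < n2%:R) ->
  (forall u, size u = n1 -> Eu u -> `|2 * i%:R - (n1 + n2)%:R - S u| <= r) ->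
  (forall j, `|2 * j%:R - n2%:R| <= r -> q <= pr n2 (fun v => (nbur v == j) && Ev v)) ->
  g * q <= pr (n1 + n2) (fun x => (nbur x == i) && (Eu (take n1 x) && Ev (drop n1 x))).
Proof.
move=> q0 hg rn hE hq; apply: le_trans (_ : pr n1 Eu * q <= _); first by rewrite ler_wpM2r.
rewrite /pr Ex_cat -ExZr; apply: (Ex_le hp0 hp) => u su.
case: (boolP (Eu u)) => Euu; last by rewrite mul0r; apply: (Ex_ge0 hp0 hp).
have := hE u su Euu; rewrite S_nbur su natrD => h.
have e : 2 * i%:R - (n1%:R + n2%:R) - (2 * (nbur u)%:R - n1%:R) =
  2 * (i%:R - (nbur u)%:R) - n2%:R :> R by ring.
have ui : (nbur u <= i)%N.
  rewrite -(ler_nat R); move: h; rewrite e ler_norml => /andP[h _].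
  by move: h rn; clear; lra.
rewrite mul1r; apply: le_trans (hq (i - nbur u)%N _) _; first by rewrite natrB// -e.
apply: (pr_le hp0 hp) => v _ /andP[/eqP hv Evv].
by rewrite take_size_cat// drop_size_cat// Euu Evv nbur_cat hv subnKC// eqxx.
Qed.

Lemma no_pinned (n1 n2 t A L : nat) i (lam : R) : (0 < t)%N ->
  (t <= n1 <= A * t)%N -> (t <= n2 <= A * t)%N ->
  1 <= lam -> lam * Num.sqrt t%:R <= 4 * L%:R ->
  pr (n1 + n2) (fun x => (nbur x == i) && (L <= no x)%N) <=
  20 * 8 ^+ 2 * A%:R / (lam * Num.sqrt t%:R).
Proof.
move=> t0 /andP[n1a n1b] /andP[n2a n2b] lam1 hL; set w := Num.sqrt t%:R in hL *.
have n1_0 : (0 < n1)%N by apply: leq_trans n1a.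
have n2_0 : (0 < n2)%N by apply: leq_trans n2a.
have w0 : 0 < w by rewrite sqrtr_gt0 ltr0n.
have wt : w ^+ 2 = t%:R by rewrite sqr_sqrtr.
have lw0 : 0 < lam * w by rewrite mulr_gt0//; lra.
pose y := lam * w / 8; have y0 : 0 < y by rewrite divr_gt0.
have := @pinned_split R p hp0 hp n1 n2 i (fun x => (L <= no x)%N)
  (fun x => y <= (no x)%:R) (fun x => y <= (no x)%:R) n1_0 n2_0.
have hy (u v : word) : (L <= no (u ++ v))%N -> (y <= (no u)%:R) || (y <= (no v)%:R).
  move=> h; rewrite -[_ || _]negbK negb_or -!ltNge; apply/negP => /andP[hu hv].
  have := leq_trans h (no_cat u v); rewrite -(ler_nat R) natrD => h2.
  by move: h2 hu hv hL; rewrite /y; clear; lra.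
move/(_ hy) => {hy} h.
have one n m : (n <= A * t)%N -> (t <= m)%N -> pr n (fun x => y <= (no x)%:R) / Num.sqrt m%:R <=
    10 * 8 ^+ 2 * A%:R / (lam * w).
  move=> nA tm; have h1 := @no_tail R p hp0 hp n y y0.
  apply: le_trans (_ : 10 * (A%:R * w ^+ 2) / y ^+ 2 * w^-1 <= _).
    apply: ler_pM; rewrite ?pr_ge0 ?invr_ge0 ?sqrtr_ge0//.
      apply: le_trans h1 _; rewrite ler_pM2r ?invr_gt0 ?exprn_gt0// ler_pM2l//.
      by rewrite wt -natrM ler_nat.
    by rewrite lef_pV2 ?posrE ?sqrtr_gt0 ?ltr0n ?(leq_trans t0)// ler_wsqrtr// ler_nat.
  have -> : 10 * (A%:R * w ^+ 2) / y ^+ 2 / w = 10 * 8 ^+ 2 * A%:R / (lam * w) / lam.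
    by rewrite /y; field; rewrite !gt_eqF//; lra.
  rewrite ler_pdivrMr; last by lra.
  by rewrite ler_peMr// divr_ge0 ?(ltW lw0).
apply: le_trans h _; have := lerD (one n1 n2 n1b n2a) (one n2 n1 n2b n1a).
move/le_trans; apply; rewrite le_eqVlt; apply/orP; left; apply/eqP.
by field; rewrite !gt_eqF//; lra.
Qed.

Lemma pin_stage (K2 : R) : 0 < K2 -> exists A (lam q : R) t0,
  [/\ (0 < A)%N, 0 < lam, 0 < q & forall t s h c, (t0 <= t)%N -> all is_burger s ->
   lam * Num.sqrt t%:R <= (cH s)%:R -> lam * Num.sqrt t%:R <= (cC s)%:R ->
   `|h%:R - (cH s)%:R| <= K2 * Num.sqrt t%:R ->
   `|c%:R - (cC s)%:R| <= K2 * Num.sqrt t%:R ->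
   odd (h + c) = odd (size s + (A * t).+1) ->
   q / t%:R <= Tg (A * t).+1 s h c].
Proof.
move=> K20; have [cb [qb [cb0 qb0 HV]]] := v_good hp0 hp.
have [c1 [K [c' [c10 K0 c'0 HU]]]] := u_good hp0 hp.
pose r := K + 2 * K2 + 2; have r0 : 0 < r by rewrite /r; move: K0 K20; clear; lra.
(* [B] puts the number of burgers required of [v], off centre by at most [r * w], inside the window
   of its local estimate. *)
have [B hB] := ex_nat_gt ((r / cb) ^+ 2).
have B0 : (0 < B)%N.
  by rewrite -(ltr_nat R); apply: le_lt_trans hB; exact: sqr_ge0.
have [K3 K30 {}HV] := HV B B0.
pose W1 := K3 + 2 * K2 + 3.
have W10 : 0 < W1 by rewrite /W1; move: K30 K20; clear; lra.
(* [Q] makes the discrepancy of [u] exceed [W1 * w], which covers the distance to [d] and the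
   influence of [v]. *)
have [Q hQ] := ex_nat_gt (2 * W1 / c1).
have Q0 : (0 < Q)%N.
  rewrite -(ltr_nat R); apply: le_lt_trans hQ.
  by rewrite ltW// divr_gt0// mulr_gt0.
have [tu {}HU] := HU (c1 / 4) (divr_gt0 c10 (ltr0n R 4)).
pose A := (Q + (B + B))%N; have A0 : (0 < A)%N by rewrite addn_gt0 Q0.
have A1 : 1 <= A%:R :> R by rewrite ler1n.
pose sA : R := Num.sqrt A%:R; have sA0 : 0 < sA by rewrite sqrtr_gt0 ltr0n.
pose kap := c' ^+ Q * (qb / sA) / sA.
have kap0 : 0 < kap by rewrite divr_gt0// mulr_gt0 ?exprn_gt0// divr_gt0.
pose Z : R := 24 * (20 * 8 ^+ 2).
have Z0 : 0 < Z by rewrite !mulr_gt0// exprn_gt0.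
(* The main term is [kap / w ^+ 2], the low-stack correction is of order [lam ^- 2 / w ^+ 2]. The
   last summand makes the correction at most half of the main term; the second one keeps the stack
   above all the orders of [u] and [v]. *)
pose lam := 1 + 6 * (Q%:R * K + K3) + 2 * Z * A%:R / kap.
have z1 : 0 <= 6 * (Q%:R * K + K3) by rewrite mulr_ge0// addr_ge0 ?mulr_ge0 ?(ltW K0) ?(ltW K30).
have z2 : 0 <= 2 * Z * A%:R / kap by rewrite ltW// divr_gt0// !mulr_gt0// ltr0n.
have lam1 : 1 <= lam by rewrite /lam; move: z1 z2; clear; lra.
have lam2 : 6 * (Q%:R * K + K3) <= lam by rewrite /lam; move: z1 z2; clear; lra.
have lam3 : 2 * Z * A%:R / kap <= lam by rewrite /lam; move: z1 z2; clear; lra.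
have lam0 : 0 < lam by apply: lt_le_trans lam1.
have [t1 ht1] := ex_nat_gt ((12 + r) ^+ 2).
exists A, lam, (kap / 8), (maxn tu t1); split => //; first by rewrite divr_gt0.
move=> t s h c; rewrite geq_max => /andP[tu_t t1_t] bs; set w := Num.sqrt t%:R.
move=> lH lC dH dC hpar.
have w12 : 12 + r <= w.
  rewrite -(ler_pXn2r (n := 2)) ?nnegrE ?sqrtr_ge0//; last by move: r0; clear; lra.
  rewrite sqr_sqrtr//; apply: ltW; apply: lt_le_trans ht1 _; by rewrite ler_nat.
have w0 : 0 < w by move: w12 r0; clear; lra.
have wt : w ^+ 2 = t%:R by rewrite sqr_sqrtr.
have t0 : (0 < t)%N by rewrite -(ltr_nat R) -wt exprn_gt0.
have rw_t : r * w < t%:R.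
  by rewrite -wt expr2 ltr_pM2r//; move: w12; clear; lra.
have szs : (size s)%:R = (cH s)%:R + (cC s)%:R :> R by rewrite size_burgers// natrD.
have At : t%:R <= (A * t)%:R :> R by rewrite ler_nat leq_pmull.
have [i hi] : exists i, (i.*2 + size s + 1 = A * t + (h + c))%N.
  apply: half_exists => //; rewrite -(ler_nat R) !natrD szs.
  move: dH dC rw_t At w12; rewrite /r !ler_norml => /andP[d1 _] /andP[d2 _].
  have : 0 < K * w by rewrite mulr_gt0.
  by move: w0 r0 d1 d2; clear; rewrite /r; lra.
have {}hi : (i.*2 + size s + 1 = A * t + h + c)%N by rewrite hi addnA.
have hiR : 2 * i%:R = (A * t)%:R + h%:R + c%:R - (size s)%:R - 1 :> R.
  have /(@natR_eq R) := hi; rewrite !natrD -mul2n [(2 * i)%:R]natrM => e.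
  by move: e; clear; lra.
pose d : int := h%:Z - c%:Z + 1.
pose n1 := (Q * t)%N; pose n2 := (B * t + B * t)%N.
have An : (A * t = n1 + n2)%N by rewrite /A /n1 /n2 !mulnDl.
pose Eu u := [&& Q%:R * ((c1 - c1 / 4) * w) <= M u, (oF u)%:R <= Q%:R * (c1 / 4 * w),
        `|S u| <= K * w & (no u)%:R <= Q%:R * (K * w)].
pose Ev v := `|M v| + 2 * (no v)%:R <= K3 * w.
have h1 := HU t Q tu_t; rewrite -/w -/Eu in h1.
have sn2 : Num.sqrt n2%:R <= sA * w.
  by rewrite -sqrt_mulnR ler_wsqrtr// ler_nat An leq_addl.
have sn20 : 0 < Num.sqrt n2%:R :> R.
  by rewrite sqrtr_gt0 ltr0n addn_gt0 muln_gt0 B0 t0.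
have h2 : c' ^+ Q * (qb / (sA * w)) <=
    pr (n1 + n2) (fun x => (nbur x == i) && (Eu (take n1 x) && Ev (drop n1 x))).
  apply: (@prefix_prob n1 n2 i Eu Ev _ _ (r * w)) => //.
  - by rewrite divr_ge0 ?mulr_ge0 ?(ltW qb0) ?(ltW sA0) ?(ltW w0).
  - by apply: lt_le_trans rw_t _; rewrite ler_nat /n2 -mulnDl leq_pmull// addn_gt0 B0.
  - move=> u _ /and4P[_ _ u3 _]; rewrite -An hiR szs.
    move: u3 dH dC; rewrite /r !ler_norml => /andP[u1 u2] /andP[d1 d2] /andP[d3 d4].
    by apply/andP; move: u1 u2 d1 d2 d3 d4 w12 r0 rw_t; rewrite /r; clear; move=> *; split; lra.
  move=> j hj; apply: le_trans (HV t j t0 _); last first.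
    apply: le_trans hj _.
    apply: le_trans (_ : cb * (Num.sqrt B%:R * w) <= _); last first.
      rewrite ler_pM2l// -sqrt_mulnR ler_wsqrtr// ler_nat; exact: leq_addr.
    rewrite mulrA ler_pM2r// mulrC -ler_pdivrMr//.
    rewrite -(ler_pXn2r (n := 2)) ?nnegrE ?sqrtr_ge0//; last by rewrite divr_ge0// ltW.
    by rewrite sqr_sqrtr// ltW.
  rewrite ler_pM2l// lef_pV2 ?posrE// mulr_gt0//.
have lw12 : 12 <= lam * w.
  have : 0 <= (lam - 1) * w by rewrite mulr_ge0 ?subr_ge0// ltW.
  by move: w12 r0; clear; lra.
pose L := Num.truncn (lam * w / 3).
have /andP[L1 L2] : L%:R <= lam * w / 3 < L.+1%:R.
  by apply: truncn_itv; move: lw12; clear; lra.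
rewrite -[L.+1%:R]natr1 in L2.
have L3 : (1 < L)%N by rewrite -(ltr_nat R); move: L2 lw12; clear; lra.
have LH m : lam * w <= m%:R -> (L.*2 <= m)%N.
  rewrite -(ler_nat R) -mul2n natrM; move: L1 lw12; clear; lra.
have h3 : pr (n1 + n2) (fun x => (nbur x == i) && (L <= no x)%N) <=
    20 * 8 ^+ 2 * A%:R / (lam * w).
  apply: (@no_pinned n1 n2 t A) => //.
  - by rewrite leq_pmull//= leq_mul2r leq_addr orbT.
  - by rewrite /n2 -mulnDl leq_pmull ?addn_gt0 ?B0//= leq_mul2r leq_addl orbT.
  - by rewrite -/w; move: L2 lw12; clear; lra.
have N0 : (0 < n1 + n2)%N by rewrite -An muln_gt0 A0.
have h4 := @pin_avg R p hp0 hp s bs n1 n2 i d (fun u v => Eu u && Ev v) N0 L L3 (LH _ lH) (LH _ lC).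
have HG u v : size u = n1 -> size v = n2 -> Eu u && Ev v ->
    level s d L (u ++ v) /\ disc (sact s (map flip u ++ v)) < d.
  move=> _ _ /andP[/and4P[u1 u2 _ u4] v1].
  have v2 := normr_ge0 (M v); rewrite /Ev in v1.
  have nl m : lam * w <= m%:R -> (no u + no v + L <= m)%N.
    rewrite -(ler_nat R) !natrD.
    have g1 : 6 * (Q%:R * K + K3) * w <= lam * w by rewrite ler_pM2r.
    have g2 : 0 < K3 * w by rewrite mulr_gt0.
    by move: L1 u4 v1 v2 g1 g2 lw12; clear; lra.
  apply: (@pin_G R s u v L d (Q%:R * (c1 / 2 * w)) (K3 * w)) => //; try exact: nl.
    by move: u1 u2; clear; lra.
  have e : `|(disc s)%:~R - d%:~R| <= 2 * (K2 * w) + 1 :> R.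
    rewrite /disc /d !rmorphD !rmorphN /= -!pmulrn; move: dH dC.
    rewrite !ler_norml => /andP[d1 d2] /andP[d3 d4].
    by apply/andP; move: d1 d2 d3 d4; clear; move=> *; split; lra.
  have g3 : W1 * w < Q%:R * (c1 / 2 * w).
    rewrite mulrA ltr_pM2r//; move: hQ; rewrite ltr_pdivrMr//; clear; lra.
  by move: g3 e w12 r0; rewrite /W1; clear; lra.
have {}h4 := h4 HG; have h5 := @Tg_last R p hp0 hp (A * t) s h c i bs hi.
rewrite -/d An in h5; rewrite -[in Num.sqrt (n1 + n2)%N%:R]An sqrt_mulnR -/w -/sA in h4.
move: h4 h5; set P := pr (n1 + n2) (fun x => (nbur x == i) && pinned s d x) => h4 h5.
rewrite An; apply: le_trans h5.
have h6 : kap / w ^+ 2 <= P + 4 / L.-1%:R * (20 * 8 ^+ 2 * A%:R / (lam * w)).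
  have -> : kap / w ^+ 2 = c' ^+ Q * (qb / (sA * w)) / (sA * w).
    by rewrite /kap; field; rewrite !gt_eqF.
  apply: le_trans (_ : pr (n1 + n2) (fun x => (nbur x == i) && (Eu (take n1 x) && Ev (drop n1 x))) / (sA * w) <= _).
    by rewrite ler_pM2r ?invr_gt0 ?mulr_gt0.
  apply: le_trans h4 _; rewrite lerD2l ler_wpM2l// divr_ge0.
have lw0 : 0 < lam * w by rewrite mulr_gt0.
have Lp : lam * w / 6 <= L.-1%:R.
  rewrite -subn1 natrB; last exact: ltnW.
  by move: L2 lw12; clear; lra.
have h7 : 4 / L.-1%:R * (20 * 8 ^+ 2 * A%:R / (lam * w)) <= kap / 2 / w ^+ 2.
  apply: le_trans (_ : 24 / (lam * w) * (20 * 8 ^+ 2 * A%:R / (lam * w)) <= _).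
    rewrite ler_wpM2r//; first by rewrite divr_ge0 ?(ltW lw0)// mulr_ge0// mulr_ge0// exprn_ge0.
    rewrite ler_pdivlMr// mulrAC ler_pdivrMr; first by move: Lp; clear; lra.
    by apply: lt_le_trans Lp; rewrite divr_gt0.
  have -> : 24 / (lam * w) * (20 * 8 ^+ 2 * A%:R / (lam * w)) = Z * A%:R / lam / lam / w ^+ 2.
    by rewrite /Z; field; rewrite !gt_eqF.
  rewrite ler_pM2r ?invr_gt0 ?exprn_gt0// ler_pdivrMr//.
  have h8 : Z * A%:R / lam <= kap / 2.
    by rewrite ler_pdivrMr//; move: lam3; rewrite ler_pdivrMr//; clear; lra.
  apply: le_trans h8 _; rewrite ler_peMr//.
  by rewrite divr_ge0// ltW.
rewrite -wt; have -> : kap / 8 / w ^+ 2 = 1 / 4 * (kap / w ^+ 2 - kap / 2 / w ^+ 2).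
  by field; rewrite gt_eqF.
by rewrite ler_pM2l ?divr_gt0//; move: h6 h7; clear; lra.
Qed.

End pin_stage_statement.

(** * Hitting a given stack *)

Section local_estimate.
Context {R : realType} (p : R) (hp0 : 0 < p) (hp : p < 1 / 2).
Local Ltac plra := move: hp0 hp => ? ?; lra.
Local Notation Ex := (word_ex p).
Local Notation pr := (pr p).

Lemma word_prob (x : word) (F : word -> R) : (forall y, 0 <= F y) ->
  (p / 4) ^+ size x * F x <= Ex (size x) F.
Proof.
elim: x F => [|a x IH] F F0; first by rewrite expr0 mul1r.
have e : 0 <= (p / 4) ^+ size x by rewrite exprn_ge0// divr_ge0// ltW.
have h t : (p / 4) ^+ size x * F (t :: x) <= Ex (size x) (fun y => F (t :: y)).
  exact: IH.
have g t : 0 <= Ex (size x) (fun y => F (t :: y)) by apply: (Ex_ge0 hp0 hp).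
have w (c : R) t : p / 4 <= c -> (p / 4) ^+ size x * F (t :: x) * (p / 4) <=
    c * Ex (size x) (fun y => F (t :: y)).
  move=> pc; rewrite [leRHS]mulrC; apply: ler_pM => //; first exact: mulr_ge0.
  by rewrite divr_ge0// ltW.
have k (c : R) t : 0 <= c -> 0 <= c * Ex (size x) (fun y => F (t :: y)) by move=> ?; exact: mulr_ge0.
cbn [word_ex size]; rewrite exprSr -mulrA [p / 4 * _]mulrC mulrA /letter_ex.
have p1 : 0 <= (1 - p) / 4 by plra.
have p2 : 0 <= p / 2 by plra.
have p4 : 0 <= 1 / 4 :> R by lra.
have := (k _ BH p4, k _ BC p4, k _ OH p1, k _ OC p1, k _ OF p2) => -[[[[k1 k2] k3] k4] k5].
have w1 : p / 4 <= 1 / 4 by plra.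
have w2 : p / 4 <= (1 - p) / 4 by plra.
have w3 : p / 4 <= p / 2 by plra.
by case: a; [have := w _ BH w1|have := w _ BC w1|have := w _ OH w2|have := w _ OC w2|have := w _ OF w3];
  move: k1 k2 k3 k4 k5; clear; lra.
Qed.

Definition close (e : R) (a b : R) (s : word) : bool :=
  (`|(size s)%:R - a| <= e) && (`|(disc s)%:~R - b| <= e).

Lemma closeP e a b s : all is_burger s -> close e a b s ->
  `|(cH s)%:R - (a + b) / 2| <= e /\ `|(cC s)%:R - (a - b) / 2| <= e.
Proof.
move=> bs; rewrite /close /disc size_burgers// intrB -!pmulrn natrD !ler_norml.
move=> /andP[/andP[a1 a2] /andP[b1 b2]].
by split; apply/andP; move: a1 a2 b1 b2; clear; move=> *; split; lra.
Qed.

(* One block pushes size and discrepancy against their current deviations. *)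
Lemma steer_step : exists c K c' : R, [/\ 0 < c, 0 < K, 0 < c' &
  exists t0, forall t s a b al be, (t0 <= t)%N -> let w := Num.sqrt t%:R in
  all is_burger s -> close ((K + c) * w) a b s ->
  K * w <= (cH s)%:R -> K * w <= (cC s)%:R ->
  `|al| <= c / 4 * w -> `|be| <= c / 4 * w ->
  c' <= pr t (fun x => alive s x && close ((K + c) * w) (a + al) (b + be) (act s x).2)].
Proof.
have [c [K [c' [c0 cK c'0 H]]]] := quadrant hp0 hp.
have K0 := lt_trans c0 cK.
have [t0 {}H] := H (c / 4) (divr_gt0 c0 (ltr0n R 4)).
exists c, K, c'; split => //; exists t0 => t s a b al be tt w bs /andP[cs1 cs2] lH lC hal hbe.
apply: le_trans (H t tt (a <= (size s)%:R) (b <= (disc s)%:~R)) _.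
have w0 : 0 <= w := sqrtr_ge0 _.
have cw : 0 <= c * w by rewrite mulr_ge0// ltW.
apply: (pr_le hp0 hp) => x _ /and4P[]; rewrite -/w => x1 x2 x3 x4.
have nx : alive s x.
  have hn m : K * w <= m%:R -> (no x <= m)%N by rewrite -(ler_nat R); exact: le_trans x4.
  have := (hn _ lH, hn _ lC, noE x) => -[[n1 n2] n3].
  by apply: alive_suff => //; move: n1 n2 n3; clear; lia.
have [d1 d2] := @alive_disc R s x bs nx.
rewrite nx /close d2 /=; move: d1 cs1 cs2 hal hbe; rewrite !ler_norml.
set D := (disc (act s x).2)%:~R; set D0 := (disc s)%:~R; set S0 := (size s)%:R.
move=> /andP[d3 d4] /andP[e1 e2] /andP[f1 f2] /andP[g1 g2] /andP[h1 h2].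
apply/andP; split.
  case: (leP a S0) x1 => hS; rewrite ?expr1 ?expr0 => /andP[x5 x6];
    apply/andP; move: e1 e2 g1 g2 x5 x6 cw hS; clear; move=> *; split; lra.
case: (leP b D0) x2 => hS; rewrite ?expr1 ?expr0 => /andP[x5 x6];
  apply/andP; move: d3 d4 f1 f2 h1 h2 x3 x5 x6 cw hS; clear; move=> *; split; lra.
Qed.

(** The blocks follow a straight line of targets. The bounds on sum and difference keep both counts
    of the stack above [K * w], so no block exhausts it. *)
Lemma steer : exists c K c' : R, [/\ 0 < c, 0 < K, 0 < c' &
  exists t0, forall t G s a b al be, (t0 <= t)%N -> let w := Num.sqrt t%:R in
  all is_burger s -> close ((K + c) * w) a b s ->
  (forall j, (j < G)%N ->
     2 * ((2 * K + c) * w) <= (a + j%:R * al) + (b + j%:R * be) /\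
     2 * ((2 * K + c) * w) <= (a + j%:R * al) - (b + j%:R * be)) ->
  `|al| <= c / 4 * w -> `|be| <= c / 4 * w ->
  c' ^+ G <= pr (G * t) (fun x => alive s x &&
     close ((K + c) * w) (a + G%:R * al) (b + G%:R * be) (act s x).2)].
Proof.
have [c [K [c' [c0 K0 c'0 [t0 H]]]]] := steer_step.
exists c, K, c'; split => //; exists t0 => t G s a b al be tt w bs cs hj hal hbe.
elim: G hj => [|G IH] hj.
  rewrite mul0n expr0 /pr; cbn [word_ex].
  by rewrite !mul0r !addr0 cs /alive /act /= .
have {}IH : c' ^+ G <= pr (G * t) (fun x => alive s x &&
     close ((K + c) * w) (a + G%:R * al) (b + G%:R * be) (act s x).2).
  by apply: IH => j jG; apply: hj; exact: ltnW.
rewrite exprSr mulSnr /pr Ex_cat.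
apply: le_trans (_ : pr (G * t) (fun x => alive s x &&
     close ((K + c) * w) (a + G%:R * al) (b + G%:R * be) (act s x).2) * c' <= _).
  by rewrite ler_pM2r.
rewrite /pr -ExZr; apply: (Ex_le hp0 hp) => x _.
case: (boolP (_ && _)) => [/andP[ax cx]|_]; last by rewrite mul0r; apply: (Ex_ge0 hp0 hp).
have bx := act_stack_all x bs; have [h1 h2] := closeP bx cx.
have [j1 j2] := hj G (ltnSn G).
rewrite mul1r; apply: le_trans (H t (act s x).2 _ _ al be tt bx cx _ _ hal hbe) _.
- by move: h1 j1; rewrite -/w ler_norml => /andP[h1 _]; move: h1; clear; lra.
- by move: h2 j2; rewrite -/w ler_norml => /andP[h2 _]; move: h2; clear; lra.
apply: (pr_le hp0 hp) => y _ /andP[ay cy].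
rewrite alive_cat ax ay act_cat /=.
by move: cy; rewrite -[G.+1%:R]natr1 !mulrDl !mul1r !addrA.
Qed.

End local_estimate.

(** * The local estimate between stacks of comparable size *)

Section local_lemma.
Context {R : realType} (p : R) (hp0 : 0 < p) (hp : p < 1 / 2).
Local Ltac plra := move: hp0 hp => ? ?; lra.
Local Notation Ex := (word_ex p).
Local Notation pr := (pr p).
Local Notation Tg := (Tg p).

Lemma odd_alive s x : all is_burger s -> alive s x ->
  odd (size (act s x).2) = odd (size s + size x).
Proof.
move=> bs ax; have [_] := @alive_disc R s x bs ax; rewrite S_nbur => e.
have {e} : (size (act s x).2 + size x = size s + (nbur x).*2)%N.
  by apply/eqP; rewrite -(eqr_nat R) !natrD e -mul2n natrM; apply/eqP; ring.
by clear; lia.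
Qed.

Lemma interp_ge (m a z j G : R) : 0 < G -> 0 <= j <= G -> m <= a -> m <= z ->
  m <= a + j * ((z - a) / G).
Proof.
move=> G0 /andP[j0 jG] ma mz.
have -> : a + j * ((z - a) / G) = m + ((G - j) * (a - m) + j * (z - m)) / G.
  by field; rewrite gt_eqF.
by rewrite lerDl divr_ge0 ?(ltW G0)// addr_ge0// mulr_ge0// subr_ge0.
Qed.

Lemma block_split (T tau m : nat) : (0 < T)%N -> (m * T < tau)%N ->
  exists t l, [/\ (tau = l + (T * t).+1)%N, (l < T)%N & (m <= t)%N].
Proof.
move=> T0 mt; exists (tau.-1 %/ T)%N, (tau.-1 %% T)%N; split.
- by have := divn_eq tau.-1 T; rewrite mulnC; lia.
- exact: ltn_pmod.
- by rewrite leq_divRL//; lia.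
Qed.

Lemma split_le (G A t l : nat) : (l < G + A)%N -> (A <= G)%N -> (0 < t)%N ->
  (l + ((G + A) * t).+1 <= 4 * (G * t))%N.
Proof.
move=> lT AG t0; have h1 : (G + A <= 2 * G)%N by lia.
have h2 : ((G + A) * t <= 2 * G * t)%N by rewrite leq_mul2r h1 orbT.
have h3 : (2 * G <= 2 * G * t)%N by rewrite leq_pmulr.
by move: h1 h2 h3 lT; rewrite -mulnA; lia.
Qed.

Lemma slope_le (e L0 G sG w sT T c : R) : 0 < c -> 0 < w -> 1 <= G -> G = sG ^+ 2 ->
  0 < sG -> sT <= 2 * (sG * w) -> 32 * L0 / c <= sG -> T <= 2 * G -> 16 / c <= w ->
  0 <= L0 -> `|e| <= 2 * (L0 * sT) + T -> `|e / G| <= c / 4 * w.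
Proof.
move=> c0 w0 G1 GE s0 hT hL TG hw L00 he.
have G0 : 0 < G by apply: lt_le_trans G1.
rewrite normrM (ger0_norm (x := G^-1)) ?invr_ge0 ?(ltW G0)// ler_pdivrMr//.
apply: le_trans he _.
have h1 : L0 * sT <= L0 * (2 * (sG * w)) by rewrite ler_wpM2l.
have h2 : 32 * L0 * (sG * w) <= sG * c * (sG * w).
  by rewrite ler_pM2r ?mulr_gt0//; rewrite -ler_pdivrMr.
have h3 : 16 * G <= w * c * G by rewrite ler_pM2r// -ler_pdivrMr.
rewrite GE in h3 TG *; move: h1 h2 h3 TG; clear; lra.
Qed.

(** The time is spent on [l < T] hamburgers, absorbing the remainder modulo [T] at constant cost, on
    [G] steering blocks of length [t], and on a pinning stage of length [A * t + 1]. *)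
Lemma local_lemma (L0 : R) : 1 <= L0 -> exists (q0 : R) n0, 0 < q0 /\
  forall tau s h c, (n0 <= tau)%N -> all is_burger s ->
  let r := Num.sqrt tau%:R in
  r <= L0 * (cH s)%:R -> (cH s)%:R <= L0 * r ->
  r <= L0 * (cC s)%:R -> (cC s)%:R <= L0 * r ->
  r <= L0 * h%:R -> h%:R <= L0 * r -> r <= L0 * c%:R -> c%:R <= L0 * r ->
  odd (h + c) = odd (size s + tau) -> q0 / tau%:R <= Tg tau s h c.
Proof.
move=> L01; have p41 : p / 4 <= 1 by plra.
have [c1 [K [c' [c10 K0 c'0 [ts HS]]]]] := steer hp0 hp.
have Kc : 0 < K + c1 by rewrite addr_gt0.
have [A [lam [qp [tp [A0 lam0 qp0 HP]]]]] := pin_stage hp0 hp Kc.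
pose m := 3 * K + 2 * c1 + lam; have m0 : 0 < m by rewrite /m; move: K0 c10 lam0; clear; lra.
have L00 : 0 < L0 by apply: lt_le_trans L01.
(* Large [G] makes the target move by a small multiple of [w] per block ([sG1]), while all counts
   involved are at least [2 * m * w] ([sG2]). *)
have [G hG] := ex_nat_gt (A%:R + (32 * L0 / c1) ^+ 2 + (2 * (L0 * m)) ^+ 2).
have sq1 := sqr_ge0 (32 * L0 / c1); have sq2 := sqr_ge0 (2 * (L0 * m)).
have AG : (A <= G)%N.
  by rewrite -(ler_nat R); move: hG sq1 sq2; clear; lra.
have G0 : (0 < G)%N by apply: leq_trans AG.
pose sG : R := Num.sqrt G%:R; have sG0 : 0 < sG by rewrite sqrtr_gt0 ltr0n.
have sGE : G%:R = sG ^+ 2 by rewrite sqr_sqrtr.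
have AR : 0 <= A%:R :> R by [].
have sG1 : 32 * L0 / c1 <= sG.
  rewrite -(ler_pXn2r (n := 2)) ?nnegrE ?sqrtr_ge0//.
    by rewrite -sGE; move: hG sq2 AR; clear; lra.
  by rewrite divr_ge0 ?mulr_ge0 ?(ltW L00) ?(ltW c10).
have sG2 : 2 * (L0 * m) <= sG.
  rewrite -(ler_pXn2r (n := 2)) ?nnegrE ?sqrtr_ge0//.
    by rewrite -sGE; move: hG sq1 AR; clear; lra.
  by rewrite !mulr_ge0 ?(ltW L00) ?(ltW m0).
pose T := (G + A)%N; have T0 : (0 < T)%N by rewrite addn_gt0 G0.
have [tw htw] := ex_nat_gt ((16 / c1 + 1) ^+ 2).
pose m0' := maxn (maxn ts tp) tw.
exists ((p / 4) ^+ T * (c' ^+ G * qp)), (m0' * T).+1; split.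
  by rewrite !mulr_gt0 ?exprn_gt0// divr_gt0.
move=> tau s h c htau bs r sH1 sH2 sC1 sC2 h1 h2 c2 c3 par.
have [t [l [tauE lT]]] := block_split T0 htau.
rewrite !geq_max => /andP[/andP[ts_t tp_t] tw_t].
set w : R := Num.sqrt t%:R.
have w16 : 16 / c1 + 1 <= w.
  rewrite -(ler_pXn2r (n := 2)) ?nnegrE ?sqrtr_ge0//; last by rewrite addr_ge0// divr_ge0// ltW.
  by rewrite sqr_sqrtr//; apply: ltW; apply: lt_le_trans htw _; rewrite ler_nat.
have c16 : 0 < 16 / c1 by rewrite divr_gt0.
have w0 : 0 < w by move: w16 c16; clear; lra.
have wt : w ^+ 2 = t%:R by rewrite sqr_sqrtr.
have t0 : (0 < t)%N by rewrite -(ltr_nat R) -wt exprn_gt0.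
have r1 : sG * w <= r.
  rewrite -sqrt_mulnR; apply: ler_wsqrtr; rewrite ler_nat tauE.
  apply: leq_trans (leq_addl _ _); rewrite leqW// leq_mul2r leq_addr orbT.
  exact: isT.
have r2 : r <= 2 * (sG * w).
  have -> : 2 * (sG * w) = Num.sqrt (4 * (G * t))%N%:R.
    rewrite sqrt_mulnR sqrt_mulnR -/w -/sG; congr (_ * _).
    have -> : (4 : nat)%:R = (2 : R) ^+ 2 by rewrite -natrX.
    by rewrite sqrtr_sqr ger0_norm.
  by apply: ler_wsqrtr; rewrite ler_nat tauE split_le.
pose bl := nseq l BH; pose s' := bl ++ s.
have bbl : all is_burger bl by rewrite all_nseq orbT.
have actl : act s bl = ([::], s').
  by rewrite /act foldl_burgers// /s' /bl rev_nseq.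
have bs' : all is_burger s' by rewrite all_cat bbl.
have cHs' : cH s' = (l + cH s)%N by rewrite cH_cat /cH /bl count_nseq mul1n.
have cCs' : cC s' = cC s by rewrite cC_cat /cC /bl count_nseq mul0n.
have szs' : size s' = (l + size s)%N by rewrite size_cat size_nseq.
pose a0 : R := (size s')%:R; pose b0 : R := (disc s')%:~R.
pose a1 : R := (h + c)%N%:R; pose b1 : R := (h%:Z - c%:Z)%:~R.
pose al := (a1 - a0) / G%:R; pose be := (b1 - b0) / G%:R.
have lR : 0 <= l%:R :> R by [].
have lTR : l%:R <= T%:R :> R by rewrite ler_nat ltnW.
have eab : [/\ a0 = l%:R + (cH s)%:R + (cC s)%:R, b0 = l%:R + (cH s)%:R - (cC s)%:R,
    a1 = h%:R + c%:R & b1 = h%:R - c%:R].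
  rewrite /a0 /b0 /a1 /b1 /disc szs' size_burgers// cHs' cCs' !intrB -!pmulrn !natrD.
  by split => //; rewrite addrA.
have [ea0 eb0 ea1 eb1] := eab.
have G1 : 1 <= G%:R :> R by rewrite ler1n.
have TG : T%:R <= 2 * G%:R :> R.
  by rewrite -natrM ler_nat /T mul2n -addnn leq_add2l.
have w16' : 16 / c1 <= w by move: w16; clear; lra.
have hal : `|al| <= c1 / 4 * w.
  apply: (slope_le c10 w0 G1 sGE sG0 r2 sG1 TG w16' (ltW L00)).
  rewrite ea0 ea1 ler_norml; apply/andP.
  by move: sH1 sH2 sC1 sC2 h1 h2 c2 c3 lR lTR; rewrite -/r; move: (ler0n R (cH s)) (ler0n R (cC s)) (ler0n R h) (ler0n R c); clear; move=> *; split; lra.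
have hbe : `|be| <= c1 / 4 * w.
  apply: (slope_le c10 w0 G1 sGE sG0 r2 sG1 TG w16' (ltW L00)).
  rewrite eb0 eb1 ler_norml; apply/andP.
  by move: sH1 sH2 sC1 sC2 h1 h2 c2 c3 lR lTR; rewrite -/r; move: (ler0n R (cH s)) (ler0n R (cC s)) (ler0n R h) (ler0n R c); clear; move=> *; split; lra.
have low (x : R) : r <= L0 * x -> 2 * m * w <= x.
  move=> hx; rewrite -(ler_pM2l L00); apply: le_trans (le_trans r1 hx).
  have -> : L0 * (2 * m * w) = 2 * (L0 * m) * w by ring.
  by rewrite ler_pM2r.
have cs : close ((K + c1) * w) a0 b0 s'.
  by rewrite /close /a0 /b0 !subrr !normr0 !mulr_ge0// ltW.
have mw : 2 * ((2 * K + c1) * w) <= 2 * m * w.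
  by rewrite mulrA ler_pM2r// /m; move: K0 c10 lam0; clear; lra.
have hj j : (j < G)%N ->
     2 * ((2 * K + c1) * w) <= (a0 + j%:R * al) + (b0 + j%:R * be) /\
     2 * ((2 * K + c1) * w) <= (a0 + j%:R * al) - (b0 + j%:R * be).
  move=> jG; have jGR : ((0 : R) <= j%:R) && (j%:R <= G%:R :> R) by rewrite ler0n ler_nat ltnW.
  have GR : 0 < G%:R :> R by rewrite ltr0n.
  have -> : a0 + j%:R * al + (b0 + j%:R * be) =
     (a0 + b0) + j%:R * (((a1 + b1) - (a0 + b0)) / G%:R) by rewrite /al /be; ring.
  have -> : a0 + j%:R * al - (b0 + j%:R * be) =
     (a0 - b0) + j%:R * (((a1 - b1) - (a0 - b0)) / G%:R) by rewrite /al /be; ring.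
  have := (low _ sH1, low _ sC1, low _ h1, low _ c2) => -[[[g1 g2] g3] g4].
  have mw0 : 0 < m * w by rewrite mulr_gt0.
  by split; apply: interp_ge => //; rewrite ?ea0 ?eb0 ?ea1 ?eb1;
    move: g1 g2 g3 g4 mw lR mw0; clear; lra.
have hsteer := HS t G s' a0 b0 al be ts_t bs' cs hj hal hbe.
have GR : G%:R != 0 :> R by rewrite gt_eqF// ltr0n.
have ea : a0 + G%:R * al = a1 by rewrite /al; field.
have eb : b0 + G%:R * be = b1 by rewrite /be; field.
rewrite ea eb -/w in hsteer.
have -> : tau = (l + (G * t + (A * t).+1))%N by rewrite tauE /T mulnDl !addnS.
rewrite Tg_cat.
have Tg0 n s0 : 0 <= Tg n s0 h c by exact: pr_ge0.
have hw := @word_prob R p hp0 hp bl (fun x => (alive s x)%:R * Tg (G * t + (A * t).+1) (act s x).2 h c)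
  (fun y => mulr_ge0 (ler0n R _) (Tg0 _ _)).
rewrite size_nseq in hw; apply: le_trans hw.
rewrite /alive actl mul1r /= Tg_cat.
have h3 : c' ^+ G * (qp / t%:R) <=
   Ex (G * t) (fun x => (alive s' x)%:R * Tg (A * t).+1 (act s' x).2 h c).
  apply: le_trans (_ : pr (G * t) (fun x => alive s' x && close ((K + c1) * w) a1 b1 (act s' x).2) * (qp / t%:R) <= _).
    by rewrite ler_pM2r// divr_gt0// ltr0n.
  rewrite /pr -ExZr; apply: (Ex_le hp0 hp) => x xs.
  case: (boolP (_ && _)) => [/andP[ax cx]|_]; last by rewrite mul0r mulr_ge0.
  rewrite ax !mul1r; have bx := act_stack_all x bs'; have [k1 k2] := closeP bx cx.
  have e1 : (a1 + b1) / 2 = h%:R by rewrite ea1 eb1; field.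
  have e2 : (a1 - b1) / 2 = c%:R by rewrite ea1 eb1; field.
  rewrite e1 e2 in k1 k2.
  have := (low _ h1, low _ c2) => -[g3 g4].
  have mwe : 2 * m * w = lam * w + (K + c1) * w + (5 * K + 3 * c1 + lam) * w by rewrite /m; ring.
  have z : 0 < (5 * K + 3 * c1 + lam) * w by rewrite mulr_gt0//; move: K0 c10 lam0; clear; lra.
  apply: HP => //.
  - by rewrite -/w; move: k1 g3 mwe z; rewrite ler_norml => /andP[k1 _]; move: k1; clear; lra.
  - by rewrite -/w; move: k2 g4 mwe z; rewrite ler_norml => /andP[k2 _]; move: k2; clear; lra.
  - by rewrite distrC.
  - by rewrite distrC.
  have := odd_alive bs' ax; rewrite xs szs' => o1.
  by move: par o1; rewrite tauE /T; clear; rewrite mulnDl; lia.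
apply: le_trans (_ : (p / 4) ^+ T * (c' ^+ G * (qp / t%:R)) <= _).
  have -> : (p / 4) ^+ T * (c' ^+ G * (qp / t%:R)) = (p / 4) ^+ T * (c' ^+ G * qp) / t%:R by ring.
  rewrite ler_pM2l; last by rewrite !mulr_gt0 ?exprn_gt0// divr_gt0.
  set tau' := (l + _)%N; have tt : (t <= tau')%N.
    apply: leq_trans (leq_addl _ _); rewrite addnS; apply: leqW.
    by rewrite -mulnDl leq_pmull.
  by rewrite lef_pV2 ?posrE ?ltr0n// ?ler_nat// (leq_trans t0).
apply: ler_pM => //; first by rewrite exprn_ge0// divr_ge0// ltW.
  by rewrite !mulr_ge0 ?exprn_ge0 ?invr_ge0 ?(ltW c'0) ?(ltW qp0).
apply: ler_wiXn2l; [exact: divr_ge0 (ltW hp0) _|exact: p41|exact: ltnW].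
Qed.
End local_lemma.

(** * Survival probabilities *)

Section survival.
Context {R : realType} (p : R) (hp0 : 0 < p) (hp : p < 1 / 2).
Local Notation Ex := (word_ex p).
Local Notation pr := (pr p).
Local Notation S := (@netS R).

Definition survival n : R := pr n (alive [::]).
Local Notation Nal := survival.

Lemma survival_decr m n : (m <= n)%N -> Nal n <= Nal m.
Proof.
move=> mn; rewrite -(subnKC mn) /survival /pr Ex_cat; apply: (Ex_le hp0 hp) => x _.
rewrite -[leRHS](Ex_cst p (n - m)); apply: (Ex_le hp0 hp) => y _.
by rewrite alive_cat ler_nat; case: (alive [::] x) => //; exact: leq_b1.
Qed.

Lemma survival_gt0 n : 0 < Nal n.
Proof.
have := @word_prob R p hp0 hp (nseq n BH) (fun x => (alive [::] x)%:R) (fun=> ler0n _ _).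
rewrite size_nseq; apply: lt_le_trans.
have b : all is_burger (nseq n BH) by rewrite all_nseq orbT.
by rewrite /alive /act foldl_burgers// mulr1 exprn_gt0// divr_gt0.
Qed.

Lemma survival_ge0 n : 0 <= Nal n. Proof. exact/ltW/survival_gt0. Qed.

(** [S ^+ 2] grows by 1 in mean with each letter read while alive, and dying only removes mass. *)
Lemma ES2_alive k : Ex k (fun x => (alive [::] x)%:R * S x ^+ 2) <= \sum_(i < k) Nal i.
Proof.
elim: k => [|k IH]; first by rewrite /= S_nil big_ord0; lra.
rewrite Ex_rcons big_ord_recr /=.
apply: le_trans (_ : Ex k (fun x => (alive [::] x)%:R * S x ^+ 2 + (alive [::] x)%:R) <= _);
  last by rewrite ExD lerD2r.
apply: (Ex_le hp0 hp) => x _; case: (boolP (alive [::] x)) => ax; last first.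
  rewrite mul0r addr0 /letter_ex -!cats1 !alive_cat (negbTE ax) /=.
  by rewrite !mul0r !mulr0 !addr0.
rewrite mul1r; apply: le_trans (_ : letter_ex p (fun t => S (rcons x t) ^+ 2) <= _).
  apply: (Lx_le hp0 hp) => t; case: (alive _ _); rewrite ?mul1r// mul0r; exact: sqr_ge0.
rewrite /letter_ex -!cats1 !S_cat !S1; cbn [is_burger nat_of_bool]; rewrite mulr1n; move: (S x) => z.
by rewrite le_eqVlt; apply/orP; left; apply/eqP; field.
Qed.

Lemma big_prob k (y : R) : 0 < y ->
  pr k (fun x => alive [::] x && (y < (size (act [::] x).2)%:R)) <=
  (\sum_(i < k) Nal i) / y ^+ 2.
Proof.
move=> y0; apply: le_trans (_ : Ex k (fun x => (alive [::] x)%:R * S x ^+ 2) / y ^+ 2 <= _);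
  last by rewrite ler_pM2r ?invr_gt0 ?exprn_gt0// ES2_alive.
rewrite -ExZr; apply: (Ex_le hp0 hp) => x _; case: (boolP (alive [::] x)) => ax /=; last by rewrite !mul0r.
have [_ ->] := @alive_disc R [::] x isT ax.
rewrite mul1r add0r ler_pdivlMr ?exprn_gt0//; case: (ltP y (S x)) => h; last by rewrite mul0r sqr_ge0.
by rewrite mul1r lerXn2r ?nnegrE ?(ltW y0)// ?ltW//; exact: lt_trans h.
Qed.

Lemma sum_survival_le m : \sum_(i < m) Nal i <= m%:R.
Proof.
rewrite -[leRHS]mulr1 mulr_natl -[m in X in _ <= X]card_ord -sumr_const.
by apply: ler_sum => i _; exact: pr_le1.
Qed.

Lemma sum_half m b : (b <= m)%N -> (m <= 2 * b)%N ->
  \sum_(i < m) Nal i <= \sum_(i < b) Nal i + b%:R * Nal b.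
Proof.
move=> bm mb; have -> : m = (b + (m - b))%N by rewrite subnKC.
rewrite -(big_mkord xpredT (fun i => Nal i)) (big_cat_nat _ (leq_addr _ _))//= big_mkord.
rewrite lerD2l; apply: le_trans (_ : \sum_(b <= i < b + (m - b)) Nal b <= _).
  by rewrite big_seq [leRHS]big_seq; apply: ler_sum => i; rewrite mem_index_iota => /andP[bi _]; exact: survival_decr.
rewrite sumr_const_nat addKn -[leLHS]mulr_natl ler_wpM2r ?survival_ge0// ler_nat; lia.
Qed.

(* A bound of Karamata type: summing the tails costs only a constant as soon as
   doubling the time costs a factor larger than 1/2. *)
Lemma sum_survival (lam : R) m0 : 1 / 2 < lam ->
  (forall m, (m0 <= m)%N -> lam * Nal m <= Nal (2 * m)) ->
  exists2 C : R, 0 < C & forall m, (0 < m)%N -> \sum_(i < m) Nal i <= C * (m%:R * Nal m).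
Proof.
move=> l1 H; have lam0 : 0 < lam by lra.
pose e := 2 * lam - 1; have e0 : 0 < e by rewrite /e; lra.
have [b1 hb1] := ex_nat_gt (2 * lam / e).
pose M0 := (2 * (maxn m0 b1).+1)%N.
(* [(Nal M0)^-1] covers [m <= M0], where the sum is at most [m]; [2 / e] closes the induction from
   about [m / 2] to [m]. *)
pose C := 2 / e + (Nal M0)^-1.
have i0 : 0 < (Nal M0)^-1 by rewrite invr_gt0 survival_gt0.
have e2 : 0 < 2 / e by rewrite divr_gt0.
have C0 : 0 < C by rewrite addr_gt0.
exists C => //; elim/ltn_ind => m IH m_gt0.
have m1 : 0 < m%:R :> R by rewrite ltr0n.
case: (leqP m M0) => hm.
  apply: le_trans (sum_survival_le m) _.
  rewrite mulrCA ler_peMr//; apply: le_trans (_ : (Nal M0)^-1 * Nal M0 <= _).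
    by rewrite mulVf// gt_eqF// survival_gt0.
  apply: ler_pM; rewrite ?survival_ge0 ?(ltW i0)//; last exact: survival_decr.
  by rewrite /C lerDr ltW.
pose b := uphalf m.
have [bm mb b2 bM] : [/\ (b < m)%N, (m <= 2 * b)%N, (2 * b <= m.+1)%N & (maxn m0 b1 < b)%N].
  by move: hm; rewrite /b /M0; move: (maxn m0 b1) => z; clear; split; lia.
have bm0 : (m0 <= b)%N by apply: leq_trans (ltnW bM); exact: leq_maxl.
have bb1 : b1%:R <= b%:R :> R.
  by rewrite ler_nat; apply: leq_trans (ltnW bM); exact: leq_maxr.
have b0 : (0 < b)%N by apply: leq_ltn_trans bM.
apply: le_trans (sum_half (ltnW bm) mb) _.
have h1 := IH b bm b0; have h2 := H b bm0.
have h3 : Nal (2 * b) <= Nal m by exact: survival_decr.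
have h4 := survival_gt0 b.
have h5 : (C + 1) * b%:R <= C * (lam * m%:R).
  have h6 : 2 * b%:R <= m%:R + 1 :> R by rewrite natr1 -natrM ler_nat.
  have h7 : 2 * lam <= b%:R * e by rewrite -ler_pdivrMr// (le_trans (ltW hb1)).
  have h8 : 1 <= C * (e / 2).
    have -> : C * (e / 2) = 1 + (Nal M0)^-1 * (e / 2) by rewrite /C; move: (Nal M0)^-1 => z; field; rewrite gt_eqF.
    by rewrite lerDl mulr_ge0 ?(ltW i0)// divr_ge0// ltW.
  have h9 : b%:R <= C * (e / 2) * b%:R by rewrite ler_peMl.
  have h10 : C * (b%:R + b%:R * e / 2) <= C * (lam * m%:R).
    rewrite ler_pM2l//; apply: le_trans (_ : lam * (2 * b%:R - 1) <= _).
      by move: h7; rewrite /e; clear; lra.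
    rewrite ler_pM2l//.
    by lra.
  by move: h9 h10; clear; lra.
apply: le_trans (_ : (C + 1) * b%:R * Nal b <= _); first by move: h1; clear; lra.
apply: le_trans (_ : C * (lam * m%:R) * Nal b <= _); first by rewrite ler_pM2r.
have -> : C * (lam * m%:R) * Nal b = C * (m%:R * (lam * Nal b)) by ring.
by rewrite ler_pM2l// ler_pM2l// (le_trans h2).
Qed.

End survival.

(** * Reaching a stack with both counts large *)

Section hitting.
Context {R : realType} (p : R) (hp0 : 0 < p) (hp : p < 1 / 2).
Local Notation Ex := (word_ex p).
Local Notation pr := (pr p).
Local Notation Tg := (Tg p).
Variables (T : nat) (lo y : R).

Definition good (s : word) : bool :=
  [&& lo <= (cH s)%:R, lo <= (cC s)%:R & (size s)%:R <= y].

(* The probability of being alive and good at one of the times [0, T, ..., jT]. *)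
Fixpoint hit (j : nat) (s : word) : R :=
  if good s then 1 else
  if j is j'.+1 then Ex T (fun x => (alive s x)%:R * hit j' (act s x).2) else 0.

Lemma hit_ge0 j s : 0 <= hit j s.
Proof.
elim: j s => [|j IH] s /=; case: ifP => // _.
by apply: (Ex_ge0 hp0 hp) => x _; rewrite mulr_ge0.
Qed.

Lemma pr_alive_cat n k s (Q : word -> bool) :
  pr (n + k) (fun x => alive s x && Q (act s x).2) =
  Ex n (fun x => (alive s x)%:R * pr k (fun y => alive (act s x).2 y && Q (act (act s x).2 y).2)).
Proof.
rewrite /pr Ex_cat; apply: Ex_ext => x _; rewrite -ExZ; apply: Ex_ext => z _.
by rewrite alive_cat act_cat; case: (alive s x) => /=; rewrite ?mul1r ?mul0r.
Qed.

Lemma pr_alive_cat' n k s : pr (n + k) (alive s) =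
  Ex n (fun x => (alive s x)%:R * pr k (alive (act s x).2)).
Proof.
rewrite /pr Ex_cat; apply: Ex_ext => x _; rewrite -ExZ; apply: Ex_ext => z _.
by rewrite alive_cat; case: (alive s x) => /=; rewrite ?mul1r ?mul0r.
Qed.

(** The strategy stops at the first good time; from a good stack the target has probability at least
    [q] whatever number of blocks is left. *)
Lemma Tg_hit (q : R) tau0 h c J s : all is_burger s -> 0 <= q ->
  (forall i s, (i <= J)%N -> all is_burger s -> good s ->
     odd (h + c) = odd (size s + (tau0 + i * T)) -> q <= Tg (tau0 + i * T) s h c) ->
  odd (h + c) = odd (size s + (tau0 + J * T)) ->
  q * hit J s <= Tg (tau0 + J * T) s h c.
Proof.
move=> + q0; elim: J s => [|J IH] s bs hq par /=.
  case: (boolP (good s)) => gs; last by rewrite mulr0; exact: pr_ge0.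
  by rewrite mulr1; exact: hq.
case: (boolP (good s)) => gs; first by rewrite mulr1; exact: hq.
have -> : (tau0 + J.+1 * T = T + (tau0 + J * T))%N by rewrite mulSn; lia.
rewrite Tg_cat -ExZ; apply: (Ex_le hp0 hp) => x xT.
case: (boolP (alive s x)) => ax; last by rewrite !mul0r mulr0.
rewrite !mul1r; apply: IH.
- exact: act_stack_all.
- by move=> i s' iJ; apply: hq; exact: leqW.
have := @odd_alive R s x bs ax; rewrite xT => o1.
rewrite par mulSn !oddD o1 !oddD; clear.
by case: (odd (size s)); case: (odd T); case: (odd tau0); case: (odd (J * T)).
Qed.

Variable c0 : R.
Hypothesis c01 : 0 < c0 <= 1.
Hypothesis kill : c0 <= pr T (fun x => lo <= (oH x)%:R).

(** With fewer than [lo] hamburgers, a block containing [lo] unfulfilled hamburger orders is fatal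
    however the stack is arranged; the exchange symmetry covers cheeseburgers. *)
Lemma kill_step s : all is_burger s -> ~~ good s -> (size s)%:R <= y ->
  pr T (alive s) <= 1 - c0.
Proof.
move=> bs ng sy; have kill' : c0 <= pr T (fun x => lo <= (oC x)%:R).
  rewrite -(pr_flip p); apply: le_trans kill _; apply: (pr_le hp0 hp) => x _.
  by have [_ _ _ -> _] := stats_flip x.
have h (n : nat) (o : word -> nat) : c0 <= pr T (fun x => lo <= (o x)%:R) ->
    n%:R < lo -> (forall x, alive s x -> (o x <= n)%N) -> pr T (alive s) <= 1 - c0.
  move=> k1 k2 k3; apply: le_trans (_ : 1 - pr T (fun x => lo <= (o x)%:R) <= _); last first.
    by rewrite lerD2l lerN2.
  rewrite -(pr_compl p); apply: (pr_le hp0 hp) => x _ ax; rewrite -ltNge.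
  by apply: le_lt_trans k2; rewrite ler_nat k3.
move: ng; rewrite /good sy andbT negb_and -!ltNge => /orP[h1|h1].
  by apply: (h _ oH kill h1) => x ax; case: (aliveW bs ax).
by apply: (h _ oC kill' h1) => x ax; case: (aliveW bs ax).
Qed.

(** At each block time a live stack is good, or too large, or is killed by the next block with
    probability at least [c0]. *)
Lemma alive_hit j s : all is_burger s ->
  pr (j * T) (alive s) <= hit j s + (1 - c0) ^+ j +
  \sum_(i < j.+1) pr (i * T) (fun x => alive s x && (y < (size (act s x).2)%:R)).
Proof.
have [c0_gt0 c0_le1] := andP c01.
elim: j s => [|j IH] s bs; set big := \sum_(i < _) _.
  have b0 : 0 <= big by apply: sumr_ge0 => i _; exact: pr_ge0.
  have := pr_le1 hp0 hp (0 * T) (alive s); have := hit_ge0 0 s; rewrite expr0; lra.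
have b0 : 0 <= big by apply: sumr_ge0 => i _; exact: pr_ge0.
have e0 : 0 <= (1 - c0) ^+ j.+1 by rewrite exprn_ge0// subr_ge0.
have p1 := pr_le1 hp0 hp (j.+1 * T) (alive s).
case: (boolP (good s)) => gs; first by rewrite /= gs; move: b0 e0 p1; lra.
case: (leP (size s)%:R y) => sy; last first.
  suff : 1 <= big by have := hit_ge0 j.+1 s; move: e0 p1; lra.
  rewrite /big big_ord_recl mul0n /pr; cbn [word_ex].
  rewrite alive_nil /act /= sy lerDl; apply: sumr_ge0 => i _; exact: pr_ge0.
have hk := kill_step bs gs sy.
rewrite mulSn pr_alive_cat'.
have -> : hit j.+1 s = Ex T (fun x => (alive s x)%:R * hit j (act s x).2).
  by rewrite /= (negbTE gs).
pose B j s := \sum_(i < j.+1) pr (i * T) (fun x => alive s x && (y < (size (act s x).2)%:R)).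
apply: le_trans (_ : Ex T (fun x => (alive s x)%:R * hit j (act s x).2 +
   (1 - c0) ^+ j * (alive s x)%:R + (alive s x)%:R * B j (act s x).2) <= _).
  apply: (Ex_le hp0 hp) => x _; case: (boolP (alive s x)) => ax; last by rewrite !mul0r mulr0 !addr0.
  by rewrite !mul1r mulr1; apply: IH; exact: act_stack_all.
rewrite !ExD ExZ; apply: lerD; first apply: lerD => //.
  rewrite exprSr; apply: ler_wpM2l => //; rewrite exprn_ge0// subr_ge0//.
rewrite /big big_ord_recl; apply: le_trans (_ : \sum_(i < j.+1) pr (lift ord0 i * T)
   (fun x => alive s x && (y < (size (act s x).2)%:R)) <= _); last by rewrite lerDr pr_ge0.
rewrite le_eqVlt; apply/orP; left; apply/eqP.
under eq_bigr => i _ do rewrite lift0 mulSn (pr_alive_cat _ _ s (fun s => y < (size s)%:R)).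
rewrite -(Ex_sum p T j.+1 (fun i x => (alive s x)%:R * pr (i * T) (fun z =>
   alive (act s x).2 z && (y < (size (act (act s x).2 z).2)%:R)))).
by apply: Ex_ext => x _; rewrite mulr_sumr.
Qed.

End hitting.

Lemma time_split (n J n1 m0 k0 : nat) : (0 < J)%N ->
  (4 * (maxn m0 (J * k0.+1)).+1 + 2 * n1 <= n)%N ->
  let m := (n %/ 4)%N in let T := (m %/ J)%N in
  [/\ (0 < m)%N, (m0 <= m)%N, (k0 <= T)%N & (0 < T)%N] /\
  [/\ (J * T <= m)%N, (2 * m <= n)%N, (n <= 16 * J * T)%N, (m <= n)%N &
    forall i, (i <= J)%N -> let tau := (n - m - J * T + i * T)%N in
      [/\ (tau <= n)%N, (n <= 4 * tau)%N & (n1 <= tau)%N]].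
Proof.
move=> J0 hn m T; have m4 : (4 * m <= n)%N by rewrite mulnC leq_divM.
have m4' : (n < 4 * m + 4)%N by have := divn_eq n 4; have := ltn_pmod n (isT : 0 < 4)%N; rewrite -/m; lia.
have JT : (J * T <= m)%N by rewrite mulnC leq_divM.
have h1 : (m0 <= maxn m0 (J * k0.+1))%N by exact: leq_maxl.
have h2 : (J * k0.+1 <= maxn m0 (J * k0.+1))%N by exact: leq_maxr.
have mM : (maxn m0 (J * k0.+1) <= m)%N by lia.
have kT : (k0.+1 <= T)%N by rewrite /T leq_divRL// mulnC; lia.
have JT' : (m < J * T + J)%N by have := divn_eq m J; have := ltn_pmod m J0; rewrite -/T; lia.
have JTJ : (J <= J * T)%N by rewrite leq_pmulr//; lia.
split; first by split; lia.
split; try lia.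
move=> i iJ tau; have iT : (i * T <= J * T)%N by rewrite leq_mul2r iJ orbT.
by rewrite /tau; split; lia.
Qed.

(** * The lower bound for large n *)

Section large_times.
Context {R : realType} (p : R) (hp0 : 0 < p) (hp : p < 1 / 2).
Local Notation Ex := (word_ex p).
Local Notation pr := (pr p).
Local Notation Tg := (Tg p).
Local Notation Nal := (survival p).

Lemma pow_small (c0 : R) : 0 < c0 <= 1 ->
  exists J, (0 < J)%N /\ (1 - c0) ^+ J <= 1 / 8.
Proof.
move=> /andP[c00 c01]; have [J hJ] := ex_nat_gt (7 / c0).
(* Bernoulli's inequality applied to the inverse power. *)
have main j : (1 - c0) ^+ j * (1 + j%:R * c0) <= 1.
  elim: j => [|j IH]; first by rewrite expr0 mul0r addr0 mulr1.
  rewrite exprSr -[j.+1%:R]natr1; apply: le_trans IH; rewrite -mulrA ler_wpM2l//.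
    by rewrite exprn_ge0// subr_ge0.
  have := ler0n R j; move: (j%:R : R) => z z0.
  have : 0 <= c0 ^+ 2 * (z + 1) by rewrite mulr_ge0 ?sqr_ge0// addr_ge0.
  by move=> ?; lra.
rewrite ltr_pdivrMr// in hJ.
exists J; split.
  rewrite -(ltr_nat R); rewrite ltNge; apply/negP => h.
  have : J%:R * c0 <= 0 by rewrite -(mul0r c0) ler_wpM2r// ltW.
  by move: hJ; lra.
have e0 : 0 <= (1 - c0) ^+ J by rewrite exprn_ge0// subr_ge0.
have := main J; have : (1 - c0) ^+ J * 8 <= (1 - c0) ^+ J * (1 + J%:R * c0).
  by apply: ler_wpM2l => //; lra.
by move=> ? ?; lra.
Qed.

Lemma sqrt_nat_le (a b : nat) (k : R) : 0 <= k -> (a%:R <= k ^+ 2 * b%:R) ->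
  Num.sqrt a%:R <= k * Num.sqrt b%:R :> R.
Proof.
move=> k0 h; rewrite -{1}(ger0_norm k0) -sqrtr_sqr -sqrtrM ?sqr_ge0//.
exact: ler_wsqrtr.
Qed.

(** Survival up to [m + J * T], a time before [2 * m], keeps at least half of [Nal m]. Stacks that
    are never good or that get too large account for an eighth each, so at least a quarter of
    [Nal m] meets a good stack. *)
Lemma large_times (C lam : R) m0 : 1 <= C -> 1 / 2 < lam ->
  (forall m, (m0 <= m)%N -> lam * Nal m <= Nal (2 * m)) ->
  exists (a : R) n0, 0 < a /\ forall n h c, (n0 <= n)%N ->
    let r := Num.sqrt n%:R in
    r <= C * h%:R -> h%:R <= C * r -> r <= C * c%:R -> c%:R <= C * r ->
    odd (h + c) = odd n -> a / n%:R * Nal n <= Tg n [::] h c.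
Proof.
move=> C1 l1 Hl; have [CK CK0 HK] := sum_survival hp0 hp l1 Hl.
have [ck [c0 [ck0 c00 [k0 Hk]]]] := kill hp0 hp.
have c01 : 0 < c0 <= 1.
  by rewrite c00 /=; apply: le_trans (Hk k0 (leqnn _)) _; exact: pr_le1.
have [J [J0 HJ]] := pow_small c01.
(* This [K] brings the union bound over the [J + 1] block times below [Nal m / 8]. *)
pose K := 1 + 16 * CK * J.+1%:R.
have zK : 0 < 16 * CK * J.+1%:R by rewrite !mulr_gt0.
have K1 : 1 <= K by rewrite lerDl ltW.
have K0 : 0 < K by apply: lt_le_trans K1.
have sJ : 0 <= 4 * Num.sqrt J%:R / ck by rewrite divr_ge0 ?(ltW ck0)// mulr_ge0 ?sqrtr_ge0.
pose L0 := 1 + 4 * Num.sqrt J%:R / ck + 2 * K + 2 * C.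
have L01 : 1 <= L0 by rewrite /L0; lra.
have L02 : 4 * Num.sqrt J%:R / ck <= L0 by rewrite /L0; lra.
have L03 : 2 * K <= L0 by rewrite /L0; lra.
have L04 : 2 * C <= L0 by rewrite /L0; lra.
have L05 : C <= L0 by lra.
have L00 : 0 <= L0 by lra.
have [q0 [n1 [q00 HL]]] := local_lemma hp0 hp L01.
exists (q0 / 4), (4 * (maxn m0 (J * k0.+1)).+1 + 2 * n1)%N; split; first by rewrite divr_gt0.
move=> n h c hn r hr1 hr2 cr1 cr2 par.
have := time_split J0 hn; set m := (n %/ 4)%N; set T := (m %/ J)%N.
move=> [[m_gt0 m0m k0T T_gt0] [JTm m2n nJT mn htau]].
have n_gt0 : (0 < n)%N := leq_trans m_gt0 mn.
have nR : 0 < n%:R :> R by rewrite ltr0n.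
pose tau0 := (n - m - J * T)%N.
pose lo := ck * Num.sqrt T%:R; pose y := K * Num.sqrt m%:R.
have r0 : 0 <= r := sqrtr_ge0 _.
have rlo : r <= L0 * lo.
  apply: le_trans (_ : 4 * Num.sqrt J%:R / ck * lo <= _); last first.
    by rewrite ler_wpM2r// mulr_ge0 ?sqrtr_ge0 ?ltW.
  have -> : 4 * Num.sqrt J%:R / ck * lo = 4 * Num.sqrt J%:R * Num.sqrt T%:R.
    by rewrite /lo; field; rewrite gt_eqF.
  rewrite -mulrA -sqrt_mulnR; apply: sqrt_nat_le => //.
  by rewrite -natrX -natrM ler_nat; move: nJT; rewrite -mulnA.
have hloc i s : (i <= J)%N -> all is_burger s -> good lo y s ->
    odd (h + c) = odd (size s + (tau0 + i * T)) -> q0 / n%:R <= Tg (tau0 + i * T) s h c.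
  move=> iJ bs /and3P[gH gC gS] opar; have [t1 t2 t3] := htau i iJ.
  set tau := (tau0 + i * T)%N in opar *; rewrite -/tau0 -/tau in t1 t2 t3.
  have tau_gt0 : (0 < tau)%N by move: n_gt0 t2; clear; lia.
  apply: le_trans (_ : q0 / tau%:R <= _).
    by rewrite ler_pM2l// lef_pV2 ?posrE ?ltr0n// ler_nat.
  have rt1 : Num.sqrt tau%:R <= r by apply: ler_wsqrtr; rewrite ler_nat.
  have rt2 : r <= 2 * Num.sqrt tau%:R.
    by apply: sqrt_nat_le => //; rewrite -natrX -natrM ler_nat.
  have st0 : 0 <= Num.sqrt tau%:R :> R := sqrtr_ge0 _.
  have up (x z : R) : 0 <= z -> 2 * z <= L0 -> x <= z * r -> x <= L0 * Num.sqrt tau%:R.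
    move=> z0 zL xz; apply: le_trans xz _.
    apply: le_trans (_ : z * (2 * Num.sqrt tau%:R) <= _); first by rewrite ler_wpM2l.
    by rewrite mulrA [z * 2]mulrC ler_wpM2r.
  have sm : Num.sqrt m%:R <= r by apply: ler_wsqrtr; rewrite ler_nat.
  have cr (z : nat) : (z%:R <= (size s)%:R :> R) -> z%:R <= K * r.
    by move=> hz; apply: le_trans (le_trans hz gS) _; rewrite /y ler_pM2l.
  have szs : (size s)%:R = (cH s)%:R + (cC s)%:R :> R by rewrite size_burgers// natrD.
  have lw (z : nat) : lo <= z%:R -> Num.sqrt tau%:R <= L0 * z%:R.
    move=> hz; apply: le_trans (le_trans rt1 rlo) _; exact: ler_wpM2l.
  have lw' (z : nat) : r <= C * z%:R -> Num.sqrt tau%:R <= L0 * z%:R.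
    by move=> hz; apply: le_trans (le_trans rt1 hz) _; rewrite ler_wpM2r.
  have Cge : 0 <= C by apply: le_trans C1.
  apply: HL => //; first by exact: lw.
  - by apply: (up _ K) => //; [exact: ltW|apply: cr; rewrite szs lerDl].
  - exact: lw.
  - by apply: (up _ K) => //; [exact: ltW|apply: cr; rewrite szs lerDr].
  - exact: lw'.
  - exact: (up _ C).
  - exact: lw'.
  - exact: (up _ C).
have Hk' : c0 <= pr T (fun x => lo <= (oH x)%:R) := Hk T k0T.
have mJT : (m + J * T <= 2 * m)%N by rewrite mul2n -addnn leq_add2l.
have Nm := survival_ge0 hp0 hp m.
pose H := Ex m (fun x => (alive [::] x)%:R * hit p T lo y J (act [::] x).2).
have hbig i : (i <= J)%N ->
    pr (m + i * T) (fun x => alive [::] x && (y < (size (act [::] x).2)%:R)) <=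
    2 * CK * Nal m / K.
  move=> iJ; have sm0 : 0 < Num.sqrt m%:R :> R by rewrite sqrtr_gt0 ltr0n.
  apply: le_trans (big_prob hp0 hp _ (mulr_gt0 K0 sm0)) _.
  rewrite exprMn sqr_sqrtr//; have mR : 0 < m%:R :> R by rewrite ltr0n.
  apply: le_trans (_ : (CK * ((2 * m)%:R * Nal (2 * m))) / (K ^+ 2 * m%:R) <= _).
    rewrite ler_pM2r ?invr_gt0 ?mulr_gt0 ?exprn_gt0//.
    apply: le_trans (HK (2 * m)%N _); last by rewrite muln_gt0.
    have im : (m + i * T <= 2 * m)%N.
      by apply: leq_trans mJT; rewrite leq_add2l leq_mul2r iJ orbT.
    rewrite -(subnKC im) -!(big_mkord xpredT (fun i => Nal i)).
    rewrite [leRHS](big_cat_nat _ (leq_addr _ _))//= lerDl.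
    by apply: sumr_ge0 => k _; exact: survival_ge0.
  have N2 : Nal (2 * m) <= Nal m by apply: survival_decr => //; rewrite leq_pmull.
  apply: le_trans (_ : CK * ((2 * m)%:R * Nal m) / (K ^+ 2 * m%:R) <= _).
    by rewrite ler_pM2r ?invr_gt0 ?mulr_gt0 ?exprn_gt0// ler_pM2l// ler_pM2l// ltr0n muln_gt0.
  have -> : CK * ((2 * m)%:R * Nal m) / (K ^+ 2 * m%:R) = 2 * CK * Nal m / K / K.
    by rewrite natrM; field; rewrite !gt_eqF.
  by rewrite ler_pdivrMr// ler_peMr// divr_ge0 ?(ltW K0)// mulr_ge0// mulr_ge0// ltW.
have h1 : Nal (m + J * T) <= H + (1 - c0) ^+ J * Nal m + J.+1%:R * (2 * CK * Nal m / K).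
  rewrite /survival pr_alive_cat'.
  apply: le_trans (_ : Ex m (fun x => (alive [::] x)%:R * hit p T lo y J (act [::] x).2 +
      (1 - c0) ^+ J * (alive [::] x)%:R + \sum_(i < J.+1) (alive [::] x)%:R *
      pr (i * T) (fun z => alive (act [::] x).2 z && (y < (size (act (act [::] x).2 z).2)%:R))) <= _).
    apply: (Ex_le hp0 hp) => x _; case: (boolP (alive [::] x)) => ax; last first.
      by rewrite !mul0r mulr0 !add0r; apply: sumr_ge0 => i _; rewrite mul0r.
    rewrite !mul1r mulr1; under eq_bigr => i _ do rewrite mul1r.
    by apply: alive_hit => //; exact: act_stack_all.
  rewrite !ExD ExZ (Ex_sum p m J.+1 (fun i x => (alive [::] x)%:R *
      pr (i * T) (fun z => alive (act [::] x).2 z && (y < (size (act (act [::] x).2 z).2)%:R)))).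
  rewrite lerD2l; apply: le_trans (_ : \sum_(i < J.+1) 2 * CK * Nal m / K <= _).
    apply: ler_sum => i _; rewrite -(pr_alive_cat p m (i * T) [::] (fun s => y < (size s)%:R)).
    by apply: hbig; rewrite -ltnS.
  by rewrite sumr_const card_ord -[X in X <= _]mulr_natl.
have h2 : J.+1%:R * (2 * CK * Nal m / K) <= 1 / 8 * Nal m.
  have -> : J.+1%:R * (2 * CK * Nal m / K) = (16 * CK * J.+1%:R) / K * (1 / 8 * Nal m).
    by field; rewrite gt_eqF.
  rewrite ler_piMl ?mulr_ge0// ler_pdivrMr// mul1r /K lerDr//.
have h3 : (1 - c0) ^+ J * Nal m <= 1 / 8 * Nal m by rewrite ler_wpM2r.
have h4 : lam * Nal m <= Nal (m + J * T).
  by apply: le_trans (Hl m m0m) _; apply: survival_decr.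
have h5 : 1 / 2 * Nal m <= lam * Nal m by rewrite ler_wpM2r// ltW.
have h6 : Nal n <= Nal m by apply: survival_decr.
have nE : n = (m + (tau0 + J * T))%N by move: JTm m2n; rewrite /tau0; clear; lia.
rewrite [in Tg n]nE Tg_cat; apply: le_trans (_ : q0 / n%:R * H <= _).
  have -> : q0 / 4 / n%:R * Nal n = q0 / n%:R * (Nal n / 4) by field; rewrite gt_eqF.
  by rewrite ler_pM2l ?divr_gt0//; lra.
rewrite -ExZ; apply: (Ex_le hp0 hp) => x xm.
case: (boolP (alive [::] x)) => ax; last by rewrite !mul0r mulr0.
have hq : 0 <= q0 / n%:R by rewrite divr_ge0// ltW.
rewrite !mul1r; apply: (Tg_hit hp0 hp (@act_stack_all [::] x isT) hq hloc).
rewrite par {1}nE !oddD (@odd_alive R [::] x isT ax) xm.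
by rewrite add0n.
Qed.

End large_times.

(** * The sequence of letters as a random word *)

Section small_times.
Context {R : realType} (p : R) (hp0 : 0 < p) (hp : p < 1 / 2).
Local Notation Tg := (Tg p).

Lemma act_pairs s k : act s (flatten (nseq k [:: BH; OH])) = ([::], s).
Proof. by elim: k => //= k IH; rewrite act_cons// (act_cons_ord (s' := s)). Qed.

Lemma act_nseq s n t : is_burger t -> act s (nseq n t) = ([::], nseq n t ++ s).
Proof.
by move=> bt; rewrite /act foldl_burgers ?rev_nseq// all_nseq bt orbT.
Qed.

Lemma target_word h c k :
  target h c [::] (nseq h BH ++ nseq c BC ++ flatten (nseq k [:: BH; OH])).
Proof.
rewrite /target /alive !act_cat !act_nseq//= act_pairs /= cats0.
by rewrite cH_cat cC_cat /cH /cC !count_nseq /= !mul0n !mul1n add0n addn0 !eqxx.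
Qed.

(** The pairs of a hamburger and its order cancel and fill the remaining even number of letters. *)
Lemma Tg_gt0 n h c : (h + c <= n)%N -> odd (h + c) = odd n ->
  (p / 4) ^+ n <= Tg n [::] h c.
Proof.
move=> hc par; pose k := (n - (h + c))./2.
pose x := nseq h BH ++ nseq c BC ++ flatten (nseq k [:: BH; OH]).
have sx : size x = n.
  have hk : (h + c + k.*2 = n)%N by rewrite /k; move: hc par; clear; lia.
  rewrite !size_cat !size_nseq size_flatten /shape map_nseq sumn_nseq /= -hk.
  by clear; lia.
have := @word_prob R p hp0 hp x (fun y => (target h c [::] y)%:R) (fun=> ler0n _ _).
by rewrite sx target_word mulr1.
Qed.

End small_times.

(** * From recursive expectations to the probability space *)

Section bridge.
Context {d} {T : measurableType d} {R : realType} {P : probability T R}.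
Context (p : R) (X : int -> {RV P >-> theta}) (hX : iid_theta p X).

Definition sample (n : nat) (w : T) : word := [seq X (1 + k%:Z) w | k <- iota 0 n].

Definition weight (x : word) : R := \prod_(t <- x) theta_law p t.

Lemma sampleS n w : sample n.+1 w = rcons (sample n w) (X (1 + n%:Z) w).
Proof. by rewrite /sample -addn1 iotaD map_cat cats1. Qed.

Lemma size_sample n w : size (sample n w) = n.
Proof. by rewrite size_map size_iota. Qed.

Lemma cylinder (u : word) :
  measurable [set w | sample (size u) w = u] /\
  P [set w | sample (size u) w = u] = (weight u)%:E.
Proof.
have [ind law] := hX; pose s : seq int := [seq 1 + k%:Z | k <- iota 0 (size u)].
(* The letters start at index 1, so index [i] carries entry [i - 1] of [u]. *)
pose A (i : int) : set theta := [set nth BH u (absz (i - 1)%R)].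
have us : uniq s by rewrite map_inj_uniq ?iota_uniq// => a b /addrI [].
have idx k : absz (1 + k%:Z - 1)%R = k by rewrite addrC addrA addNr add0r.
have E : [set w | sample (size u) w = u] =
    \bigcap_(i in [set` seq_fset tt s]) (X i @^-1` A i).
  apply/seteqP; split => w /=.
    move=> e i si; have {}si : i \in seq_fset tt s := si.
    move: si; rewrite seq_fsetE => /mapP[k]; rewrite mem_iota => /= ku ->.
    change (X (1 + k%:Z) w = nth BH u (absz (1 + k%:Z - 1)%R)).
    by rewrite idx -[in RHS]e (nth_map 0%N) ?size_iota// nth_iota.
  move=> H; apply: (@eq_from_nth _ BH) => [|k]; rewrite size_sample// => ku.
  rewrite (nth_map 0%N) ?size_iota// nth_iota// add0n.
  have sk : 1 + k%:Z \in seq_fset tt s.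
    by rewrite seq_fsetE; apply/mapP; exists k => //; rewrite mem_iota.
  by have := H _ sk; rewrite /A /preimage /mkset idx.
have mA i : measurable (A i) by [].
split.
  rewrite E; apply: fin_bigcap_measurable => // i _.
  exact: measurable_funPTI.
rewrite E ind// (perm_big _ (seq_fset_perm _ _)) /= undup_id// big_map.
rewrite /weight (big_nth BH) /index_iota subn0.
have lawE i t : P (X i @^-1` [set t]) = (theta_law p t)%:E := law i t.
elim: (iota 0 (size u)) => [|k l IH]; first by rewrite !big_nil.
by rewrite !big_cons IH /A idx lawE -EFinM.
Qed.

Lemma measure5 (A : theta -> set T) (f : T -> theta) :
  (forall t, measurable (A t)) -> (forall t w, A t w -> f w = t) ->
  measurable [set w | A (f w) w] /\
  P [set w | A (f w) w] = (P (A BH) + P (A BC) + P (A OH) + P (A OC) + P (A OF))%E.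
Proof.
move=> mA Af.
have -> : [set w | A (f w) w] = A BH `|` A BC `|` A OH `|` A OC `|` A OF.
  apply/seteqP; split => w /=; first by case: (f w) => ?; tauto.
  by move=> [[[[]|]|]|] h; rewrite (Af _ _ h).
have dis (B C : set T) : (forall w, B w -> C w -> False) -> B `&` C = set0.
  by move=> h; apply/seteqP; split => // w [b c]; exact: h b c.
split; first by repeat apply: measurableU.
rewrite !measureU//; try by (repeat apply: measurableU).
all: apply: dis => w h1 h2; have e2 := Af _ _ h2.
all: repeat (destruct h1 as [h1|h1]); have e1 := Af _ _ h1; congruence.
Qed.

(** Induction on the number of unread letters, for all prefixes at once: the value of the next
    letter splits the event into five disjoint pieces ([measure5]). *)
Lemma pr_sample (Q : word -> bool) k u :
  measurable [set w | sample (size u) w = u /\ Q (sample (size u + k) w)] /\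
  P [set w | sample (size u) w = u /\ Q (sample (size u + k) w)] =
    (weight u * word_ex p k (fun v => (Q (u ++ v))%:R))%:E.
Proof.
elim: k u => [|k IH] u.
  rewrite addn0 /= cats0; have [m e] := cylinder u.
  case: (boolP (Q u)) => Qu.
    have -> : [set w | sample (size u) w = u /\ Q (sample (size u) w)] =
        [set w | sample (size u) w = u].
      by apply/seteqP; split => w /= => [[]//|eu]; rewrite eu.
    by rewrite mulr1.
  have -> : [set w | sample (size u) w = u /\ Q (sample (size u) w)] = set0.
    by apply/seteqP; split => w //= [-> ]; apply/negP.
  by rewrite mulr0 measure0.
pose A t := [set w | sample (size u).+1 w = rcons u t /\ Q (sample ((size u).+1 + k) w)].
have IHt t : measurable (A t) /\
    P (A t) = (weight (rcons u t) * word_ex p k (fun v => (Q (rcons u t ++ v))%:R))%:E.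
  by have := IH (rcons u t); rewrite size_rcons.
have Af t w : A t w -> X (1 + (size u)%:Z) w = t.
  by move=> [h _]; rewrite sampleS in h; case: (rcons_inj h).
have [m e] := measure5 (fun t => (IHt t).1) Af.
have -> : [set w | sample (size u) w = u /\ Q (sample (size u + k.+1) w)] =
    [set w | A (X (1 + (size u)%:Z) w) w].
  apply/seteqP; split => w /=; rewrite /A /mkset sampleS addSnnS => -[h1 h2]; split => //.
    by rewrite h1.
  by have [] := rcons_inj h1.
split => //; rewrite e.
have wt t : P (A t) = (weight u * (theta_law p t * word_ex p k (fun v => (Q (u ++ t :: v))%:R)))%:E.
  rewrite (IHt t).2 /weight big_rcons /=.
  rewrite mulrA; congr (_ * _)%:E; apply: Ex_ext => v _; by rewrite cat_rcons.
rewrite !wt -!EFinD; congr (_%:E); cbn [word_ex theta_law]; rewrite /letter_ex; ring.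
Qed.

Lemma sample_prob (Q : word -> bool) n :
  P [set w | Q (sample n w)] = (pr p n Q)%:E.
Proof.
have [_] := pr_sample Q n [::]; rewrite /weight big_nil mul1r => <-.
by congr (P _); apply/seteqP; split => w /= [].
Qed.

End bridge.

Section doubling.
Context {R : realType} (p : R) (hp0 : 0 < p) (hp : p < 1 / 2).
Local Notation Nal := (survival p).

(** The arctangent is below [pi / 2], so the denominator exceeds [pi]. *)
Lemma mu_lt1 : mu p < 1.
Proof.
have p0 := pi_gt0 R; have := atan_ltpi2 (Num.sqrt (1 - 2 * p) / p).
rewrite /mu; set x := atan _ => hx.
by rewrite ltr_pdivrMr ?mul1r; lra.
Qed.

Lemma pow2_gt : 1 / 2 < 2 `^ (- mu p) :> R.
Proof.
rewrite div1r -powR_inv1// /powR pnatr_eq0/= ltr_expR ltr_pM2r ?ltrN2 ?mu_lt1//.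
by rewrite ln_gt0// ltr1n.
Qed.

(** The ratio of the survival probabilities at [2 * m] and [m] tends to 2 to the power [- mu p],
    which exceeds 1/2; [lam] is the midpoint of the two. *)
Lemma survival_doubling (psi : R -> R) : (forall t, 0 <= t -> 0 < psi t) ->
  slowly_varying psi ->
  (forall n, (0 < n)%N -> Nal n = psi n%:R * n%:R `^ (- mu p)) ->
  exists (lam : R) m0, 1 / 2 < lam /\
    forall m, (m0 <= m)%N -> lam * Nal m <= Nal (2 * m).
Proof.
move=> psi0 sv NE; set z : R := 2 `^ (- mu p).
have z2 : 1 / 2 < z := pow2_gt; have z0 : 0 < z by lra.
pose lam := (z + 1 / 2) / 2.
have lz : lam / z < 1 by rewrite ltr_pdivrMr// mul1r /lam; lra.
have [A [_ HA]] := cvgr_gt _ (sv 2 (ltr0n R 2)) _ lz.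
have [m0 hm0] := ex_nat_gt A.
exists lam, m0.+1; split; first by rewrite /lam; lra.
move=> m m0m; have m_gt0 : (0 < m)%N by apply: leq_trans m0m.
have mA : A < m%:R by apply: lt_le_trans hm0 _; rewrite ler_nat ltnW.
have := HA m%:R mA; rewrite ltr_pdivlMr ?psi0// => h.
rewrite !NE ?muln_gt0// natrM powRM// -/z.
have y0 : 0 <= m%:R `^ (- mu p) by exact: powR_ge0.
have -> : lam * (psi m%:R * m%:R `^ (- mu p)) = lam / z * psi m%:R * z * m%:R `^ (- mu p).
  by field; rewrite gt_eqF.
by rewrite mulrA ler_wpM2r// ler_pM2r// ltW.
Qed.

End doubling.

Section events.
Context {d} {T : measurableType d} {R : realType} {P : probability T R}.
Context (p : R) (X : int -> {RV P >-> theta}) (hX : iid_theta p X).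

Lemma event_IE n : event_I_gt X n = [set w | alive [::] (sample X n w)].
Proof.
rewrite event_I_gtE; apply/seteqP; split => w /=;
  by rewrite /Xred letters1 has_order_reduceE negbK.
Qed.

Lemma event_EE n h c : event_E X n h c = [set w | target h c [::] (sample X n w)].
Proof.
have e w : Xred X 1 n%:Z w = reduce (sample X n w) by rewrite /Xred letters1.
apply/seteqP; split => w; rewrite /event_E /target /mkset e has_order_reduceE negbK
    !count_reduce /alive -/(orders _) -/(stack _).
  by move=> [/eqP -> <- <-]; rewrite /cH /cC !add0n !eqxx.
by move=> /and3P[/eqP -> /eqP <- /eqP <-].
Qed.

Lemma prob_I n : fine (P (event_I_gt X n)) = survival p n.
Proof. by rewrite event_IE (sample_prob hX (alive [::])). Qed.

Lemma prob_E n h c : fine (P (event_E X n h c)) = Tg p n [::] h c.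
Proof. by rewrite event_EE (sample_prob hX (target h c [::])). Qed.

Lemma cond_probE n h c :
  cond_prob P (event_E X n h c) (event_I_gt X n) = Tg p n [::] h c / survival p n.
Proof.
rewrite /cond_prob prob_I -prob_E; congr (fine (P _) / _).
rewrite event_EE event_IE; apply/seteqP; split => w /=; first by case.
by move=> h'; split => //; case/and3P: h'.
Qed.

End events.

Theorem proposition3p5 (R : realType) (p : R) (hp0 : 0 < p) (hp : p < 1 / 2)
    (C : R) (hC : 1 < C) :
  exists a a' : R, [/\ 0 < a, 0 < a' &
    forall (d : measure_display) (T : measurableType d) (P : probability T R)
      (X : int -> {RV P >-> theta}) (psi0 : R -> R),
      iid_theta p X ->
      (forall t : R, 0 <= t -> 0 < psi0 t) ->
      slowly_varying psi0 ->
      (forall n : nat, (0 < n)%N ->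
        fine (P (event_I_gt X n)) = psi0 n%:R * n%:R `^ (- mu p)) ->
      forall n h c : nat,
        C ^+ 2 <= n%:R ->
        C^-1 * Num.sqrt n%:R <= h%:R <= C * Num.sqrt n%:R ->
        C^-1 * Num.sqrt n%:R <= c%:R <= C * Num.sqrt n%:R ->
        (h + c <= n)%N ->
        odd (h + c) = odd n ->
        a * n%:R^-1 <= cond_prob P (event_E X n h c) (event_I_gt X n) /\
        a' * psi0 n%:R * n%:R `^ (-1 - mu p) <= fine (P (event_E X n h c))].
Proof.
(* The survival probabilities depend on p only, hence so do the constants
   obtained from an arbitrary admissible psi. *)
case: (pselect (exists psi : R -> R, [/\ forall t, 0 <= t -> 0 < psi t, slowly_varying psi &
    forall n, (0 < n)%N -> survival p n = psi n%:R * n%:R `^ (- mu p)])); last first.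
  move=> no; exists 1, 1; split => // d T P X psi hX pos sv hpsi.
  exfalso; apply: no; exists psi; split => // n n0.
  by rewrite -hpsi// (prob_I hX).
move=> [psi [pos sv hpsi]].
have [lam [m0 [l2 Hl]]] := survival_doubling pos sv hpsi.
have [a1 [n0 [a10 H]]] := large_times hp0 hp (ltW hC) l2 Hl.
have p4 : 0 < p / 4 by rewrite divr_gt0.
have p41 : p / 4 <= 1 by lra.
(* [a1] serves [n >= n0]. For smaller [n] one explicit word has probability at least
   [(p / 4) ^+ n0], and the remaining factors of the bound are at most 1. *)
pose a := Num.min a1 ((p / 4) ^+ n0).
have a0 : 0 < a by rewrite lt_min a10 exprn_gt0.
exists a, a; split => // d T P X psi0 hX pos0 sv0 hpsi0 n h c hn /andP[h1 h2] /andP[c1 c2] hc par.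
have C0 : 0 < C by apply: lt_trans hC.
have nR : 0 < n%:R :> R by apply: lt_le_trans hn; rewrite exprn_gt0.
have n_gt0 : (0 < n)%N by rewrite -(ltr_nat R).
have N0 := survival_gt0 hp0 hp n.
have main : a / n%:R * survival p n <= Tg p n [::] h c.
  case: (leqP n0 n) => n0n.
    apply: le_trans (H n h c n0n _ h2 _ c2 par).
    - by rewrite ler_wpM2r ?(ltW N0)// ler_pM2r ?invr_gt0// ge_min lexx.
    - by rewrite mulrC -ler_pdivrMr// mulrC.
    - by rewrite mulrC -ler_pdivrMr// mulrC.
  apply: le_trans (Tg_gt0 hp0 hp hc par); apply: le_trans (_ : (p / 4) ^+ n0 * 1 * 1 <= _).
    apply: ler_pM; rewrite ?pr_le1 ?(ltW N0) ?divr_ge0 ?(ltW a0)//.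
    apply: ler_pM; rewrite ?invr_ge0 ?(ltW a0)//; first by rewrite ge_min lexx orbT.
    by rewrite invf_le1// ler1n.
  by rewrite !mulr1; apply: ler_wiXn2l; [exact: ltW|exact: p41|exact: ltnW].
split; first by rewrite (cond_probE hX) ler_pdivlMr.
rewrite (prob_E hX); apply: le_trans main.
rewrite -(prob_I hX) hpsi0// powRD; last by rewrite (gt_eqF nR) implybT.
rewrite powR_inv1; last exact: ltW.
by rewrite le_eqVlt; apply/orP; left; apply/eqP; ring.
Qed.
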